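(* Let $K$ be a field with $\mathrm{char}(K)=2$ and let $A=KQ/I$ be the Xu--Snashall algebra over $K$. Then the Hochschild cohomology ring $\mathrm{HH}^*(A)$ is isomorphic, as a graded algebra, to the commutative algebra $K[X]/J$, where $K[X]$ is the graded commutative polynomial algebra on $X=\{x_{n,1},x_{n,2}\mid n\ge0\}\cup\{x_{n,3},x_{n,4}\mid n\ge1\}$ with $|x_{n,i}|=n$, and $J$ is the ideal generated by the following homogeneous relations: - $x_{m,1}x_{n,1}$, $x_{m,1}x_{n,2}$, $x_{m,2}x_{n,2}$, for $m,n\ge0$; - $x_{m,2}x_{n,4}$, $x_{m,2}x_{n,3}-x_{m,1}x_{n,4}$, for $m\ge0$, $n\ge1$; - $x_{m,4}x_{n,4}$, $x_{m,1}x_{n,3}-x_{0,1}x_{m+n,3}$, $x_{m,1}x_{n,4}-x_{0,1}x_{m+n,4}$, for $m,n\ge1$; - $x_{m,3}x_{n,3}-x_{1,3}x_{m+n-1,3}$, $x_{m,3}x_{n,4}-x_{1,3}x_{m+n-1,4}$, for $m\ge2$, $n\ge1$. As a consequence, under this identification the ideal $\mathcal N$ of $\mathrm{HH}^*(A)$ generated by all homogeneous nilpotent elements has the $K$-linear basis $$\{x_{n,1},x_{n,2}\mid n\ge0\}\cup\{x_{n,4}\mid n\ge1\}\cup\{x_{0,1}(x_{1,3})^lx_{n,3},\ x_{0,1}(x_{1,3})^lx_{n,4},\ (x_{1,3})^{l+1}x_{n,4}\mid n\ge1,\ l\ge0\}.$$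
   Context: Xu--Snashall algebra: $Q$ is the quiver with two vertices $1,2$, two loops $a,b$ at vertex $1$ and one arrow $c\colon1\to2$. Paths are written from left to right (a product $\alpha\beta$ of arrows is a path if the target of $\alpha$ is the source of $\beta$). $I$ is the two-sided ideal of $KQ$ generated by $a^2,\ b^2,\ ab-ba,\ ac$, and $A=KQ/I$. $\mathrm{HH}^*(A)=\bigoplus_{n\ge0}\mathrm{HH}^n(A)$ with $\mathrm{HH}^n(A)=\mathrm{Ext}^n_{A^e}(A,A)$, $A^e=A\otimes_KA^{op}$, is regarded as a graded commutative algebra via the cup product, given on Hochschild cochains by $(f\cup g)(a_1\otimes\cdots\otimes a_{m+n})=(-1)^{mn}f(a_1\otimes\cdots\otimes a_m)g(a_{m+1}\otimes\cdots\otimes a_{m+n})$. (In characteristic $2$ graded commutative means commutative.) *)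

(* Defs.v *)
(* Mathematical Components + multinomials (monalg) + classical reasoning from
   mathcomp-classical (boolp).
   Conventions: paths are composed from left to right; the Hochschild cup
   product carries the sign (-1)^(mn). *)
From HB Require Import structures.
From mathcomp Require Import all_boot all_order all_algebra finmap boolp.
From mathcomp.multinomials Require Import monalg.

Set Implicit Arguments.
Unset Strict Implicit.
Unset Printing Implicit Defensive.

Import GRing.Theory.
Local Open Scope ring_scope.
Local Open Scope quotient_scope.

Section Ideals.
Variable R : nzRingType.

(* Two-sided ideal generated by S. *)
Inductive gen_ideal (S : R -> Prop) : R -> Prop :=
| gen_ideal_in x of S x : gen_ideal S x
| gen_ideal0 : gen_ideal S 0
| gen_idealD x y of gen_ideal S x & gen_ideal S y : gen_ideal S (x + y)
| gen_idealMl r x of gen_ideal S x : gen_ideal S (r * x)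
| gen_idealMr r x of gen_ideal S x : gen_ideal S (x * r).

Record proper_ideal2 := ProperIdeal2 {
  ideal2_set :> R -> Prop;
  ideal2_0 : ideal2_set 0;
  ideal2_D x y : ideal2_set x -> ideal2_set y -> ideal2_set (x + y);
  ideal2_Ml r x : ideal2_set x -> ideal2_set (r * x);
  ideal2_Mr r x : ideal2_set x -> ideal2_set (x * r);
  ideal2_1 : ~ ideal2_set 1
}.

Definition gen_proper_ideal2 (S : R -> Prop) (S1 : ~ gen_ideal S 1) :=
  @ProperIdeal2 (gen_ideal S) (gen_ideal0 S) (@gen_idealD S)
    (@gen_idealMl S) (@gen_idealMr S) S1.

Variable I : proper_ideal2.

Definition ideal2_pred : {pred R} := fun x => `[< I x >].

Lemma ideal2_predP x : reflect (I x) (x \in ideal2_pred).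
Proof. exact: asboolP. Qed.

Fact ideal2_zmod_closed : zmod_closed ideal2_pred.
Proof.
split=> [|x y /ideal2_predP Ix /ideal2_predP Iy]; apply/ideal2_predP.
  exact: ideal2_0.
by apply: ideal2_D => //; rewrite -mulN1r; apply: ideal2_Ml.
Qed.

HB.instance Definition _ := GRing.isZmodClosed.Build R ideal2_pred
  ideal2_zmod_closed.

End Ideals.

Section Quotient.
Variables (K : fieldType) (R : algType K) (I : proper_ideal2 R).

(* The quotient algebra R / I; ideals are Prop-valued predicates, made boolean
   by the classical [asbool]. *)
Definition quot2 : Type := Quotient.quot (@ideal2_pred R I).

HB.instance Definition _ := GRing.Zmodule.on quot2.

Definition quot2_pi (x : R) : quot2 := \pi_(Quotient.quot (@ideal2_pred R I)) x.

Lemma quot2_piP x y : reflect (I (x - y)) (quot2_pi x == quot2_pi y).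
Proof.
apply: (iffP idP) => [/eqP e|h].
  by apply/ideal2_predP; rewrite Quotient.idealrBE; apply/eqP.
by have /ideal2_predP := h; rewrite Quotient.idealrBE.
Qed.

Lemma quot2_pi_surj (u : quot2) : exists x, u = quot2_pi x.
Proof. by exists (repr u); rewrite /quot2_pi reprK. Qed.

Definition quot2_repr (u : quot2) : R := repr u.

Lemma quot2_reprK u : quot2_pi (quot2_repr u) = u.
Proof. exact: reprK. Qed.

Lemma quot2_pi_repr x : I (quot2_repr (quot2_pi x) - x).
Proof. by apply/quot2_piP; rewrite quot2_reprK. Qed.

Lemma quot2_piD x y : quot2_pi (x + y) = quot2_pi x + quot2_pi y.
Proof. by rewrite /quot2_pi !piE. Qed.

Definition quot2_one : quot2 := quot2_pi 1.
(* The operations are locked so that unification never unfolds them. *)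
Definition quot2_mul : quot2 -> quot2 -> quot2 :=
  locked (fun u v => quot2_pi (quot2_repr u * quot2_repr v)).
Definition quot2_scale : K -> quot2 -> quot2 :=
  locked (fun k u => quot2_pi (k *: quot2_repr u)).

Lemma quot2_piM x y : quot2_mul (quot2_pi x) (quot2_pi y) = quot2_pi (x * y).
Proof.
rewrite /quot2_mul -lock; apply/eqP/quot2_piP.
set a := quot2_repr _; set b := quot2_repr _.
have -> : a * b - x * y = a * (b - y) + (a - x) * y.
  by rewrite mulrBr mulrBl addrA subrK.
by apply: ideal2_D; [apply: ideal2_Ml | apply: ideal2_Mr]; apply: quot2_pi_repr.
Qed.

Lemma quot2_piZ k x : quot2_scale k (quot2_pi x) = quot2_pi (k *: x).
Proof.
rewrite /quot2_scale -lock; apply/eqP/quot2_piP; rewrite -scalerBr -mulr_algl.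
by apply: ideal2_Ml; apply: quot2_pi_repr.
Qed.

Fact quot2_mulA : associative quot2_mul.
Proof.
move=> u v w; have [x ->] := quot2_pi_surj u.
have [y ->] := quot2_pi_surj v; have [z ->] := quot2_pi_surj w.
by rewrite !quot2_piM mulrA.
Qed.

Fact quot2_mul1r : left_id quot2_one quot2_mul.
Proof. by move=> u; have [x ->] := quot2_pi_surj u; rewrite quot2_piM mul1r. Qed.

Fact quot2_mulr1 : right_id quot2_one quot2_mul.
Proof. by move=> u; have [x ->] := quot2_pi_surj u; rewrite quot2_piM mulr1. Qed.

Fact quot2_mulDl : left_distributive quot2_mul +%R.
Proof.
move=> u v w; have [x ->] := quot2_pi_surj u.
have [y ->] := quot2_pi_surj v; have [z ->] := quot2_pi_surj w.
by rewrite -quot2_piD !quot2_piM -quot2_piD mulrDl.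
Qed.

Fact quot2_mulDr : right_distributive quot2_mul +%R.
Proof.
move=> u v w; have [x ->] := quot2_pi_surj u.
have [y ->] := quot2_pi_surj v; have [z ->] := quot2_pi_surj w.
by rewrite -quot2_piD !quot2_piM -quot2_piD mulrDr.
Qed.

Lemma quot2_pi0 : quot2_pi 0 = 0.
Proof. by rewrite /quot2_pi !piE. Qed.

Fact quot2_one_neq0 : quot2_one != 0.
Proof.
rewrite -quot2_pi0; apply/negP => /quot2_piP; rewrite subr0.
exact: ideal2_1.
Qed.

HB.instance Definition _ := GRing.Zmodule_isNzRing.Build quot2
  quot2_mulA quot2_mul1r quot2_mulr1 quot2_mulDl quot2_mulDr quot2_one_neq0.

Fact quot2_scaleA a b v :
  quot2_scale a (quot2_scale b v) = quot2_scale (a * b) v.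
Proof. by have [x ->] := quot2_pi_surj v; rewrite !quot2_piZ scalerA. Qed.

Fact quot2_scale1 : left_id 1 quot2_scale.
Proof. by move=> v; have [x ->] := quot2_pi_surj v; rewrite quot2_piZ scale1r. Qed.

Fact quot2_scaleDr : right_distributive quot2_scale +%R.
Proof.
move=> a u v; have [x ->] := quot2_pi_surj u; have [y ->] := quot2_pi_surj v.
by rewrite -quot2_piD !quot2_piZ -quot2_piD scalerDr.
Qed.

Fact quot2_scaleDl v : {morph quot2_scale^~ v : a b / a + b}.
Proof.
move=> a b; have [x ->] := quot2_pi_surj v.
by rewrite /= !quot2_piZ -quot2_piD scalerDl.
Qed.

HB.instance Definition _ := GRing.Zmodule_isLmodule.Build K quot2
  quot2_scaleA quot2_scale1 quot2_scaleDr quot2_scaleDl.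

Fact quot2_scaleAl (a : K) (u v : quot2) : a *: (u * v) = (a *: u) * v.
Proof.
have [x ->] := quot2_pi_surj u; have [y ->] := quot2_pi_surj v.
change (quot2_scale a (quot2_mul (quot2_pi x) (quot2_pi y)) =
  quot2_mul (quot2_scale a (quot2_pi x)) (quot2_pi y)).
by rewrite quot2_piM !quot2_piZ quot2_piM scalerAl.
Qed.

HB.instance Definition _ := GRing.Lmodule_isLalgebra.Build K quot2
  quot2_scaleAl.

Fact quot2_scaleAr (a : K) (u v : quot2) : a *: (u * v) = u * (a *: v).
Proof.
have [x ->] := quot2_pi_surj u; have [y ->] := quot2_pi_surj v.
change (quot2_scale a (quot2_mul (quot2_pi x) (quot2_pi y)) =
  quot2_mul (quot2_pi x) (quot2_scale a (quot2_pi y))).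
by rewrite quot2_piM !quot2_piZ quot2_piM scalerAr.
Qed.

HB.instance Definition _ := GRing.Lalgebra_isAlgebra.Build K quot2
  quot2_scaleAr.

Fact quot2_pi_linear : linear quot2_pi.
Proof. by move=> k x y; rewrite quot2_piD -quot2_piZ. Qed.

HB.instance Definition _ := GRing.isLinear.Build K R quot2 _ quot2_pi
  quot2_pi_linear.

Fact quot2_pi_multiplicative : monoid_morphism quot2_pi.
Proof. by split=> // x y; rewrite -quot2_piM. Qed.

HB.instance Definition _ := GRing.isMonoidMorphism.Build R quot2 quot2_pi
  quot2_pi_multiplicative.
End Quotient.

Record quiver := Quiver {
  qvertex : finType;
  qarrow : finType;
  qsource : qarrow -> qvertex;
  qtarget : qarrow -> qvertex;
  qvertex_gt0 : (0 < #|qvertex|)%N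
}.

Section PathAlgebra.
Variable Q : quiver.

(* A path is a start vertex v and a composable list of arrows starting at v;
   (v, [::]) is the trivial path at v. *)
Fixpoint is_qpath (v : qvertex Q) (s : seq (qarrow Q)) : bool :=
  if s is x :: s' then (qsource x == v) && is_qpath (qtarget x) s' else true.

Definition qpath := {p : qvertex Q * seq (qarrow Q) | is_qpath p.1 p.2}.
HB.instance Definition _ := Choice.on qpath.

Definition psource (p : qpath) : qvertex Q := (val p).1.
Definition parrows (p : qpath) : seq (qarrow Q) := (val p).2.
Definition ptarget (p : qpath) : qvertex Q :=
  last (psource p) (map (@qtarget Q) (parrows p)).

Definition pid (v : qvertex Q) : qpath := exist _ (v, [::]) isT.

Fact parrow_subproof (x : qarrow Q) : is_qpath (qsource x) [:: x].
Proof. by rewrite /= eqxx. Qed.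

Definition parrow (x : qarrow Q) : qpath :=
  exist _ (qsource x, [:: x]) (parrow_subproof x).

Fact is_qpath_cat v s t : is_qpath v (s ++ t) =
  is_qpath v s && is_qpath (last v (map (@qtarget Q) s)) t.
Proof. by elim: s v => //= x s IHs v; rewrite IHs andbA. Qed.

(* First p, then q. *)
Definition pcomp (p q : qpath) : option qpath :=
  if ptarget p == psource q then
    (insub (psource p, parrows p ++ parrows q) : option qpath)
  else None.

Variant pcomp_spec (p q : qpath) : option qpath -> Prop :=
| PcompSome r of ptarget p = psource q & psource r = psource p
    & parrows r = parrows p ++ parrows q & ptarget r = ptarget q :
    pcomp_spec p q (Some r)
| PcompNone of ptarget p <> psource q : pcomp_spec p q None.

Lemma pcompP p q : pcomp_spec p q (pcomp p q).
Proof.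
rewrite /pcomp; case: eqP => [e|]; last by constructor.
case: insubP => [r hr vr|/negP[]].
  have [sr ar] : psource r = psource p /\ parrows r = parrows p ++ parrows q.
    by rewrite /psource /parrows vr.
  constructor=> //; rewrite /ptarget sr ar map_cat last_cat.
  by rewrite [X in last X _](_ : _ = ptarget p) // e.
by rewrite /= is_qpath_cat (valP p) -/(ptarget p) e (valP q).
Qed.

Lemma qpath_inj (p q : qpath) :
  psource p = psource q -> parrows p = parrows q -> p = q.
Proof.
move=> e1 e2; apply: val_inj; move: e1 e2; rewrite /psource /parrows.
by case: (val p) (val q) => [? ?] [? ?] /= -> ->.
Qed.

Lemma pcompA p q r :
  obind (pcomp p) (pcomp q r) = obind (fun u => pcomp u r) (pcomp p q).
Proof.
case: (pcompP q r) => [u e1 s1 a1 t1|n1]; case: (pcompP p q) => [w e2 s2 a2 t2|n2] //=.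
- case: (pcompP p u) => [x e3 s3 a3 t3|[]]; last by rewrite s1.
  case: (pcompP w r) => [y e4 s4 a4 t4|[]]; last by rewrite t2.
  congr Some; apply: qpath_inj; first by rewrite s3 s4.
  by rewrite a3 a4 a1 a2 catA.
- by case: (pcompP p u) => // x e3; case: n2; rewrite e3 s1.
- by case: (pcompP w r) => // x e3; case: n1; rewrite -t2.
Qed.

Lemma pcomp_idl v p : pcomp (pid v) p = if v == psource p then Some p else None.
Proof.
case: pcompP => [r e s a t|/eqP/negPf n]; last by rewrite n.
rewrite -[v]/(ptarget (pid v)) e eqxx; congr Some; apply: qpath_inj => //.
by rewrite s -e.
Qed.

Lemma pcomp_idr v p : pcomp p (pid v) = if v == ptarget p then Some p else None.
Proof.
case: pcompP => [r e s a t|/eqP/negPf n]; last by rewrite eq_sym n.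
rewrite -[v]/(psource (pid v)) -e eqxx; congr Some; apply: qpath_inj => //.
by rewrite a cats0.
Qed.

Variable K : fieldType.

Definition path_alg : Type := {malg K[qpath]}.
HB.instance Definition _ := GRing.Lmodule.on path_alg.

Implicit Types f g h : path_alg.

Definition path_basis (p : option qpath) : path_alg :=
  if p is Some r then mkmalgU r 1 else 0.

Definition path_mul : path_alg -> path_alg -> path_alg := locked (fun f g =>
  \sum_(p <- msupp f) \sum_(q <- msupp g)
    (mcoeff p f * mcoeff q g) *: path_basis (pcomp p q)).

Lemma path_mulE f g : path_mul f g =
  \sum_(p <- msupp f) \sum_(q <- msupp g)
    (mcoeff p f * mcoeff q g) *: path_basis (pcomp p q).
Proof. by rewrite /path_mul -lock. Qed.

Definition path_one : path_alg := \sum_v path_basis (Some (pid v)).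

Lemma path_mulw (d1 d2 : {fset qpath}) f g :
  (msupp f `<=` d1)%fset -> (msupp g `<=` d2)%fset ->
  path_mul f g = \sum_(p <- d1) \sum_(q <- d2)
    (mcoeff p f * mcoeff q g) *: path_basis (pcomp p q).
Proof.
move=> le1 le2; rewrite path_mulE (big_fset_incl _ le1) /=.
  apply: eq_bigr => p _; apply: big_fset_incl => // q _ /mcoeff_outdom ->.
  by rewrite mulr0 scale0r.
move=> p _ /mcoeff_outdom e.
by rewrite big1 // => q _; rewrite e mul0r scale0r.
Qed.

Fact path_mulDl : left_distributive path_mul +%R.
Proof.
move=> f g h; pose d := (msupp f `|` msupp g)%fset.
rewrite (@path_mulw d (msupp h)) ?fsubset_refl ?msuppD_le //.
rewrite (@path_mulw d (msupp h) f) ?fsubset_refl ?fsubsetUl //.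
rewrite (@path_mulw d (msupp h) g) ?fsubset_refl ?fsubsetUr //.
rewrite -big_split; apply: eq_bigr => p _ /=.
rewrite -big_split; apply: eq_bigr => q _ /=.
by rewrite mcoeffD mulrDl scalerDl.
Qed.

Fact path_mulDr : right_distributive path_mul +%R.
Proof.
move=> h f g; pose d := (msupp f `|` msupp g)%fset.
rewrite (@path_mulw (msupp h) d) ?fsubset_refl ?msuppD_le //.
rewrite (@path_mulw (msupp h) d h f) ?fsubset_refl ?fsubsetUl //.
rewrite (@path_mulw (msupp h) d h g) ?fsubset_refl ?fsubsetUr //.
rewrite -big_split; apply: eq_bigr => p _ /=.
rewrite -big_split; apply: eq_bigr => q _ /=.
by rewrite mcoeffD mulrDr scalerDl.
Qed.

Fact path_scaleAl (c : K) f g : c *: path_mul f g = path_mul (c *: f) g.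
Proof.
rewrite (@path_mulw (msupp f) (msupp g) (c *: f)) ?fsubset_refl ?msuppZ_le //.
rewrite path_mulE scaler_sumr; apply: eq_bigr => p _.
by rewrite scaler_sumr; apply: eq_bigr => q _; rewrite mcoeffZ scalerA mulrA.
Qed.

Fact path_scaleAr (c : K) f g : c *: path_mul f g = path_mul f (c *: g).
Proof.
rewrite (@path_mulw (msupp f) (msupp g) f (c *: g)) ?fsubset_refl ?msuppZ_le //.
rewrite path_mulE scaler_sumr; apply: eq_bigr => p _.
by rewrite scaler_sumr; apply: eq_bigr => q _; rewrite mcoeffZ scalerA mulrCA.
Qed.

Fact path_mul0l f : path_mul 0 f = 0.
Proof. by rewrite path_mulE msupp0 big_seq_fset0. Qed.

Fact path_mul0r f : path_mul f 0 = 0.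
Proof. by rewrite path_mulE msupp0 big1 // => p _; rewrite big_seq_fset0. Qed.

Fact path_mul_suml I (r : seq I) P (F : I -> path_alg) g :
  path_mul (\sum_(i <- r | P i) F i) g = \sum_(i <- r | P i) path_mul (F i) g.
Proof.
exact: (big_morph (path_mul^~ g) (fun x y => path_mulDl x y g) (path_mul0l g)).
Qed.

Fact path_mul_sumr I (r : seq I) P (F : I -> path_alg) g :
  path_mul g (\sum_(i <- r | P i) F i) = \sum_(i <- r | P i) path_mul g (F i).
Proof. exact: (big_morph (path_mul g) (path_mulDr g) (path_mul0r g)). Qed.

Fact path_mul_basis p q :
  path_mul (path_basis (Some p)) (path_basis (Some q)) = path_basis (pcomp p q).
Proof.
rewrite (path_mulw msuppU_le msuppU_le) !big_seq_fset1 !mcoeffUU.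
by rewrite mulr1 scale1r.
Qed.

Fact path_algE f : f = \sum_(p <- msupp f) mcoeff p f *: path_basis (Some p).
Proof.
rewrite [LHS]monalgE; apply: eq_bigr => p _.
by apply/malgP => q; rewrite mcoeffZ !mcoeffU mulrnAr mulr1.
Qed.

Fact path_mulA : associative path_mul.
Proof.
move=> f g h; rewrite (path_algE f) path_mul_suml.
rewrite [X in _ = path_mul X h]path_mul_suml [RHS]path_mul_suml.
apply: eq_bigr => p _; rewrite -!path_scaleAl; congr (_ *: _).
rewrite (path_algE g) [X in path_mul _ X = _]path_mul_suml [LHS]path_mul_sumr.
rewrite [X in _ = path_mul X h]path_mul_sumr [RHS]path_mul_suml.
apply: eq_bigr => q _; rewrite -!(path_scaleAl, path_scaleAr).
congr (_ *: _); rewrite (path_algE h).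
rewrite [X in path_mul _ X = _]path_mul_sumr [LHS]path_mul_sumr.
rewrite [RHS]path_mul_sumr; apply: eq_bigr => r _.
rewrite -!path_scaleAr; congr (_ *: _).
rewrite !path_mul_basis; have := pcompA p q r.
case: (pcomp q r) => [u|]; case: (pcomp p q) => [w|] //=.
- by rewrite !path_mul_basis => ->.
- by rewrite path_mul_basis => ->; rewrite path_mul0l.
- by rewrite path_mul_basis => <-; rewrite path_mul0r.
- by rewrite path_mul0l path_mul0r.
Qed.

Fact path_mul1l : left_id path_one path_mul.
Proof.
move=> f; rewrite [in RHS](path_algE f) [X in path_mul _ X](path_algE f).
rewrite path_mul_sumr; apply: eq_bigr => p _; rewrite -path_scaleAr.
congr (_ *: _); rewrite path_mul_suml (bigD1 (psource p)) //=.
rewrite path_mul_basis pcomp_idl eqxx big1 ?addr0 // => v /negPf nv.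
by rewrite path_mul_basis pcomp_idl nv.
Qed.

Fact path_mul1r : right_id path_one path_mul.
Proof.
move=> f; rewrite [in RHS](path_algE f) [X in path_mul X _](path_algE f).
rewrite path_mul_suml; apply: eq_bigr => p _; rewrite -path_scaleAl.
congr (_ *: _); rewrite path_mul_sumr (bigD1 (ptarget p)) //=.
rewrite path_mul_basis pcomp_idr eqxx big1 ?addr0 // => v /negPf nv.
by rewrite path_mul_basis pcomp_idr nv.
Qed.

Lemma path_one_id v : mcoeff (pid v) path_one = 1.
Proof.
rewrite /path_one raddf_sum (bigD1 v) //= mcoeffUU big1 ?addr0 // => w nw.
rewrite mcoeffU; case: eqP => // /(congr1 psource) /= e.
by move: nw; rewrite -[w]/(psource (pid w)) e eqxx.
Qed.

Fact path_one_neq0 : path_one != 0.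
Proof.
have /card_gt0P[v _] := qvertex_gt0 Q.
apply/eqP => /(congr1 (mcoeff (pid v))); rewrite path_one_id mcoeff0.
by apply/eqP; rewrite oner_eq0.
Qed.

HB.instance Definition _ := GRing.Zmodule_isNzRing.Build path_alg
  path_mulA path_mul1l path_mul1r path_mulDl path_mulDr path_one_neq0.
HB.instance Definition _ := GRing.Lmodule_isLalgebra.Build K path_alg
  path_scaleAl.
HB.instance Definition _ := GRing.Lalgebra_isAlgebra.Build K path_alg
  path_scaleAr.

Definition arrow_elt : qarrow Q -> path_alg :=
  locked (fun x => path_basis (Some (parrow x))).

Lemma arrow_eltE x : arrow_elt x = path_basis (Some (parrow x)).
Proof. by rewrite /arrow_elt -lock. Qed.

Lemma pcomp_pid v p q : (pcomp p q == Some (pid v)) = (p == pid v) && (q == pid v).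
Proof.
apply/eqP/andP => [|[/eqP-> /eqP->]]; last by rewrite pcomp_idl eqxx.
case: pcompP => // r e s a t [er]; rewrite er in s a t.
have /nilP : nilp (parrows p ++ parrows q) by rewrite -a.
move/eqP; rewrite -size_eq0 size_cat addn_eq0 !size_eq0 => /andP[/eqP ap /eqP aq].
have ep : p = pid v by apply: qpath_inj.
by split; apply/eqP => //; apply: qpath_inj => //; rewrite -e ep.
Qed.

Lemma mcoeff_pidM v f g :
  mcoeff (pid v) (f * g) = mcoeff (pid v) f * mcoeff (pid v) g.
Proof.
rewrite (_ : f * g = path_mul f g) //.
pose d1 := (pid v |` msupp f)%fset; pose d2 := (pid v |` msupp g)%fset.
rewrite (@path_mulw d1 d2) ?fsubsetU1 //.
have zero p q : (p != pid v) || (q != pid v) ->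
    mcoeff (pid v) ((mcoeff p f * mcoeff q g) *: path_basis (pcomp p q)) = 0.
  rewrite -negb_and -pcomp_pid mcoeffZ; case: (pcomp p q) => [r|] /=.
    rewrite mcoeffU => /eqP nr; case: eqP => [er|]; last by rewrite mulr0.
    by case: nr; rewrite er.
  by rewrite mcoeff0 mulr0.
rewrite raddf_sum (big_fsetD1 (pid v)) ?fset1U1 //= [X in _ + X]big1_fset ?addr0.
  rewrite raddf_sum (big_fsetD1 (pid v)) ?fset1U1 //= [X in _ + X]big1_fset ?addr0.
    by rewrite pcomp_idl eqxx mcoeffZ mcoeffUU mulr1.
  by move=> q; rewrite in_fsetD1 => /andP[nq _] _; apply: zero; rewrite nq orbT.
move=> p; rewrite in_fsetD1 => /andP[np _] _.
by rewrite raddf_sum big1 // => q _; apply: zero; rewrite np.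
Qed.

Lemma mcoeff_pidB v f g :
  mcoeff (pid v) (f - g) = mcoeff (pid v) f - mcoeff (pid v) g.
Proof. exact: mcoeffB. Qed.

Lemma mcoeff_pidD v f g :
  mcoeff (pid v) (f + g) = mcoeff (pid v) f + mcoeff (pid v) g.
Proof. exact: mcoeffD. Qed.

Lemma mcoeff_pid_arrow v x : mcoeff (pid v) (arrow_elt x) = 0.
Proof. by rewrite arrow_eltE mcoeffU; case: eqP => // /(congr1 parrows). Qed.
End PathAlgebra.

Section Hochschild.
Variables (K : fieldType) (A : algType K).

(* An element of the product over n of the maps A^n -> A: the component of
   degree n is the restriction to lists of size n.  The Hochschild cochains are
   those which are multilinear (hc_multilinear) and vanish in almost all degrees
   (hc_bounded).  As Hom_K(A^{(x) n}, A) = Hom_{A^e}(A (x) A^{(x) n} (x) A, A),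
   their complex computes Ext_{A^e}(A, A) by the bar resolution of A; see
   [hdiff_bar] for the differential. *)
Definition hcochain : Type := seq A -> A.

HB.instance Definition _ := gen_eqMixin hcochain.
HB.instance Definition _ := gen_choiceMixin hcochain.

Implicit Types f g h : hcochain.

Definition hc_zero : hcochain := fun=> 0.
Definition hc_opp f : hcochain := fun s => - f s.
Definition hc_add f g : hcochain := fun s => f s + g s.
Definition hc_scale (k : K) f : hcochain := fun s => k *: f s.
Definition hc_one : hcochain := fun s => if s is [::] then 1 else 0.

Definition cup f g : hcochain := fun s =>
  \sum_(i < (size s).+1)
    (-1) ^+ (i * (size s - i)) *: (f (take i s) * g (drop i s)).

(* Replaces the entries i and i+1 of s (counted from 0) by their product. *)
Definition hmerge (i : nat) (s : seq A) : seq A :=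
  take i s ++ (nth 0 s i * nth 0 s i.+1) :: drop i.+2 s.

Definition hdiff f : hcochain := fun s =>
  if s is x :: s' then
    x * f s' + \sum_(i < size s') (-1) ^+ i.+1 *: f (hmerge i s)
      + (-1) ^+ size s *: (f (belast x s') * last x s')
  else 0.

Definition hc_multilinear f := forall s1 s2 (k : K) x y,
  f (s1 ++ (k *: x + y) :: s2) = k *: f (s1 ++ x :: s2) + f (s1 ++ y :: s2).

Definition hc_bounded f := exists N, forall s, (N <= size s)%N -> f s = 0.

Fact hc_addA : associative hc_add.
Proof. by move=> f g h; apply/funext => s; apply: addrA. Qed.
Fact hc_addC : commutative hc_add.
Proof. by move=> f g; apply/funext => s; apply: addrC. Qed.
Fact hc_add0 : left_id hc_zero hc_add.
Proof. by move=> f; apply/funext => s; apply: add0r. Qed.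
Fact hc_addN : left_inverse hc_zero hc_opp hc_add.
Proof. by move=> f; apply/funext => s; apply: addNr. Qed.
HB.instance Definition _ := GRing.isZmodule.Build hcochain
  hc_addA hc_addC hc_add0 hc_addN.

Fact hc_scaleA a b f : hc_scale a (hc_scale b f) = hc_scale (a * b) f.
Proof. by apply/funext => s; apply: scalerA. Qed.
Fact hc_scale1 : left_id 1 hc_scale.
Proof. by move=> f; apply/funext => s; apply: scale1r. Qed.
Fact hc_scaleDr : right_distributive hc_scale +%R.
Proof. by move=> a f g; apply/funext => s; apply: scalerDr. Qed.
Fact hc_scaleDl f : {morph hc_scale^~ f : a b / a + b}.
Proof. by move=> a b; apply/funext => s; apply: scalerDl. Qed.
HB.instance Definition _ := GRing.Zmodule_isLmodule.Build K hcochain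
  hc_scaleA hc_scale1 hc_scaleDr hc_scaleDl.

Lemma hcD f g s : (f + g) s = f s + g s. Proof. by []. Qed.
Lemma hcN f s : (- f) s = - f s. Proof. by []. Qed.
Lemma hcZ k f s : (k *: f) s = k *: f s. Proof. by []. Qed.
Lemma hc0 s : (0 : hcochain) s = 0. Proof. by []. Qed.

(* Auxiliary operations; [cupE]: conjugating the unsigned product by [tw] gives
   [cup]. *)
Definition ucup f g : hcochain := fun s =>
  \sum_(i < (size s).+1) f (take i s) * g (drop i s).
Definition tw f : hcochain := fun s => (-1) ^+ 'C(size s, 2) *: f s.
Definition alt f : hcochain := fun s => (-1) ^+ size s *: f s.
Definition sh (x : A) f : hcochain := fun s => f (x :: s).
Definition lm (c : A) f : hcochain := fun s => c * f s.

Lemma twK : involutive tw.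
Proof.
by move=> f; apply/funext => s; rewrite /tw scalerA -exprD addnn -mul2n exprM
  sqrrN expr1n expr1n scale1r.
Qed.

Lemma twD : {morph tw : f g / f + g}.
Proof. by move=> f g; apply/funext => s; rewrite /tw hcD scalerDr. Qed.

Lemma twZ k f : tw (k *: f) = k *: tw f.
Proof. by apply/funext => s; rewrite /tw !hcZ !scalerA mulrC. Qed.

Lemma bin2D i j : 'C(i + j, 2) = ('C(i, 2) + 'C(j, 2) + i * j)%N.
Proof.
elim: i => [|i IHi]; first by rewrite addn0.
by rewrite addSn !binS !bin1 IHi mulSn addnACA (addnAC 'C(i, 2)) (addnC j).
Qed.

Lemma sgn_cancel n : (-1) ^+ n * (-1) ^+ n = 1 :> K.
Proof. by rewrite -exprD addnn -mul2n exprM sqrrN expr1n expr1n. Qed.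

Lemma cupE f g : cup f g = tw (ucup (tw f) (tw g)).
Proof.
apply/funext => s; rewrite /cup /tw /ucup scaler_sumr; apply: eq_bigr => i _.
have lei : (i <= size s)%N by rewrite -ltnS.
rewrite -scalerAl -scalerAr !scalerA size_takel // size_drop.
have := bin2D i (size s - i); rewrite subnKC // => ->.
congr (_ *: _); rewrite !exprD.
set u := (-1) ^+ 'C(i, 2); set v := (-1) ^+ 'C(_, 2); set w := (-1) ^+ (i * _).
have -> : u * v * w * u * v = (u * u) * (v * v) * w.
  by rewrite [LHS](ACl ((1*4)*(2*5)*3)).
by rewrite !sgn_cancel !mul1r.
Qed.

Lemma ucup_nil f g : ucup f g [::] = f [::] * g [::].
Proof. by rewrite /ucup big_ord1. Qed.

Lemma ucup_cons f g x s :
  ucup f g (x :: s) = f [::] * g (x :: s) + ucup (sh x f) g s.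
Proof. by rewrite /ucup big_ord_recl. Qed.

Lemma ucupDl f g h : ucup (f + g) h = ucup f h + ucup g h.
Proof.
apply/funext => s; rewrite hcD /ucup -big_split; apply: eq_bigr => i _ /=.
by rewrite hcD mulrDl.
Qed.

Lemma ucupDr f g h : ucup h (f + g) = ucup h f + ucup h g.
Proof.
apply/funext => s; rewrite hcD /ucup -big_split; apply: eq_bigr => i _ /=.
by rewrite hcD mulrDr.
Qed.

Lemma ucupZl k f g : ucup (k *: f) g = k *: ucup f g.
Proof.
apply/funext => s; rewrite hcZ /ucup scaler_sumr; apply: eq_bigr => i _ /=.
by rewrite hcZ scalerAl.
Qed.

Lemma ucupZr k f g : ucup f (k *: g) = k *: ucup f g.
Proof.
apply/funext => s; rewrite hcZ /ucup scaler_sumr; apply: eq_bigr => i _ /=.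
by rewrite hcZ scalerAr.
Qed.

Lemma ucupNl f g : ucup (- f) g = - ucup f g.
Proof. by rewrite -scaleN1r ucupZl scaleN1r. Qed.

Lemma ucup_lm c f g : ucup (lm c f) g = lm c (ucup f g).
Proof.
apply/funext => s; rewrite /lm /ucup mulr_sumr; apply: eq_bigr => i _ /=.
by rewrite mulrA.
Qed.

Lemma sh_ucup x f g : sh x (ucup f g) = lm (f [::]) (sh x g) + ucup (sh x f) g.
Proof. by apply/funext => s; rewrite /sh ucup_cons. Qed.

Lemma ucupA f g h : ucup f (ucup g h) = ucup (ucup f g) h.
Proof.
apply/funext => s; elim: s f => [|x s IHs] f.
  by rewrite !ucup_nil mulrA.
rewrite !ucup_cons IHs sh_ucup ucupDl hcD ucup_nil ucup_lm mulrDr !addrA.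
by rewrite mulrA.
Qed.

Lemma ucup1l f : ucup hc_one f = f.
Proof.
apply/funext => -[|x s]; first by rewrite ucup_nil mul1r.
rewrite ucup_cons mul1r /ucup big1 ?addr0 // => i _.
by rewrite mul0r.
Qed.

Lemma ucup1r f : ucup f hc_one = f.
Proof.
apply/funext => s; elim: s f => [|x s IHs] f; first by rewrite ucup_nil mulr1.
by rewrite ucup_cons mulr0 add0r IHs.
Qed.

Lemma tw1 : tw hc_one = hc_one.
Proof. by apply/funext => -[|x s]; rewrite /tw /= ?scale1r ?scaler0. Qed.

Fact cupA : associative cup.
Proof. by move=> f g h; rewrite !cupE !twK ucupA. Qed.
Fact cup1l : left_id hc_one cup.
Proof. by move=> f; rewrite cupE tw1 ucup1l twK. Qed.
Fact cup1r : right_id hc_one cup.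
Proof. by move=> f; rewrite cupE tw1 ucup1r twK. Qed.
Fact cupDl : left_distributive cup +%R.
Proof. by move=> f g h; rewrite !cupE twD ucupDl twD. Qed.
Fact cupDr : right_distributive cup +%R.
Proof. by move=> f g h; rewrite !cupE twD ucupDr twD. Qed.
Fact hc_one_neq0 : hc_one != 0.
Proof.
apply/eqP => /(congr1 (fun f : hcochain => f [::])) /= /eqP.
by rewrite (negPf (oner_neq0 A)).
Qed.
HB.instance Definition _ := GRing.Zmodule_isNzRing.Build hcochain
  cupA cup1l cup1r cupDl cupDr hc_one_neq0.

Fact cupZl (k : K) f g : k *: cup f g = cup (k *: f) g.
Proof. by rewrite !cupE twZ ucupZl twZ. Qed.
Fact cupZr (k : K) f g : k *: cup f g = cup f (k *: g).
Proof. by rewrite !cupE twZ ucupZr twZ. Qed.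
HB.instance Definition _ := GRing.Lmodule_isLalgebra.Build K hcochain cupZl.
HB.instance Definition _ := GRing.Lalgebra_isAlgebra.Build K hcochain cupZr.

Lemma cupf0 f : cup f 0 = 0. Proof. exact: (mulr0 f). Qed.
Lemma cup0f f : cup 0 f = 0. Proof. exact: (mul0r f). Qed.

Lemma hdiffD f g : hdiff (f + g) = hdiff f + hdiff g.
Proof.
apply/funext => -[|x s]; rewrite hcD /= ?addr0 //.
rewrite hcD mulrDr hcD mulrDl scalerDr.
have -> : \sum_(i < size s) (-1) ^+ i.+1 *: (f + g) (hmerge i (x :: s)) =
  \sum_(i < size s) (-1) ^+ i.+1 *: f (hmerge i (x :: s)) +
  \sum_(i < size s) (-1) ^+ i.+1 *: g (hmerge i (x :: s)).
  by rewrite -big_split; apply: eq_bigr => i _; rewrite hcD scalerDr.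
by rewrite !addrA [RHS](ACl (1*4*2*5*3*6)).
Qed.

Lemma hdiffZ k f : hdiff (k *: f) = k *: hdiff f.
Proof.
apply/funext => -[|x s]; rewrite hcZ /= ?scaler0 //.
rewrite !scalerDr !hcZ -scalerAr -scalerAl !scalerA (mulrC k).
congr (_ + _ + _); rewrite scaler_sumr; apply: eq_bigr => i _.
by rewrite hcZ !scalerA mulrC.
Qed.


Lemma hdiff_nil f : hdiff f [::] = 0. Proof. by []. Qed.

Lemma hdiff1 f x : hdiff f [:: x] = x * f [::] - f [::] * x.
Proof. by rewrite /hdiff /= big_ord0 addr0 expr1 scaleN1r. Qed.

Lemma hdiff_cons2 f x y s : hdiff f (x :: y :: s) =
  x * f (y :: s) - f (x * y :: s) + y * f (x :: s) - hdiff (sh x f) (y :: s).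
Proof.
have -> : hdiff f (x :: y :: s) = x * f (y :: s)
    + (- f (x * y :: s) - \sum_(i < size s) (-1) ^+ i.+1 *: sh x f (hmerge i (y :: s)))
    - (-1) ^+ (size s).+1 *: (sh x f (belast y s) * last y s).
  rewrite [LHS]/= big_ord_recl expr1 scaleN1r {1}/hmerge /= drop0.
  rewrite [(-1) ^+ _.+2]exprS mulN1r scaleNr -sumrN; congr (_ + (_ + _) - _).
  by apply: eq_bigr => i _; rewrite [(-1) ^+ _.+2]exprS mulN1r scaleNr.
rewrite /= -/(sh x f) !opprD !addrA.
set S1 := \sum_(_ < _) _; set T := _ *: _.
by rewrite [RHS](ACl (1*2*5*6*3*4)) /= addrK.
Qed.

Lemma hdiff_lm c f x s :
  hdiff (lm c f) (x :: s) = c * hdiff f (x :: s) + (x * c - c * x) * f s.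
Proof.
rewrite /= /lm !mulrDr mulrBl !mulrA -!scalerAr -!mulrA mulr_sumr.
rewrite [RHS]addrA [RHS](ACl (4*2*3*1*5)) /= addrK; congr (_ + _ + _).
by apply: eq_bigr => i _; rewrite -scalerAr.
Qed.

Lemma sh_alt x f : sh x (alt f) = - alt (sh x f).
Proof.
by apply/funext => s; rewrite /sh hcN /alt /= exprS mulN1r scaleNr.
Qed.

Lemma sh2_hdiff x y f : sh y (sh x (hdiff f)) =
  lm x (sh y f) - sh (x * y) f + lm y (sh x f) - sh y (hdiff (sh x f)).
Proof. by apply/funext => s; rewrite /sh hdiff_cons2. Qed.

Lemma leibniz_comb (V : zmodType) (a1 a2 a3 a4 a5 a6 u1 u2 u3 w z : V) :
  (a1 + u1) - (a2 + u2) + (a3 + u3) - ((a4 + (a3 - a5)) + (w + z)) =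
  ((a1 - a6) + (u1 - u2 + u3 - w)) + ((a6 - a2 + a5 - a4) - z).
Proof.
rewrite !opprD !opprK !addrA [LHS](ACl (1*2*3*4*6*7*9*10*11*5*8)) /= addrK.
by rewrite [RHS](ACl (1*3*8*4*5*10*9*6*11*2*7)) /= subrK.
Qed.

Lemma hdiff_ucup f g :
  hdiff (ucup f g) = ucup (hdiff f) g + ucup (alt f) (hdiff g).
Proof.
apply/funext => s; rewrite hcD.
have [n] := ubnP (size s); elim: n f s => // n IHn f [|x [|y s]] lsn.
- by rewrite hdiff_nil !ucup_nil hdiff_nil mul0r mulr0 addr0.
- rewrite hdiff1 !ucup_cons !ucup_nil /sh !hdiff1 !hdiff_nil.
  rewrite mul0r mulr0 add0r addr0 /alt /= expr0 scale1r.
  by rewrite mulrBl mulrBr !mulrA addrA subrK.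
rewrite hdiff_cons2 !(ucup_cons _ _ _ (y :: s)) sh_ucup hdiffD hcD hdiff_lm.
rewrite (IHn (sh x f) (y :: s)) // sh_alt ucupNl hcN hdiff_nil mul0r add0r.
rewrite !ucup_cons sh2_hdiff.
have -> : sh x (hdiff f) [::] = x * f [::] - f [::] * x by exact: hdiff1.
have -> : alt f [::] = f [::] by rewrite /alt scale1r.
rewrite hdiff_cons2 hdiff_nil mul0r add0r.
move: (sh y (hdiff (sh x f))) => W; rewrite !(ucupDl, ucupNl) !ucup_lm.
rewrite !(hcD, hcN) /lm; set z := _ + ucup _ (hdiff g) s.
move: (hdiff (sh x g) (y :: s)) z => d z.
rewrite !mulrDr !mulrN !mulrDl !mulNr !mulrA.
exact: leibniz_comb.
Qed.

Lemma hdiff_size (c : nat -> K) f s :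
  hdiff (fun t => c (size t) *: f t) s = c (size s).-1 *: hdiff f s.
Proof.
case: s => [|x s]; first by rewrite scaler0.
rewrite /= !scalerDr size_belast; congr (_ + _ + _); first by rewrite scalerAr.
  rewrite scaler_sumr; apply: eq_bigr => i _.
  rewrite !scalerA [c _ * _]mulrC; congr (_ * c _ *: _).
  rewrite size_cat size_takel /=; last by rewrite leqW // ltnW.
  by rewrite size_drop addnS -addSn subnKC.
by rewrite -scalerAl !scalerA mulrC.
Qed.

Lemma tw_hdiff f : tw (hdiff f) = - alt (hdiff (tw f)).
Proof.
apply/funext => s; rewrite hcN /alt.
rewrite (hdiff_size (fun n => (-1) ^+ 'C(n, 2))).
case: s => [|x s]; first by rewrite /tw /= !scaler0 oppr0.
rewrite /tw [size _]/= [(_.+1).-1]/= binS bin1 exprD scalerA -scaleNr.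
by rewrite exprS mulN1r mulNr opprK mulrC.
Qed.

Lemma hdiff_alt f : hdiff (alt f) = - alt (hdiff f).
Proof.
apply/funext => s; rewrite hcN /alt (hdiff_size (fun n => (-1) ^+ n)).
case: s => [|x s]; first by rewrite /= !scaler0 oppr0.
by rewrite [size _]/= exprS mulN1r scaleNr opprK.
Qed.

Lemma altD f g : alt (f + g) = alt f + alt g.
Proof. by apply/funext => s; rewrite /alt hcD scalerDr. Qed.

Lemma altK : involutive alt.
Proof. by move=> f; apply/funext => s; rewrite /alt scalerA sgn_cancel scale1r. Qed.

Lemma tw_alt f : tw (alt f) = alt (tw f).
Proof. by apply/funext => s; rewrite /tw /alt !scalerA mulrC. Qed.

Lemma alt_ucup f g : alt (ucup f g) = ucup (alt f) (alt g).
Proof.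
apply/funext => s; rewrite /alt /ucup scaler_sumr; apply: eq_bigr => i _.
have lei : (i <= size s)%N by rewrite -ltnS.
rewrite -scalerAl -scalerAr scalerA -exprD; congr ((-1) ^+ _ *: _).
by rewrite -size_cat cat_take_drop.
Qed.

Lemma hdiff_cup f g :
  hdiff (cup f g) = cup f (hdiff g) + cup (hdiff f) (alt g).
Proof.
apply: (can_inj twK); rewrite tw_hdiff !cupE twK hdiff_ucup altD !alt_ucup altK.
rewrite twD !twK !tw_hdiff tw_alt ucupNl addrC opprD; congr (_ + _).
by rewrite -scaleN1r -ucupZr scaleN1r.
Qed.

Lemma hc_multilinearD k f g :
  hc_multilinear f -> hc_multilinear g -> hc_multilinear (k *: f + g).
Proof.
move=> mf mg s1 s2 c x y; rewrite !hcD !hcZ mf mg !scalerDr !scalerA (mulrC k).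
by rewrite addrACA.
Qed.

Lemma hc_multilinear_size (c : nat -> K) f :
  hc_multilinear f -> hc_multilinear (fun s => c (size s) *: f s).
Proof.
move=> mf s1 s2 k x y; rewrite mf !size_cat /= scalerDr !scalerA.
by rewrite [k * _]mulrC.
Qed.

Lemma hc_multilinear_ucup f g :
  hc_multilinear f -> hc_multilinear g -> hc_multilinear (ucup f g).
Proof.
move=> mf mg s1 s2 k x y; rewrite /ucup !size_cat /=.
rewrite scaler_sumr -big_split; apply: eq_bigr => i _ /=.
rewrite !take_cat !drop_cat; case: ltnP => [_|le].
  by rewrite mg mulrDr scalerAr.
case: (i - size s1)%N => [|j] /=; last by rewrite mf mulrDl scalerAl.
by rewrite (mg [::]) mulrDr scalerAr.
Qed.

Lemma hc_multilinear_cup f g :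
  hc_multilinear f -> hc_multilinear g -> hc_multilinear (cup f g).
Proof.
have tm h : hc_multilinear h -> hc_multilinear (tw h).
  exact: (hc_multilinear_size (fun n => (-1) ^+ 'C(n, 2))).
by move=> mf mg; rewrite cupE; apply/tm/hc_multilinear_ucup; apply: tm.
Qed.

Lemma hc_boundedD k f g :
  hc_bounded f -> hc_bounded g -> hc_bounded (k *: f + g).
Proof.
move=> [M fM] [N gN]; exists (maxn M N) => s; rewrite geq_max => /andP[lM lN].
by rewrite hcD hcZ fM // gN // scaler0 addr0.
Qed.

Lemma hc_bounded_cup f g : hc_bounded f -> hc_bounded g -> hc_bounded (cup f g).
Proof.
move=> [M fM] [N gN]; exists (M + N)%N => s les; rewrite /cup big1 // => i _.
have lei : (i <= size s)%N by rewrite -ltnS.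
have [leM|ltM] := leqP M i.
  by rewrite fM ?mul0r ?scaler0 // size_takel.
rewrite gN ?mulr0 ?scaler0 // size_drop leq_subRL //.
by apply: leq_trans les; rewrite leq_add2r ltnW.
Qed.

Definition is_hcocycle f := [/\ hc_multilinear f, hc_bounded f & hdiff f = 0].
Definition hcocycle_pred : {pred hcochain} := fun f => `[< is_hcocycle f >].

Lemma hcocycleP f : reflect (is_hcocycle f) (f \in hcocycle_pred).
Proof. exact: asboolP. Qed.

Fact hcocycle_subalg : subalg_closed hcocycle_pred.
Proof.
split=> [|k f g /hcocycleP[mf bf df] /hcocycleP[mg bg dg]|
  f g /hcocycleP[mf bf df] /hcocycleP[mg bg dg]]; apply/hcocycleP; split.
- by move=> [|? ?] s2 k x y; rewrite [LHS]/= scaler0 addr0.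
- by exists 1%N => -[].
- apply/funext => -[|x [|y s]] //; first by rewrite hdiff1 mulr1 mul1r subrr.
  rewrite hdiff_cons2 mulr0 mulr0 subr0 addr0 sub0r.
  by rewrite (_ : sh x hc_one = 0 *: hc_one) ?hdiffZ ?scale0r ?oppr0 //;
    apply/funext => t; rewrite scale0r.
- exact: hc_multilinearD.
- exact: hc_boundedD.
- by rewrite hdiffD hdiffZ df dg scaler0 addr0.
- exact: hc_multilinear_cup.
- exact: hc_bounded_cup.
- by rewrite hdiff_cup df dg cupf0 cup0f addr0.
Qed.

HB.instance Definition _ := GRing.isSubalgClosed.Build K hcochain hcocycle_pred
  (GRing.subalg_closed_semi hcocycle_subalg).

Record hcocycle := HCocycle {
  hcocycle_val :> hcochain; _ : hcocycle_val \in hcocycle_pred }.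

HB.instance Definition _ := [isSub for hcocycle_val].
HB.instance Definition _ := [Choice of hcocycle by <:].
HB.instance Definition _ := [SubChoice_isSubZmodule of hcocycle by <:].
HB.instance Definition _ := [SubZmodule_isSubNzRing of hcocycle by <:].
HB.instance Definition _ := [SubZmodule_isSubLmodule of hcocycle by <:].
HB.instance Definition _ := [SubNzRing_SubLmodule_isSubLalgebra of hcocycle by <:].
HB.instance Definition _ := [SubLalgebra_isSubAlgebra of hcocycle by <:].

Definition hcoboundary (z : hcocycle) : Prop :=
  exists g, [/\ hc_multilinear g, hc_bounded g & val z = hdiff g].

Fact hcoboundary0 : hcoboundary 0.
Proof.
exists 0; split.
- by move=> s1 s2 k x y; rewrite !hc0 scaler0 addr0.
- by exists 0%N.
- by rewrite raddf0 -(scale0r (0 : hcochain)) hdiffZ !scale0r.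
Qed.

Fact hcoboundaryD x y : hcoboundary x -> hcoboundary y -> hcoboundary (x + y).
Proof.
move=> [f [mf bf ef]] [g [mg bg eg]]; exists (1 *: f + g); split.
- exact: hc_multilinearD.
- exact: hc_boundedD.
- by rewrite raddfD /= ef eg scale1r hdiffD.
Qed.

Fact hcoboundaryMl r x : hcoboundary x -> hcoboundary (r * x).
Proof.
move=> [g [mg bg eg]]; have /hcocycleP[mr br dr] := valP r.
exists (cup (val r) g); split.
- exact: hc_multilinear_cup.
- exact: hc_bounded_cup.
- by rewrite hdiff_cup dr cup0f addr0 -eg.
Qed.

Fact hcoboundaryMr r x : hcoboundary x -> hcoboundary (x * r).
Proof.
move=> [g [mg bg eg]]; have /hcocycleP[mr br dr] := valP r.
exists (cup g (alt (val r))); split.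
- by apply: hc_multilinear_cup => //;
    apply: (hc_multilinear_size (fun n => (-1) ^+ n)).
- apply: hc_bounded_cup => //; have [N rN] := br.
  by exists N => s les; rewrite /alt rN // scaler0.
- by rewrite hdiff_cup hdiff_alt dr -scaleN1r altK -eg
    (_ : alt 0 = 0) ?scaler0 ?cupf0 ?add0r //;
    apply/funext => s; rewrite /alt scaler0.
Qed.

Fact hcoboundary1 : ~ hcoboundary 1.
Proof.
move=> [g [_ _ /(congr1 (fun f : hcochain => f [::]))]].
by rewrite hdiff_nil rmorph1 => /eqP; rewrite (negPf (oner_neq0 A)).
Qed.

Definition hcoboundaries : proper_ideal2 hcocycle :=
  ProperIdeal2 hcoboundary0 hcoboundaryD hcoboundaryMl hcoboundaryMr
    hcoboundary1.

(* The map a_0, ..., a_{n+1} |-> a_0 f(a_1, ..., a_n) a_{n+1} of A-bimodules on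
   A (x) A^{(x) n} (x) A given by f; [hdiff_bar] says that hdiff is the
   composition with the differential of the bar resolution. *)
Definition bar_map f : seq A -> A := fun s =>
  if s is x :: y :: t then x * f (belast y t) * last y t else 0.

Lemma hdiff_bar f x z s y : bar_map (hdiff f) (x :: z :: rcons s y) =
  \sum_(i < (size s).+2)
    (-1) ^+ i *: bar_map f (hmerge i (x :: z :: rcons s y)).
Proof.
have bm h u (t : seq A) w : bar_map h (u :: rcons t w) = u * h t * w.
  by case: t => [|v t] //=; rewrite belast_rcons last_rcons.
have hs i t : hmerge i.+1 (x :: t) = x :: hmerge i t by [].
have e0 : hmerge 0 (x :: z :: rcons s y) = x * z :: rcons s y.
  by rewrite /hmerge /= drop0.
have ei i : (i < size s)%N ->
    hmerge i.+1 (x :: z :: rcons s y) = x :: rcons (hmerge i (z :: s)) y.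
  move=> lt; rewrite hs -rcons_cons; congr cons.
  rewrite /hmerge !nth_rcons /= !ltnS lt (ltnW lt) -rcons_cons -cats1.
  rewrite takel_cat /=; last by rewrite leqW // ltnW.
  by rewrite drop_rcons // -rcons_cons -rcons_cat.
have en : hmerge (size s).+1 (x :: z :: rcons s y) =
    x :: rcons (belast z s) (last z s * y).
  rewrite hs; congr cons; elim: (s) (z) => [|w t IHt] v //.
  by rewrite -[RHS]/(v :: rcons (belast w t) (last w t * y)) -IHt.
rewrite -rcons_cons bm big_ord_recl big_ord_recr [hdiff f _]/=.
rewrite rcons_cons e0 bm mulrDr mulrDr !mulrDl expr0 scale1r !mulrA -addrA.
congr (_ + (_ + _)).
  rewrite mulr_sumr mulr_suml; apply: eq_bigr => i _.
  by rewrite [nat_of_ord (lift _ _)]/= /bump add1n ei // bm -scalerAr -scalerAl.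
by rewrite [nat_of_ord (lift _ _)]/= /bump add1n en bm -scalerAr -scalerAl !mulrA.
Qed.

Definition HH := quot2 hcoboundaries.

(* The summand HH^n(A): classes of cocycles concentrated in degree n. *)
Definition HH_deg (n : nat) (x : HH) : Prop :=
  exists2 z : hcocycle, x = quot2_pi hcoboundaries z &
    forall s, size s != n -> val z s = 0.
End Hochschild.

Variant xs_vertex := V1 | V2.
Variant xs_arrow := Xa | Xb | Xc.

Definition xs_vertex_enc v := if v is V1 then true else false.
Definition xs_vertex_dec b := if b then V1 else V2.
Fact xs_vertex_can : cancel xs_vertex_enc xs_vertex_dec. Proof. by case. Qed.
HB.instance Definition _ := Finite.copy xs_vertex (can_type xs_vertex_can).

Definition xs_arrow_enc x :=
  match x with Xa => None | Xb => Some true | Xc => Some false end.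
Definition xs_arrow_dec o :=
  match o with None => Xa | Some true => Xb | Some false => Xc end.
Fact xs_arrow_can : cancel xs_arrow_enc xs_arrow_dec. Proof. by case. Qed.
HB.instance Definition _ := Finite.copy xs_arrow (can_type xs_arrow_can).

Definition xs_source (x : xs_arrow) : xs_vertex := V1.
Definition xs_target (x : xs_arrow) : xs_vertex := if x is Xc then V2 else V1.

Fact xs_vertex_gt0 : (0 < #|{: xs_vertex}|)%N.
Proof. by apply/card_gt0P; exists V1. Qed.

Definition xs_quiver : quiver := Quiver xs_source xs_target xs_vertex_gt0.

Section XuSnashall.
Variable K : fieldType.

Local Notation KQ := (path_alg xs_quiver K).
Definition xs_elt (x : xs_arrow) : KQ := @arrow_elt xs_quiver K x.

Inductive xs_rel : KQ -> Prop :=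
| xs_rel_aa : xs_rel (xs_elt Xa ^+ 2)
| xs_rel_bb : xs_rel (xs_elt Xb ^+ 2)
| xs_rel_ab : xs_rel (xs_elt Xa * xs_elt Xb - xs_elt Xb * xs_elt Xa)
| xs_rel_ac : xs_rel (xs_elt Xa * xs_elt Xc).

Fact xs_rel_proper : ~ gen_ideal xs_rel 1.
Proof.
have main (f : KQ) : gen_ideal xs_rel f -> mcoeff (@pid xs_quiver V2) f = 0.
  elim=> {f} [_ []||f g _ hf _ hg|r f _ hf|r f _ hf].
  - by rewrite expr2 mcoeff_pidM mcoeff_pid_arrow mul0r.
  - by rewrite expr2 mcoeff_pidM mcoeff_pid_arrow mul0r.
  - by rewrite mcoeff_pidB !mcoeff_pidM !mcoeff_pid_arrow !mul0r subrr.
  - by rewrite mcoeff_pidM mcoeff_pid_arrow mul0r.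
  - exact: mcoeff0.
  - by rewrite mcoeff_pidD hf hg addr0.
  - by rewrite mcoeff_pidM hf mulr0.
  - by rewrite mcoeff_pidM hf mul0r.
move/main => e; have := @path_one_id xs_quiver K V2.
by rewrite [LHS]e => /eqP; rewrite eq_sym oner_eq0.
Qed.

Definition xs_alg := quot2 (gen_proper_ideal2 xs_rel_proper).

(* The pair (n, i) stands for the variable x_{n,i} of degree n. *)
Definition is_xvar (v : nat * nat) : bool :=
  (v.2 \in [:: 1; 2]%N) || (v.2 \in [:: 3; 4]%N) && (0 < v.1)%N.
Definition xvar := {v : nat * nat | is_xvar v}.
HB.instance Definition _ := Choice.on xvar.

Definition xdeg (v : xvar) : nat := (val v).1.

Local Notation KX := {malg K[{cmonom xvar}]}.

(* x_{n,i}, and 0 if there is no such variable. *)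
Definition xg : nat -> nat -> KX := locked (fun n i =>
  if (insub (n, i) : option xvar) is Some v then mkmalgU (ucm v) 1 else 0).

Lemma xgE n i : xg n i =
  if (insub (n, i) : option xvar) is Some v then mkmalgU (ucm v) 1 else 0.
Proof. by rewrite /xg -lock. Qed.

Definition wdeg (m : {cmonom xvar}) : nat :=
  (\sum_(v <- finsupp m) m v * xdeg v)%N.

(* p is homogeneous of degree n (or 0) for the grading |x_{n,i}| = n. *)
Definition KX_deg (n : nat) (p : KX) : Prop :=
  forall m, m \in msupp p -> wdeg m = n.

Inductive J_rel : KX -> Prop :=
| J_11 m n : J_rel (xg m 1 * xg n 1)
| J_12 m n : J_rel (xg m 1 * xg n 2)
| J_22 m n : J_rel (xg m 2 * xg n 2)
| J_24 m n of (1 <= n)%N : J_rel (xg m 2 * xg n 4)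
| J_23 m n of (1 <= n)%N : J_rel (xg m 2 * xg n 3 - xg m 1 * xg n 4)
| J_44 m n of (1 <= m)%N & (1 <= n)%N : J_rel (xg m 4 * xg n 4)
| J_13 m n of (1 <= m)%N & (1 <= n)%N :
    J_rel (xg m 1 * xg n 3 - xg 0 1 * xg (m + n) 3)
| J_14 m n of (1 <= m)%N & (1 <= n)%N :
    J_rel (xg m 1 * xg n 4 - xg 0 1 * xg (m + n) 4)
| J_33 m n of (2 <= m)%N & (1 <= n)%N :
    J_rel (xg m 3 * xg n 3 - xg 1 3 * xg (m + n - 1) 3)
| J_34 m n of (2 <= m)%N & (1 <= n)%N :
    J_rel (xg m 3 * xg n 4 - xg 1 3 * xg (m + n - 1) 4).

Lemma mcoeff1_x n i : mcoeff (mone : {cmonom xvar}) (xg n i) = 0.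
Proof.
rewrite xgE; case: insubP => [v _ _|_]; last exact: mcoeff0.
by rewrite mcoeffU cm1_eq1.
Qed.

Fact J_proper : ~ gen_ideal J_rel 1.
Proof.
pose c : KX -> K := @mcoeff _ K (mone : {cmonom xvar}).
have cM p q : c (p * q) = c p * c q by exact: rmorphM.
have cB p q : c (p - q) = c p - c q by exact: mcoeffB.
have cD p q : c (p + q) = c p + c q by exact: mcoeffD.
have c1 : c 1 = 1 by exact: rmorph1.
have c0 : c 0 = 0 by exact: mcoeff0.
have cx n i : c (xg n i) = 0 by exact: mcoeff1_x.
have cxB m i p n j q : c (xg m i * p - xg n j * q) = 0.
  have c0M m' i' r : c (xg m' i' * r) = 0 by rewrite cM cx mul0r.
  by rewrite cB -[RHS](subrr 0); congr (_ - _); apply: c0M.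
suff main p : gen_ideal J_rel p -> c p = 0.
  by move/main/eqP; rewrite c1 oner_eq0.
clearbody c.
elim=> {p} [_ []||p q _ hp _ hq|r p _ hp|r p _ hp].
1-4,6: by move=> *; rewrite cM !cx mul0r.
1-5: by move=> *; apply: cxB.
- exact: c0.
- by rewrite cD hp hq addr0.
- by rewrite cM hp mulr0.
- by rewrite cM hp mul0r.
Qed.

Definition J_ideal := gen_proper_ideal2 J_proper.
Definition KXJ := quot2 J_ideal.
Definition KXJ_pi (p : KX) : KXJ := quot2_pi J_ideal p.
Definition KXJ_deg (n : nat) (u : KXJ) : Prop :=
  exists2 p, u = KXJ_pi p & KX_deg n p.

(* Index set of the basis; a parameter n of N_4, N_133, N_134, N_34 stands for
   the index n + 1 >= 1 of x_{n+1,i}. *)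
Variant N_index :=
| N_1 of nat | N_2 of nat | N_4 of nat
| N_133 of nat & nat | N_134 of nat & nat | N_34 of nat & nat.

Definition N_family (i : N_index) : KX :=
  match i with
  | N_1 n => xg n 1
  | N_2 n => xg n 2
  | N_4 n => xg n.+1 4
  | N_133 l n => xg 0 1 * xg 1 3 ^+ l * xg n.+1 3
  | N_134 l n => xg 0 1 * xg 1 3 ^+ l * xg n.+1 4
  | N_34 l n => xg 1 3 ^+ l.+1 * xg n.+1 4
  end.

Definition nil_ideal (A : algType K) : HH A -> Prop :=
  gen_ideal (fun u : HH A =>
    (exists n, HH_deg n u) /\ (exists k, u ^+ k = 0)).

(* The family b is a K-basis of the subspace N: it spans N and each finite
   subfamily is linearly independent (hence b is injective). *)
Definition is_basis (V : lmodType K) (I : Type) (b : I -> V) (N : V -> Prop) :=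
  (forall v, N v <->
     exists s : seq (K * I), v = \sum_(p <- s) p.1 *: b p.2) /\
  (forall n (i : 'I_n -> I) (c : 'I_n -> K), injective i ->
     \sum_k c k *: b (i k) = 0 -> forall k, c k = 0).
End XuSnashall.

(* Main.v *)
(* Write A = e1 A e1 + e1 A e2 + e2 A e2, where e1 A e1 = L = K[a,b]/(a^2,b^2) and e1 A e2 is
   spanned by c and bc. Summing the values of a cochain over all words in the loops a and b,
   each a counted by x and each b by y, gives in characteristic 2 a ring morphism
   HH(A) -> L[x,y], the symbol. Its coefficients determine the constant terms of the comparison
   map to the Koszul complex of A, and a cocycle for which these vanish is a coboundary, by a
   descending induction on the degree; hence the symbol is injective.
   The cocycles a, ab, d/db and b d/db, multiplied by powers of d/da, together with the vanishing
   of the coefficients of x^n (n > 0) and b x^n forced by c, show that the image is K + (a,y) L[x,y].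
   Setting
     x_{n,1} = a x^n, x_{n,2} = ab x^n, x_{n,3} = y x^(n-1), x_{n,4} = b y x^(n-1)
   identifies K[X]/J with the same subring, by comparing normal forms. Modulo a and b the symbol
   lands in the domain K[x,y], so that the nilpotent part is spanned by the monomials divisible
   by a or b. *)
Require Import Defs.
From HB Require Import structures.
From mathcomp Require Import all_boot all_order all_algebra finmap boolp.
From mathcomp.multinomials Require Import monalg.
From mathcomp Require Import ring.

Set Implicit Arguments.
Unset Strict Implicit.
Unset Printing Implicit Defensive.

Import GRing.Theory.
Local Open Scope ring_scope.

(** * Sums in characteristic 2 *)

(** Put t = xa + yb. The word sum of f in degree n is the loop part of f(t, ..., t), and in
    characteristic 2 one has t^2 = xy(ab + ba) = 0. Hence the inner terms of a differential vanish
    at (t, ..., t), its two outer terms cancel because L[x,y] is commutative, and cup products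
    become products.

    Injectivity avoids building resolutions. Cochains form an A-bimodule under [lm] and [rm], a
    cocycle is an element on which both actions agree, and fixing its first argument gives a
    derivation, which is inner for a coboundary and, in positive degree, only then. So the arguments
    of a cocycle can be fed one by one into Koszul generators: each step trades an argument for a
    Koszul degree, boundedness ends the process, and a contracting homotopy carries primitives back.

    The obstacle to a class with symbol x is ac = 0, which d/da would send to c. The resulting
    defect is harmless in a cup product whose right factor has values in e1 A, so x occurs only as a
    multiplier. *)

Section Char2Sum.
Variables (V : zmodType) (addvv : forall x : V, x + x = 0).

Inductive sum_tree := SAdd of sum_tree & sum_tree | SVar of nat | SZero.

Fixpoint sum_eval (e : seq V) t : V :=
  match t with
  | SAdd t1 t2 => sum_eval e t1 + sum_eval e t2
  | SVar i => e`_i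
  | SZero => 0
  end.

Fixpoint sum_vars t : seq nat :=
  match t with
  | SAdd t1 t2 => sum_vars t1 ++ sum_vars t2
  | SVar i => [:: i]
  | SZero => [::]
  end.

(** Equal summands cancel in pairs, so only the indices of odd multiplicity survive. *)
Definition sum_norm : seq nat -> seq nat :=
  foldr (fun i l => if i \in l then rem i l else i :: l) [::].

Lemma sum_evalE e t : sum_eval e t = \sum_(i <- sum_norm (sum_vars t)) e`_i.
Proof.
transitivity (\sum_(i <- sum_vars t) e`_i).
  elim: t => [t1 IH1 t2 IH2|i|] /=; last by rewrite big_nil.
    by rewrite big_cat IH1 IH2.
  by rewrite big_seq1.
elim: (sum_vars t) => [|i l IHl] /=; first by rewrite !big_nil.
rewrite big_cons IHl; case: ifP => [il|_]; last by rewrite big_cons.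
by rewrite (big_rem i il) /= addrA addvv add0r.
Qed.

Lemma sum_eval_eq e t1 t2 :
  sum_norm (sum_vars (SAdd t1 t2)) = [::] -> sum_eval e t1 = sum_eval e t2.
Proof.
move=> h; have := sum_evalE e (SAdd t1 t2); rewrite h big_nil /= => h2.
by rewrite -[LHS]addr0 -(addvv (sum_eval e t2)) addrA h2 add0r.
Qed.
End Char2Sum.

Ltac sum_index x e :=
  lazymatch e with
  | ?y :: ?e' =>
    match constr:(Set) with
    | _ => let _ := match constr:(Set) with _ => constr_eq x y end in constr:(O)
    | _ => let n := sum_index x e' in constr:(S n)
    end
  end.
Ltac sum_insert x e :=
  match constr:(Set) with
  | _ => let _ := sum_index x e in e
  | _ => constr:(x :: e)
  end.
Ltac sum_atoms t e :=
  lazymatch t with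
  | @GRing.add _ ?x ?y => let e1 := sum_atoms x e in sum_atoms y e1
  | @GRing.zero _ => e
  | _ => sum_insert t e
  end.
Ltac sum_quote t e :=
  lazymatch t with
  | @GRing.add _ ?x ?y =>
    let a := sum_quote x e in let b := sum_quote y e in constr:(SAdd a b)
  | @GRing.zero _ => constr:(SZero)
  | _ => let i := sum_index t e in constr:(SVar i)
  end.
(* Decides equalities of sums in an abelian group of exponent 2. *)
Ltac cancel2 h :=
  lazymatch goal with
  | |- ?x = ?y :> ?V =>
    let e0 := sum_atoms x (@nil V) in let e := sum_atoms y e0 in
    let s := sum_quote x e in let t := sum_quote y e in
    exact: (@sum_eval_eq _ h e s t erefl)
  end.

(** * Cochains as a bimodule *)

Section CochainBimodule.
Variables (K : fieldType) (A : algType K).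
Implicit Types (f g h : hcochain A) (x y z : A) (s : seq A).

(** The right action of dimension shifting: the value at z1, ..., zn is g(x z1, z2, ...) - g(x, z1
    z2, ...) + ..., ending with g(x, z1, ..., z(n-1)) zn up to sign. With [lm] it makes cochains an
    A-bimodule whose commutators are the differential. *)
Definition rm : A -> hcochain A -> hcochain A :=
  fix rm x g s := if s is z :: s' then g (x * z :: s') - rm z (sh x g) s'
                  else g [::] * x.

Arguments rm : simpl never.

Lemma rm_nil x g : rm x g [::] = g [::] * x. Proof. by []. Qed.
Lemma rm_cons x g z s : rm x g (z :: s) = g (x * z :: s) - rm z (sh x g) s.
Proof. by []. Qed.

Lemma hdiff_rm g x s : hdiff g (x :: s) = x * g s - rm x g s.
Proof.
elim: s x g => [|z s IHs] x g; first exact: hdiff1.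
rewrite hdiff_cons2 rm_cons (IHs z (sh x g)) -[sh x g s]/(g (x :: s)) !opprB !addrA.
by rewrite [LHS](ACl (1*4*2*3*5)) /= addrK.
Qed.

Lemma sh_rm z x g : sh z (rm x g) = sh (x * z) g - rm z (sh x g).
Proof. by []. Qed.

Lemma rmD x g h : rm x (g + h) = rm x g + rm x h.
Proof.
apply/funext => s; elim: s x g h => [|z s IHs] x g h; first exact: mulrDl.
by rewrite hcD !rm_cons hcD (IHs z (sh x g) (sh x h)) opprD addrACA.
Qed.

Lemma rmZ x k g : rm x (k *: g) = k *: rm x g.
Proof.
apply/funext => s; elim: s x g => [|z s IHs] x g; first by rewrite hcZ !rm_nil -scalerAl.
by rewrite hcZ !rm_cons hcZ (IHs z (sh x g)) scalerBr hcZ.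
Qed.

Lemma rm0 x : rm x 0 = 0 :> hcochain A.
Proof. by rewrite -(scale0r (0 : hcochain A)) rmZ !scale0r. Qed.

Lemma rmN x g : rm x (- g) = - rm x g.
Proof. by rewrite -scaleN1r rmZ scaleN1r. Qed.

Lemma rm_rm x y g : rm y (rm x g) = rm (x * y) g.
Proof.
apply/funext => s; elim: s x y g => [|z s IHs] x y g; first by rewrite !rm_nil mulrA.
rewrite !rm_cons mulrA.
rewrite (_ : sh y (rm x g) = sh (x * y) g - rm y (sh x g)) // rmD rmN hcD hcN.
by rewrite IHs opprB addrA subrK.
Qed.

Lemma rm_lm x y g : rm y (lm x g) = lm x (rm y g).
Proof.
apply/funext => s; elim: s y g => [|z s IHs] y g; first by rewrite /lm !rm_nil mulrA.
by rewrite rm_cons [RHS]mulrBr; congr (_ - _); apply: (IHs z (sh y g)).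
Qed.

Lemma lmD x g h : lm x (g + h) = lm x g + lm x h.
Proof. by apply/funext => s; apply: mulrDr. Qed.

Lemma lm0 x : lm x 0 = 0.
Proof. by apply/funext => s; apply: mulr0. Qed.

Lemma lm_lm x y g : lm x (lm y g) = lm (x * y) g.
Proof. by apply/funext => s; apply: mulrA. Qed.

Lemma lm_0 g : lm 0 g = 0. Proof. by apply/funext => s; apply: mul0r. Qed.

Lemma lm_D x y g : lm (x + y) g = lm x g + lm y g.
Proof. by apply/funext => s; apply: mulrDl. Qed.

Lemma sh_lm z x g : sh z (lm x g) = lm x (sh z g). Proof. by []. Qed.
Lemma shD z g h : sh z (g + h) = sh z g + sh z h. Proof. by []. Qed.
Lemma sh0 z : sh z (0 : hcochain A) = 0. Proof. by []. Qed.

Local Notation ml := hc_multilinear.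

Lemma ml_sh x g : ml g -> ml (sh x g).
Proof. by move=> mg s1; apply: (mg (x :: s1)). Qed.

Lemma ml_lm x g : ml g -> ml (lm x g).
Proof. by move=> mg s1 s2 k y z; rewrite /lm mg mulrDr scalerAr. Qed.

Lemma ml_0 : ml (0 : hcochain A).
Proof. by move=> s1 s2 k y z; rewrite !hc0 scaler0 addr0. Qed.

Lemma ml_D g h : ml g -> ml h -> ml (g + h).
Proof. by move=> mg mh; rewrite -[g]scale1r; apply: hc_multilinearD. Qed.

Lemma sh_linear k x y g : ml g -> sh (k *: x + y) g = k *: sh x g + sh y g.
Proof. by move=> mg; apply/funext => s; apply: (mg [::]). Qed.

Lemma sh_0 g : ml g -> sh 0 g = 0.
Proof. by move/(sh_linear (-1) 0 0); rewrite scaler0 addr0 scaleN1r addNr.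
Qed.

Lemma rm_linear k x y g : ml g ->
  rm (k *: x + y) g = k *: rm x g + rm y g.
Proof.
move=> mg; apply/funext => s.
elim: s k x y g mg => [|z s IHs] k x y g mg; first by rewrite hcD hcZ !rm_nil mulrDr scalerAr.
have e : (k *: x + y) * z = k *: (x * z) + y * z by rewrite mulrDl scalerAl.
rewrite hcD hcZ !rm_cons e -[g (_ :: s)]/(sh _ g s) sh_linear // sh_linear // rmD rmZ.
by rewrite !hcD !hcZ scalerBr opprD addrACA.
Qed.

Lemma rm_0 g : ml g -> rm 0 g = 0.
Proof. by move/(rm_linear (-1) 0 0); rewrite scaler0 addr0 scaleN1r addNr.
Qed.

Lemma ml_rm x g : ml g -> ml (rm x g).
Proof.
move=> mg s1; elim: s1 x g mg => [|w s1 IHs] x g mg s2 k y z; rewrite ?cat0s ?cat_cons ?rm_cons.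
  rewrite mulrDr -scalerAr (mg [::]) rm_linear; last exact: ml_sh.
  by rewrite hcD hcZ scalerBr opprD addrACA.
rewrite (mg (x * w :: s1)) IHs; last exact: ml_sh.
by rewrite scalerBr opprD addrACA.
Qed.

Lemma ml_hdiff g : ml g -> ml (hdiff g).
Proof.
move=> mg [|w s1] s2 k y z; rewrite ?cat0s ?cat_cons !hdiff_rm.
  rewrite mulrDl -scalerAl rm_linear // hcD hcZ scalerBr opprD addrACA //.
by rewrite mg (ml_rm w mg) mulrDr -scalerAr scalerBr opprD addrACA.
Qed.
End CochainBimodule.
Arguments rm : simpl never.

(** * Comparison with the Koszul complex *)

Lemma char2_addvv (K : fieldType) (V : lmodType K) :
  2%N \in [pchar K] -> forall x : V, x + x = 0.
Proof.
by move=> h x; rewrite -mulr2n -scaler_nat (pcharf0 h) scale0r.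
Qed.

(* PAB stands for both ab and ba. *)
Variant xs_path := PE1 | PE2 | PA | PB | PAB | PC | PBC.

Definition xs_paths := [:: PE1; PE2; PA; PB; PAB; PC; PBC].

Definition xs_path_eq p q :=
  match p, q with
  | PE1, PE1 => true | PE2, PE2 => true | PA, PA => true | PB, PB => true
  | PAB, PAB => true | PC, PC => true | PBC, PBC => true | _, _ => false
  end.

Definition xs_comp p q : option xs_path :=
  match p, q with
  | PE1, (PE1 | PA | PB | PAB | PC | PBC) => Some q
  | (PA | PB | PAB), PE1 => Some p
  | PE2, PE2 => Some PE2
  | (PC | PBC), PE2 => Some p
  | PA, PB => Some PAB
  | PB, PA => Some PAB
  | PB, PC => Some PBC
  | _, _ => None
  end.

(** All that the cohomological argument uses of A: seven basis paths, their coordinate forms and the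
    multiplication table. The quotient of the path algebra enters only at the end. *)
Record xs_basis (K : fieldType) (A : algType K) := XsBasis {
  bs :> xs_path -> A;
  co : xs_path -> A -> K;
  co_linear : forall p k u v, co p (k *: u + v) = k * co p u + co p v;
  co_bs : forall p q, co p (bs q) = (xs_path_eq p q)%:R;
  bs_co : forall u, u = \sum_(p <- xs_paths) co p u *: bs p;
  bs1 : 1 = bs PE1 + bs PE2;
  bsM : forall p q, bs p * bs q = if xs_comp p q is Some r then bs r else 0
}.

Section Core.
Variables (K : fieldType) (A : algType K) (B : xs_basis A).
Hypothesis char2 : 2%N \in [pchar K].
Local Notation H := (hcochain A).
Local Notation ml := hc_multilinear.
Local Notation e1 := (B PE1).
Local Notation e2 := (B PE2).
Local Notation a := (B PA).
Local Notation b := (B PB).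
Local Notation c := (B PC).

Let addHH : forall g : H, g + g = 0 := char2_addvv char2.
Let addAA : forall u : A, u + u = 0 := char2_addvv char2.

Lemma add_eq0 (V : lmodType K) (x y : V) : x + y = 0 -> x = y.
Proof.
by move=> e; rewrite -[LHS]addr0 -(char2_addvv char2 y) addrA e add0r.
Qed.

Lemma char2_opp (V : lmodType K) (x : V) : - x = x.
Proof. by apply/esym/add_eq0; rewrite subrr. Qed.

Lemma sh_rm2 z x (g : H) : sh z (rm x g) = sh (x * z) g + rm z (sh x g).
Proof. by rewrite sh_rm char2_opp. Qed.

Lemma rm_sh2 z x (g : H) : rm z (sh x g) = sh (x * z) g + sh z (rm x g).
Proof. by rewrite sh_rm2; cancel2 addHH. Qed.

Definition ext (P : xs_path -> H) : H := fun s =>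
  if s is y :: s' then \sum_(p <- xs_paths) co B p y *: P p s' else 0.

Lemma sh_ext P y : sh y (ext P) = \sum_(p <- xs_paths) co B p y *: P p.
Proof. by apply/funext => s; rewrite /sh /ext !big_cons !big_nil. Qed.

Lemma sh_ext_bs P q : sh (B q) (ext P) = P q.
Proof.
rewrite sh_ext !big_cons !big_nil !co_bs.
by case: q; rewrite /= !scale0r scale1r ?add0r ?addr0.
Qed.

Lemma co0 p : co B p 0 = 0.
Proof. by have := co_linear B p (-1) 0 0; rewrite scaler0 addr0 mulN1r addNr. Qed.

Lemma coZ p k u : co B p (k *: u) = k * co B p u.
Proof. by rewrite -[_ *: u]addr0 co_linear co0 addr0. Qed.

Lemma coD p u v : co B p (u + v) = co B p u + co B p v.
Proof. by rewrite -[u]scale1r co_linear mul1r scale1r. Qed.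

Lemma ml_ext P : (forall p, ml (P p)) -> ml (ext P).
Proof.
move=> mP [|w s1] s2 k y z /=; rewrite scaler_sumr -big_split;
  apply: eq_bigr => p _ /=.
  by rewrite co_linear scalerDl scalerA.
by rewrite mP scalerDr !scalerA (mulrC k).
Qed.

Lemma ml_eq (f g : H) : ml f -> ml g -> f [::] = g [::] ->
  (forall q, sh (B q) f = sh (B q) g) -> f = g.
Proof.
move=> mf mg e0 e; apply/funext => -[//|y s].
rewrite -[LHS]/(sh y f s) -[RHS]/(sh y g s) (bs_co B y) !big_cons big_nil.
by rewrite !sh_linear // !sh_0 // !e.
Qed.

Definition pt u : H := fun s => if s is [::] then u else 0.

Lemma ml_pt u : ml (pt u).
Proof. by move=> [|w s1] s2 k y z /=; rewrite scaler0 addr0. Qed.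

Lemma sh_pt x u : sh x (pt u) = 0. Proof. by []. Qed.

Lemma eq_add0 (V : zmodType) (x y z : V) : z = 0 -> x + z = y -> x = y.
Proof. by move=> ->; rewrite addr0. Qed.

Lemma lmDlm x y (g h : H) : lm x (g + lm y h) = lm x g + lm (x * y) h.
Proof. by rewrite lmD lm_lm. Qed.

Lemma lmlmD x y (g h : H) : lm x (lm y g + h) = lm (x * y) g + lm x h.
Proof. by rewrite lmD lm_lm. Qed.

(* For k fixed, U j is the value of a Koszul cochain on the generator dual to
   x^(k-j) y^j, and kd is the Koszul differential. *)
Definition dn (U : nat -> H) j : H := if j is j'.+1 then U j' else 0.
Definition kd (U : nat -> H) j : H :=
  lm a (U j) + rm a (U j) + (lm b (dn U j) + rm b (dn U j)).

Lemma ml_dn W j : (forall i, ml (W i)) -> ml (dn W j).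
Proof. by move=> mW; case: j => [|j]; [apply: ml_0 | apply: mW]. Qed.

(** * Lowering a primitive by one Koszul degree *)

Section Step.
(** (U, V) is a Koszul cocycle of degree n with values in cochains, and G is a primitive of the
    cocycle obtained from it by absorbing one more argument. [U0] excludes a contribution with no
    argument left to absorb. *)
Variables (U G : nat -> H) (V : H).
Hypotheses (mU : forall j, ml (U j)) (mV : ml V) (mG : forall j, ml (G j)).
Hypotheses (e1U : forall j, lm e1 (U j) = U j) (Ue1 : forall j, rm e1 (U j) = U j).
Hypotheses (e1V : lm e1 V = V) (Ve2 : rm e2 V = V).
Hypotheses (dU : forall j, kd U j = 0) (dV : lm a V + rm c (U 0%N) = 0).
Hypothesis U0 : forall j, U j [::] = 0.
Hypotheses (Ge1 : forall j, rm e1 (G j) = G j).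
Hypothesis UG : forall j, rm e1 (sh a (U j) + sh b (dn U j)) = kd G j.
Hypothesis VG : rm e2 (sh c (U 0%N)) = rm c (G 0%N).

Variable n : nat.
Hypotheses (n_gt0 : (0 < n)%N).
Hypotheses (U_gt : forall j, (n < j)%N -> U j = 0) (G_gt : forall j, (n < j)%N -> G j = 0).

(** By the Leibniz rule, [sh] of U fails to be a one-sided cocycle by [rm] of the next Koszul image.
    That image is [kd G], so adding [rm] of G repairs the failure. *)
Let Up j q : H := sh (B q) (U j) + rm (B q) (G j).
Let Vp : H := sh e2 V.

Let sh_kd W j q : (forall i, ml (W i)) -> sh (B q) (kd W j) =
  lm a (sh (B q) (W j)) + (sh (a * B q) (W j) + rm (B q) (sh a (W j)))
  + (lm b (sh (B q) (dn W j)) + (sh (b * B q) (dn W j) + rm (B q) (sh b (dn W j)))).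
Proof. by move=> mW; rewrite /kd !shD !sh_lm !sh_rm2. Qed.

Let kd_rm W j q : rm (B q) (kd W j) =
  lm a (rm (B q) (W j)) + rm (a * B q) (W j)
  + (lm b (rm (B q) (dn W j)) + rm (b * B q) (dn W j)).
Proof. by rewrite /kd !rmD !rm_lm !rm_rm. Qed.

(* The left-linear extension of Up to the Koszul resolution is a cocycle. *)
Let Up_cocycle j q : e1 * B q = B q ->
  lm a (Up j q) + (sh (a * B q) (U j) + rm (a * B q) (G j)) +
  (lm b (sh (B q) (dn U j) + rm (B q) (dn G j)) +
   (sh (b * B q) (dn U j) + rm (b * B q) (dn G j))) = 0.
Proof.
move=> eq.
have := sh_kd j q mU; rewrite dU sh0 => h1.
have h2 : rm (B q) (sh a (U j)) + rm (B q) (sh b (dn U j)) = rm (B q) (kd G j).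
  by rewrite -UG rm_rm eq rmD.
rewrite kd_rm in h2.
set X := (X in X = _) in h2; transitivity (0 + (X + X)); last by rewrite add0r addHH.
by rewrite {1}h1 {2}h2 /X /Up !lmD; cancel2 addHH.
Qed.

Let Upo j q := if q is Some r then Up j r else 0.

Let UpoE j p q : sh (B p * B q) (U j) + rm (B p * B q) (G j) = Upo j (xs_comp p q).
Proof.
by rewrite bsM /Upo; case: (xs_comp p q) => [//|]; rewrite sh_0 // rm_0 // addr0.
Qed.

Let Up_cocycle0 q : xs_comp PE1 q = Some q ->
  lm a (Up 0 q) + Upo 0 (xs_comp PA q) = 0.
Proof.
move=> eq; have := @Up_cocycle 0 q; rewrite bsM eq /dn !sh0 !rm0 lmD lm0 !UpoE => <- //.
by cancel2 addHH.
Qed.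

Let Up_cocycleS j q : xs_comp PE1 q = Some q ->
  lm a (Up j.+1 q) + Upo j.+1 (xs_comp PA q) +
  (lm b (Up j q) + Upo j (xs_comp PB q)) = 0.
Proof. by move=> eq; have := @Up_cocycle j.+1 q; rewrite bsM eq !UpoE; apply. Qed.

Let Vp_cocycle : lm a Vp + Up 0 PC = 0.
Proof.
have := congr1 (sh e2) dV; rewrite shD sh_lm sh_rm2 sh0 VG.
by rewrite bsM /= /Up addrA.
Qed.

Let UpE j q : sh (B q) (U j) =
  (if xs_comp PE1 q is Some r then Up j r else 0)
  + rm (B q) (Up j PE1).
Proof.
rewrite -{1}Ue1 sh_rm2 /Up rmD rm_rm bsM.
case: (xs_comp _ _) => [r|]; rewrite ?rm_0 ?sh_0 //; cancel2 addHH.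
Qed.

(** This is the pullback of [Up] and [Vp] along a left-linear contracting homotopy of the Koszul
    complex: a factor b of the path is moved into the generator, raising j, while a or c is absorbed
    only at j = 0. At j = 0 the paths ab and bc contribute in both ways, with b kept as a left
    coefficient in the second. *)
Let P j q : H :=
  match q, j with
  | PB, _ => Up j.+1 PE1
  | PAB, 0 => Up 1 PA + lm b (Up 0 PE1)
  | PAB, j.+1 => Up j.+2 PA
  | PBC, 0 => Up 1 PC + lm b Vp
  | PBC, j.+1 => Up j.+2 PC
  | PA, 0 => Up 0 PE1
  | PC, 0 => Vp
  | _, _ => 0
  end.

(** The value of V at the empty list is a combination of c and bc, hence a combination of e1 and b
    times c. Since e1 and b commute with a and b, adding that combination does not change [kd]. *)
Let G1 j : H := ext (P j) +
  (if j is 0 then pt (co B PC (V [::]) *: e1 + co B PBC (V [::]) *: b) else 0).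

Let ml_Up j q : ml (Up j q).
Proof. by apply: ml_D; [apply: ml_sh | apply: ml_rm]. Qed.

Let ml_Vp : ml Vp. Proof. exact: ml_sh. Qed.

Let ml_P j q : ml (P j q).
Proof.
by case: q j => [] [|j] //=; try exact: ml_0; try apply: ml_D;
  try apply: ml_lm; try exact: ml_Up.
Qed.

Let ml_G1 j : ml (G1 j).
Proof.
by apply: ml_D; [apply/ml_ext/ml_P | case: j => [|j]; [apply: ml_pt | apply: ml_0]].
Qed.

Let sh_G1 j q : sh (B q) (G1 j) = P j q.
Proof. by rewrite /G1 shD sh_ext_bs; case: j => [|j]; rewrite ?sh_pt ?sh0 addr0. Qed.

Let kd_G1 j : kd G1 j = U j.
Proof.
apply: ml_eq => //.
- by do 2?apply: ml_D; [apply: ml_lm | apply: ml_rm | apply: ml_lm | apply: ml_rm];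
    [exact: ml_G1 | exact: ml_G1 | apply: ml_dn; exact: ml_G1 | apply: ml_dn; exact: ml_G1].
- rewrite U0 /kd !hcD; case: j => [|[|j]]; rewrite /lm /= ?rm_nil /G1 ?hcD /= ?hc0;
    rewrite ?(mul0r, mulr0, add0r, addr0) //.
    rewrite mulrDr mulrDl -!scalerAr -!scalerAl !bsM /=; cancel2 addAA.
  rewrite mulrDr mulrDl -!scalerAr -!scalerAl !bsM /= scaler0; cancel2 addAA.
move=> q; rewrite (sh_kd j q ml_G1) UpE.
have sh0 i : sh 0 (G1 i) = 0 by apply/sh_0/ml_G1.
have Up1E i : sh a (G1 i) + sh b (dn G1 i) = Up i PE1.
  by case: i => [|i]; rewrite /= !sh_G1 ?addr0 ?add0r.
have {}Up1E : rm (B q) (sh a (G1 j)) + rm (B q) (sh b (dn G1 j)) = rm (B q) (Up j PE1).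
  by rewrite -Up1E rmD.
pose T i p := if xs_comp p q is Some r then P i r else 0.
pose dP i := if i is i'.+1 then P i' q else 0.
pose dT i := if i is i'.+1 then T i' PB else 0.
have TE i p : sh (B p * B q) (G1 i) = T i p.
  by rewrite bsM /T; case: (xs_comp p q) => [r|//]; rewrite sh_G1.
have -> : sh (b * B q) (dn G1 j) = dT j by case: (j) => [//|i]; apply: TE.
have -> : sh (B q) (dn G1 j) = dP j by case: (j) => [//|i]; apply: sh_G1.
rewrite TE sh_G1.
(* What remains is the homotopy identity for [P]. Each path and each small j gives an instance of a
   cocycle condition on [Up] or [Vp], or b times one. *)
have <- : lm a (P j q) + T j PA + (lm b (dP j) + dT j) =
  (if xs_comp PE1 q is Some r then Up j r else 0).
  rewrite /dP /dT /T; clear dP dT T Up1E TE.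
  case: q j => [] [|[|j]] /=; rewrite ?(lm0, addr0, add0r) //.
  - by apply: add_eq0; apply: Up_cocycle0.
  - by cancel2 addHH.
  - by apply: (eq_add0 (@Up_cocycleS 0 PE1 erefl)) => /=; cancel2 addHH.
  - by apply: (eq_add0 (@Up_cocycleS 1 PE1 erefl)) => /=; cancel2 addHH.
  - by apply: (eq_add0 (@Up_cocycleS j.+2 PE1 erefl)) => /=; cancel2 addHH.
  - apply: (eq_add0 (@Up_cocycleS 0 PA erefl)); apply: (eq_add0 (etrans (congr1 (lm b) (@Up_cocycle0 PE1 erefl)) (lm0 b))).
    by rewrite /= !lmDlm ?lmlmD !bsM /=; cancel2 addHH.
  - apply: (eq_add0 (@Up_cocycleS 1 PA erefl)).
    by rewrite /= !lmDlm ?lmlmD !bsM /= lm_0; cancel2 addHH.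
  - by apply: (eq_add0 (@Up_cocycleS j.+2 PA erefl)) => /=; cancel2 addHH.
  - by apply: add_eq0; apply: Vp_cocycle.
  - by cancel2 addHH.
  - apply: (eq_add0 (@Up_cocycleS 0 PC erefl)); apply: (eq_add0 (etrans (congr1 (lm b) Vp_cocycle) (lm0 b))).
    by rewrite /= !lmDlm ?lmlmD !bsM /=; cancel2 addHH.
  - apply: (eq_add0 (@Up_cocycleS 1 PC erefl)).
    by rewrite /= !lmDlm ?lmlmD !bsM /= lm_0; cancel2 addHH.
  - by apply: (eq_add0 (@Up_cocycleS j.+2 PC erefl)) => /=; cancel2 addHH.
by rewrite -Up1E; cancel2 addHH.
Qed.

Let V_G1 : rm c (G1 0) = V.
Proof.
apply: ml_eq => //; first exact/ml_rm/ml_G1.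
  have e1V0 : e1 * V [::] = V [::] by rewrite -[RHS](congr1 (@^~ [::]) e1V).
  have Ve20 : V [::] * e2 = V [::] by rewrite -[RHS](congr1 (@^~ [::]) Ve2).
  rewrite rm_nil /G1 hcD /= add0r mulrDl -!scalerAl !bsM /=.
  rewrite -[RHS]Ve20 -[in RHS]e1V0 [in RHS](bs_co B (V [::])) !big_cons big_nil.
  rewrite !(mulrDr, mulrDl) mulr0 mul0r -!(scalerAl, scalerAr) !bsM /=.
  by rewrite !(bsM, mul0r, scaler0, add0r, addr0).
move=> q; rewrite sh_rm2 sh_G1 -[in RHS]Ve2 sh_rm2 !bsM; congr (_ + _).
by case: q => /=; rewrite ?(sh_0 (ml_G1 0)) ?sh_0 ?sh_G1.
Qed.

Let kd_lm W j x : x * a = a * x -> x * b = b * x -> kd (fun i => lm x (W i)) j = lm x (kd W j).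
Proof.
move=> xa xb; case: j => [|j]; rewrite /kd /= !lmD ?rm0 ?lm0 !rm_lm !lm_lm xa ?xb ?lm0 ?rm0 //.
Qed.

Let kd_rm' W j x : x * a = a * x -> x * b = b * x -> kd (fun i => rm x (W i)) j = rm x (kd W j).
Proof.
move=> xa xb; case: j => [|j]; rewrite /kd /= !rmD ?lm0 ?rm0 !rm_lm !rm_rm xa ?xb ?lm0 ?rm0 //.
Qed.

(* The descent on the degree: a primitive G of the next Koszul image (UG, VG)
   gives a primitive W of (U, V). *)
Lemma kos_step : exists W : nat -> H,
  [/\ forall j, ml (W j), forall j, lm e1 (W j) = W j,
     forall j, rm e1 (W j) = W j,
     forall j, (n <= j)%N -> W j = 0 &
     (forall j, U j = kd W j) /\ V = rm c (W 0%N)].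
Proof.
have e1a : e1 * a = a * e1 by rewrite !bsM.
have e1b : e1 * b = b * e1 by rewrite !bsM.
(* As e1 commutes with a and b, cutting down to e1 on both sides commutes with [kd], and it fixes
   U. *)
exists (fun j => lm e1 (rm e1 (G1 j))); split.
- by move=> j; apply/ml_lm/ml_rm/ml_G1.
- by move=> j; rewrite lm_lm bsM.
- by move=> j; rewrite rm_lm rm_rm bsM.
- move=> [|j] lej; first by rewrite leqNgt n_gt0 in lej.
  have Up0 i q : (n < i)%N -> Up i q = 0 by move=> lti; rewrite /Up U_gt // G_gt // rm0 addr0.
  have -> : G1 j.+1 = 0; last by rewrite rm0 lm0.
  rewrite /G1 addr0; apply/funext => -[//|y s]; rewrite /ext big1 // => p _.
  by case: p; rewrite /= ?Up0 ?ltnS ?hc0 ?scaler0 //; apply: leqW.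
split; last by rewrite rm_lm rm_rm bsM V_G1.
- by move=> j; rewrite kd_lm // kd_rm' // kd_G1 Ue1 e1U.
Qed.
End Step.

(** * From bar cocycles to Koszul cocycles, and back *)

Section Comparison.
Variable f : H.
Hypotheses (mf : ml f) (df : hdiff f = 0).

(** In other words f is a Koszul cocycle of degree 0 with values in the bimodule of cochains, which
    is where the comparison starts. *)
Lemma cocycle_rm x : rm x f = lm x f.
Proof.
apply/funext => s; have := congr1 (@^~ (x :: s)) df.
by rewrite hdiff_rm char2_opp => /add_eq0.
Qed.

(* The comparison map from the bar complex to the Koszul complex, with one
   generator x^(k-j) y^j for loops (kosU) and one of the form x^k c (kosV). *)
Fixpoint kosU k j : H :=
  if k is k'.+1 then rm e1 (sh a (kosU k' j) + sh b (dn (kosU k') j))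
  else if j is 0 then lm e1 f else 0.

Definition kosV k : H := rm e2 (sh c (kosU k 0)).

Lemma ml_kosU k j : ml (kosU k j).
Proof.
elim: k j => [|k IHk] j /=; first by case: j => [|j]; [apply: ml_lm | apply: ml_0].
by apply/ml_rm/ml_D; apply: ml_sh => //; apply: ml_dn.
Qed.

Lemma ml_kosV k : ml (kosV k). Proof. exact/ml_rm/ml_sh/ml_kosU. Qed.

Lemma e1_kosU k j : lm e1 (kosU k j) = kosU k j.
Proof.
elim: k j => [|k IHk] j /=; first by case: j => [|j]; rewrite ?lm0 ?lm_lm ?bsM.
rewrite -rm_lm lmD -!sh_lm !IHk; case: j => [|j] /=; last by rewrite IHk.
by rewrite lm0.
Qed.

Lemma kosU_e1 k j : rm e1 (kosU k j) = kosU k j.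
Proof.
case: k j => [|k] [|j] /=; rewrite ?rm0 ?rm_rm ?bsM //.
by rewrite rm_lm cocycle_rm !lm_lm !bsM.
Qed.

Lemma kosU_gt k j : (k < j)%N -> kosU k j = 0.
Proof.
elim: k j => [|k IHk] [|j] // ltkj; rewrite /= !IHk ?sh0 ?addr0 ?rm0 //.
exact: ltnW.
Qed.

(** The relations of L make the comparison compatible with the differentials: the Leibniz terms for
    aa and bb vanish, and those for ab and ba are equal, so they cancel. *)
Lemma kd_kosU k j : kd (kosU k) j = 0.
Proof.
elim: k j => [|k IHk] j.
  have h q : lm (B q) (lm e1 f) + rm (B q) (lm e1 f) =
      lm (B q * e1) f + lm (e1 * B q) f.
    by rewrite rm_lm cocycle_rm !lm_lm.
  rewrite /kd; case: j => [|[|j]] /=; rewrite ?lm0 ?rm0 ?addr0 //.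
    by rewrite h !bsM.
  by rewrite add0r h !bsM.
pose X i := sh a (kosU k i) + sh b (dn (kosU k) i).
have dX i : dn (kosU k.+1) i = rm e1 (dn X i) by case: i => [|i]; rewrite /= ?rm0.
have mX i : ml (X i).
  by apply: ml_D; apply: ml_sh; [|apply: ml_dn] => *; apply: ml_kosU.
have IH i : rm a (kosU k i) + rm b (dn (kosU k) i)
    = lm a (kosU k i) + lm b (dn (kosU k) i).
  by apply: add_eq0; rewrite -[RHS](IHk i) /kd; cancel2 addHH.
have main : rm a (X j) + rm b (dn X j) = lm a (X j) + lm b (dn X j).
  have Xa i : rm a (X i) = sh (B PAB) (dn (kosU k) i) + sh a (rm a (kosU k i) + rm b (dn (kosU k) i)).
    rewrite /X rmD !rm_sh2 !bsM /= sh_0 ?shD; last exact: ml_kosU.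
    by cancel2 addHH.
  have Xb i : rm b (X i) = sh (B PAB) (kosU k i) + sh b (rm a (kosU k i) + rm b (dn (kosU k) i)).
    rewrite /X rmD !rm_sh2 !bsM /= (@sh_0 _ _ (dn _ i)) ?shD; last exact/ml_dn/ml_kosU.
    by cancel2 addHH.
  rewrite Xa IH; case: j => [|j]; rewrite /= ?rm0 ?lm0 ?Xb ?IH ?shD /X ?lmD ?sh_lm //=;
    rewrite ?sh0 ?lm0; cancel2 addHH.
rewrite /kd dX [kosU _ _]/= -/(X j) !rm_rm !bsM /=.
transitivity (rm e1 (lm a (X j) + lm b (dn X j)) + (rm a (X j) + rm b (dn X j))).
  by rewrite rmD !rm_lm; cancel2 addHH.
by rewrite -main rmD !rm_rm !bsM /= addHH.
Qed.

Lemma e1_kosV k : lm e1 (kosV k) = kosV k.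
Proof. by rewrite -rm_lm -sh_lm e1_kosU. Qed.

Lemma kosV_e2 k : rm e2 (kosV k) = kosV k.
Proof. by rewrite rm_rm bsM. Qed.

(** Here ac = 0 enters: the term [sh (a * c)] of the Leibniz rule disappears, so fixing c commutes
    with exchanging a. *)
Lemma dkosV k : lm a (kosV k) + rm c (kosU k.+1 0) = 0.
Proof.
have h : rm a (kosU k 0) = lm a (kosU k 0).
  have := kd_kosU k 0; rewrite /kd /= rm0 lm0 !addr0 => h.
  by apply: add_eq0; rewrite -[RHS]h; cancel2 addHH.
have e : sh c (rm a (kosU k 0)) = rm c (sh a (kosU k 0)).
  by rewrite rm_sh2 bsM /= sh_0 ?add0r //; apply: ml_kosU.
rewrite /= sh0 addr0 rm_rm bsM /= /kosV -rm_lm -sh_lm -h e rm_rm bsM /=.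
exact: addHH.
Qed.

(** Each Koszul step consumes one argument of f, so everything vanishes from step N on. The descent
    starts there, with the primitive 0. *)
Lemma bounded_kosU N k j s :
  (forall t, (N <= size t)%N -> f t = 0) -> (N <= k + size s)%N -> kosU k j s = 0.
Proof.
move=> fN.
have rmN m (x : A) (g : H) : (forall t, (m <= size t)%N -> g t = 0) ->
    forall t, (m <= size t)%N -> rm x g t = 0.
  move=> h t; elim: t m x g h => [|z t IHt] m x g h le.
    by rewrite rm_nil h ?mul0r.
  rewrite rm_cons h // (IHt m.-1) ?subr0 //; last by case: (m) le.
  by move=> u le'; apply: h; rewrite /=; case: (m) le'.
suff main m : (N <= k + m)%N -> forall t, (m <= size t)%N -> kosU k j t = 0.
  by move=> le; apply: (main (size s)).
elim: k j m => [|k IHk] j m /= le t lt.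
  by case: j => [|j] //; rewrite /lm fN ?mulr0 //; apply: leq_trans lt.
apply: (rmN m) => // u lu.
have IH i x : sh x (kosU k i) u = 0 by apply: (IHk i m.+1); rewrite ?addnS.
by rewrite hcD IH; case: j => [|j]; rewrite /= ?IH addr0.
Qed.

Lemma kos_coboundary : hc_bounded f -> (forall k j, kosU k j [::] = 0) ->
  exists W : nat -> H, [/\ forall j, ml (W j), forall j, lm e1 (W j) = W j,
     forall j, rm e1 (W j) = W j, forall j, (1 <= j)%N -> W j = 0 &
     (forall j, kosU 1 j = kd W j) /\ kosV 0 = rm c (W 0%N)].
Proof.
move=> [N fN] U0.
suff main d k : (N <= k + d)%N -> exists W : nat -> H,
    [/\ forall j, ml (W j), forall j, lm e1 (W j) = W j,
     forall j, rm e1 (W j) = W j, forall j, (k < j)%N -> W j = 0 &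
     (forall j, kosU k.+1 j = kd W j) /\ kosV k = rm c (W 0%N)].
  by apply: (main N 0).
elim: d k => [|d IHd] k le.
  have UN i j : (N <= i)%N -> kosU i j = 0.
    by move=> lei; apply/funext => s; apply: (bounded_kosU _ fN); apply: leq_trans lei (leq_addr _ _).
  exists (fun=> 0); rewrite addn0 in le; split=> // [j|j|j|].
  - exact: ml_0.
  - exact: lm0.
  - exact: rm0.
  by split=> [j|]; rewrite ?UN ?(leqW le) // /kosV ?UN // /kd;
    [case: j => [|j]; rewrite /= ?rm0 ?lm0 !addr0 | rewrite sh0 !rm0].
have [|W [mW e1W We1 Wgt [UW VW]]] := IHd k.+1; first by rewrite addSnnS.
have [] := @kos_step (kosU k.+1) W (kosV k) (ml_kosU _) (ml_kosV k) mW
  (e1_kosU _) (kosU_e1 _) (e1_kosV k) (kosV_e2 k) (kd_kosU _) (dkosV k)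
  (U0 _) UW VW k.+1 (ltn0Sn k) (@kosU_gt k.+1) Wgt.
by move=> X [mX e1X Xe1 Xgt UX]; exists X.
Qed.

(** Thus [sh x f] is a derivation in x with values in the bimodule of cochains. If f vanishes at the
    empty list, it is a coboundary as soon as this derivation is inner. *)
Lemma sh_cocycleM x y :
  sh (x * y) f = lm x (sh y f) + rm y (sh x f).
Proof. by rewrite -sh_lm -cocycle_rm sh_rm2; cancel2 addHH. Qed.

Lemma lm_e1e2 (g : H) : lm e1 g + lm e2 g = g.
Proof. by rewrite -lm_D -bs1; apply/funext => s; apply: mul1r. Qed.

(** For a path x from vertex 1 to the vertex of t, the derivation splits into its component between
    these vertices, which is what the Koszul cochains record, and an inner correction coming from
    the idempotents. *)
Lemma sh_cocycle_e1 x t : e1 * x = x -> e2 * x = 0 -> x * t = x ->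
  sh x f = lm e1 (rm t (sh x f)) + lm x (sh t f) +
    (lm e1 (rm x (sh e1 f)) + lm e2 (rm x (sh e2 f))).
Proof.
move=> e1x e2x xt.
have h1 : lm e1 (sh x f) = sh x f + rm x (sh e1 f).
  by rewrite -{2}e1x sh_cocycleM; cancel2 addHH.
have h2 : rm t (sh x f) = sh x f + lm x (sh t f).
  by rewrite -{2}xt sh_cocycleM; cancel2 addHH.
have h3 : lm e2 (sh x f) = rm x (sh e2 f).
  by apply: add_eq0; rewrite -sh_cocycleM e2x sh_0.
have h4 : lm e2 (rm x (sh e1 f)) = lm e2 (sh x f).
  have := congr1 (lm e2) h1; rewrite lmD lm_lm bsM lm_0 => h.
  by apply: add_eq0; rewrite h; cancel2 addHH.
rewrite h2 -h3 lm_lm bsM /= -h4 !lmD lm_e1e2 lm_lm e1x h1; cancel2 addHH.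
Qed.

Lemma kos_exact W : f [::] = 0 ->
  (forall j, ml (W j)) -> (forall j, lm e1 (W j) = W j) ->
  (forall j, rm e1 (W j) = W j) -> W 1%N = 0 ->
  (forall j, kosU 1 j = kd W j) -> kosV 0 = rm c (W 0%N) ->
  exists2 g, ml g & f = hdiff g.
Proof.
move=> f0 mW e1W We1 W1 UW VW.
pose g := W 0%N + (lm e1 (sh e1 f) + lm e2 (sh e2 f)).
have mg : ml g.
  by apply: ml_D => //; apply: ml_D; apply/ml_lm/ml_sh.
have e2W q : xs_comp q PE1 = None -> lm (B q) (W 0%N) = 0.
  by move=> h; rewrite -e1W lm_lm bsM h lm_0.
have We2 q : xs_comp PE1 q = None -> rm (B q) (W 0%N) = 0.
  by move=> h; rewrite -We1 rm_rm bsM h rm_0.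
pose D x := sh x f = lm x g + rm x g.
have DM x y : D x -> D y -> D (x * y).
  rewrite /D sh_cocycleM => -> ->; rewrite lmD rmD !lm_lm !rm_rm rm_lm.
  by cancel2 addHH.
have ee t u : rm u (sh t f) = sh (t * u) f + lm t (sh u f).
  by rewrite sh_cocycleM; cancel2 addHH.
have De1 : D e1.
  rewrite /D /g !lmD !rmD !rm_lm !ee !lmD !lm_lm !bsM /= lm_0 sh_0 // lm0 e1W We1.
  by rewrite -[LHS]lm_e1e2; cancel2 addHH.
have De2 : D e2.
  rewrite /D /g !lmD !rmD !rm_lm !ee !lmD !lm_lm !bsM /= lm_0 sh_0 // lm0 e2W // We2 //.
  by rewrite -[LHS]lm_e1e2; cancel2 addHH.
have Da : D a.
  have := UW 0%N; rewrite /= /kd /= sh0 !lm0 !rm0 !addr0 sh_lm rm_lm => h.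
  rewrite /D (@sh_cocycle_e1 a e1) ?bsM // h /g !lmD !rmD !rm_lm !lm_lm !bsM /= lm_0.
  by cancel2 addHH.
have Db : D b.
  have := UW 1%N; rewrite /= /kd /= W1 sh0 !lm0 !rm0 !add0r sh_lm rm_lm => h.
  rewrite /D (@sh_cocycle_e1 b e1) ?bsM // h /g !lmD !rmD !rm_lm !lm_lm !bsM /= lm_0.
  by cancel2 addHH.
have Dc : D c.
  have := VW; rewrite /kosV /= sh_lm rm_lm => h.
  rewrite /D (@sh_cocycle_e1 c e2) ?bsM // h /g !lmD !rmD !rm_lm !lm_lm !bsM /= lm_0 e2W //.
  by cancel2 addHH.
exists g => //; apply: ml_eq => //; first exact: ml_hdiff.
move=> q; have -> : sh (B q) (hdiff g) = lm (B q) g + rm (B q) g.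
  by apply/funext => s; rewrite /sh hdiff_rm char2_opp.
have Dab : D (B PAB) by have := DM _ _ Da Db; rewrite bsM.
have Dbc : D (B PBC) by have := DM _ _ Db Dc; rewrite bsM.
by case: q.
Qed.

Lemma truncate_coboundary g : hc_bounded f -> ml g -> f = hdiff g ->
  exists g', [/\ ml g', hc_bounded g' & f = hdiff g'].
Proof.
move=> [N fN] mg fg; pose t n : K := (n < N)%:R.
exists (fun s => t (size s) *: g s); split.
- exact: hc_multilinear_size.
- by exists N => s le; rewrite /t ltnNge le scale0r.
apply/funext => s; rewrite hdiff_size -fg /t.
case: ltnP => [_|le]; first by rewrite scale1r.
by rewrite fN ?scaler0 //; apply: leq_trans le (leq_pred _).
Qed.

Lemma kos_injective : hc_bounded f -> f [::] = 0 -> (forall k j, kosU k j [::] = 0) ->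
  exists g, [/\ ml g, hc_bounded g & f = hdiff g].
Proof.
move=> bf f0 U0.
have [W [mW e1W We1 /(_ 1%N (leqnn 1)) W1 [UW VW]]] := kos_coboundary bf U0.
have [g mg fg] := kos_exact f0 mW e1W We1 W1 UW VW.
exact: truncate_coboundary mg fg.
Qed.
End Comparison.
End Core.

(** * The symbol of a cohomology class *)

Section DualNumbers.
Variable R : comNzRingType.

(** The ring R[t]/(t^2), the second component being the coefficient of t. *)
Definition dual : Type := (R * R)%type.
HB.instance Definition _ := GRing.Zmodule.on dual.

Definition dual_one : dual := (1, 0).
Definition dual_mul (u v : dual) : dual := (u.1 * v.1, u.1 * v.2 + u.2 * v.1).

Fact dual_mulA : associative dual_mul.
Proof.
move=> u v w; congr pair; rewrite /= ?mulrA //.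
by rewrite mulrDr mulrDl !mulrA addrA.
Qed.

Fact dual_mulC : commutative dual_mul.
Proof.
by move=> u v; congr pair; rewrite /= mulrC // addrC [v.1 * _]mulrC.
Qed.

Fact dual_mul1l : left_id dual_one dual_mul.
Proof. by move=> [u1 u2]; rewrite /dual_mul /= !mul1r mul0r addr0. Qed.

Fact dual_mulDl : left_distributive dual_mul +%R.
Proof. by move=> u v w; congr pair; rewrite /= !mulrDl // addrACA. Qed.

Fact dual_one_neq0 : dual_one != 0.
Proof. by apply/eqP => -[] /eqP; rewrite oner_eq0. Qed.

HB.instance Definition _ := GRing.Zmodule_isComNzRing.Build dual
  dual_mulA dual_mulC dual_mul1l dual_mulDl dual_one_neq0.

Lemma dualM1 (u v : dual) : (u * v).1 = u.1 * v.1. Proof. by []. Qed.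
Lemma dualM2 (u v : dual) : (u * v).2 = u.1 * v.2 + u.2 * v.1. Proof. by []. Qed.

Definition dual_fst (u : dual) : R := u.1.
HB.instance Definition _ := GRing.isZmodMorphism.Build dual R dual_fst (fun u v => erefl).
HB.instance Definition _ :=
  GRing.isMonoidMorphism.Build dual R dual_fst (erefl, fun u v => erefl).
End DualNumbers.

(** * Evaluation of cochains on words in the loops *)

Section WordSums.
Variables (K : fieldType) (A : algType K) (B : xs_basis A).
Hypothesis char2 : 2%N \in [pchar K].
Variables (S : comNzRingType) (pi : {rmorphism A -> S}) (x y : S).
Hypothesis pi_e1 : pi (B PE1) = 1.
Local Notation H := (hcochain A).
Local Notation ml := hc_multilinear.
Local Notation e1 := (B PE1).
Local Notation a := (B PA).
Local Notation b := (B PB).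

(* Sums over the words of length n in a and b, a counting for x and b for y. *)
Fixpoint wsum n (f : H) : S :=
  if n is n'.+1 then x * wsum n' (sh a f) + y * wsum n' (sh b f) else pi (f [::]).

Let addSS : forall s : S, s + s = 0.
Proof.
move=> s; have : pi (1 + 1) = 0 by rewrite (char2_addvv char2) rmorph0.
by rewrite rmorphD rmorph1 => h; rewrite -[s]mul1r -mulrDl h mul0r.
Qed.

Lemma wsumD n f g : wsum n (f + g) = wsum n f + wsum n g.
Proof.
elim: n f g => [|n IHn] f g /=; first by rewrite hcD rmorphD.
by rewrite !shD !IHn !mulrDr addrACA.
Qed.

Lemma wsum_lm n u f : wsum n (lm u f) = pi u * wsum n f.
Proof.
elim: n f => [|n IHn] f /=; first by rewrite /lm rmorphM.
by rewrite !sh_lm !IHn mulrDr !(mulrCA (pi u)).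
Qed.

Lemma wsumZ n k f : wsum n (k *: f) = pi (k%:A) * wsum n f.
Proof.
rewrite -wsum_lm; congr wsum; apply/funext => s.
by rewrite /lm -scalerAl mul1r.
Qed.

Lemma wsum0 n : wsum n 0 = 0.
Proof. by rewrite -(scale0r (0 : H)) wsumZ scale0r rmorph0 mul0r. Qed.

(** Since (xa + yb)^2 = 0, the only term of [rm] to survive is the last one, where the final letter
    multiplies the value from the right. *)
Lemma wsum_rm n f : ml f ->
  x * wsum n (rm a f) + y * wsum n (rm b f) = (x * pi a + y * pi b) * wsum n f.
Proof.
elim: n f => [|n IHn] f mf.
  by rewrite /= !rm_nil !rmorphM !mulrA -!(mulrAC _ _ (pi (f _))) -mulrDl.
rewrite /= !sh_rm2 // !bsM /= !sh_0 // !add0r !wsumD !(mulrDr, mulrDl).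
have IHa := IHn _ (ml_sh a mf); have IHb := IHn _ (ml_sh b mf).
transitivity (x * (x * wsum n (rm a (sh a f)) + y * wsum n (rm b (sh a f)))
  + y * (x * wsum n (rm a (sh b f)) + y * wsum n (rm b (sh b f)))).
  (* The term added twice is the contribution of ab, respectively of ba. *)
  by rewrite -[RHS]addr0 -(addSS (x * y * wsum n (sh (B PAB) f))); ring.
by rewrite IHa IHb; ring.
Qed.

(** Left and right multiplication by xa + yb agree in the commutative ring S, and their sum is
    zero. *)
Lemma wsum_hdiff n g : ml g -> wsum n (hdiff g) = 0.
Proof.
case: n => [|n] mg /=; first by rewrite rmorph0.
have h q : sh (B q) (hdiff g) = lm (B q) g + rm (B q) g.
  by apply/funext => s; rewrite /sh hdiff_rm char2_opp.
rewrite !h !wsumD !mulrDr addrACA wsum_rm // !wsum_lm !mulrA -mulrDl.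
exact: addSS.
Qed.

Lemma wsum_ucup n f g :
  wsum n (ucup f g) = \sum_(i < n.+1) wsum i f * wsum (n - i) g.
Proof.
elim: n f g => [|n IHn] f g; first by rewrite big_ord1 /= ucup_nil rmorphM.
rewrite [LHS]/= !sh_ucup !wsumD !wsum_lm !IHn [RHS]big_ord_recl /= !mulrDr.
rewrite addrACA !(mulrCA _ (pi _)); congr (_ + _).
rewrite !mulr_sumr -big_split; apply: eq_bigr => i _ /=.
by rewrite /bump add1n subSS !mulrA mulrDl.
Qed.

(** The generator of index j collects the words with j letters b. For m = 0 this expresses the
    symbol through the values of the Koszul cochains at the empty list. *)
Lemma wsum_kosU f k m : ml f -> hdiff f = 0 ->
  \sum_(j < k.+1) x ^+ (k - j) * y ^+ j * wsum m (kosU B f k j) = wsum (m + k) f.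
Proof.
move=> mf df; elim: k m => [|k IHk] m.
  by rewrite big_ord1 !expr0 !mul1r addn0 wsum_lm pi_e1 mul1r.
pose U := kosU B f k.
have mU j : ml (U j) by apply: ml_kosU.
have kdU j : rm a (U j) + rm b (dn U j) = lm a (U j) + lm b (dn U j).
  apply: (add_eq0 char2); have := kd_kosU B char2 mf df k j; rewrite /kd -/U.
  by move=> <-; cancel2 (char2_addvv (V := H) char2).
have US j : kosU B f k.+1 j = sh a (U j) + sh b (dn U j)
    + (lm a (sh e1 (U j)) + lm b (sh e1 (dn U j))).
  rewrite /= -/U rmD !rm_sh2 // !bsM /= addrACA -shD kdU shD !sh_lm //.
(* The projection [rm e1] in [kosU] creates terms with e1 as an argument. They enter the sum only
   through this product. *)
have zero j : (x * pi a + y * pi b) * wsum m (sh e1 (U j)) = 0.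
  rewrite -wsum_rm; last exact: ml_sh.
  have h q : xs_comp PE1 q = Some q -> rm (B q) (sh e1 (U j)) = 0.
    by move=> eq; rewrite rm_sh2 // kosU_e1 // bsM eq; apply: char2_addvv.
  by rewrite !h // wsum0 !mulr0 addr0.
pose P j := wsum m (sh a (U j)) + pi a * wsum m (sh e1 (U j)).
pose Q j := wsum m (sh b (U j)) + pi b * wsum m (sh e1 (U j)).
have WS j : wsum m (kosU B f k.+1 j) = P j + (if j is j'.+1 then Q j' else 0).
  rewrite US !wsumD !wsum_lm addrACA; congr (_ + _).
  by case: j => [|j]; rewrite /= ?sh0 ?wsum0 ?mulr0 ?addr0.
transitivity (\sum_(j < k.+1) x ^+ (k - j) * y ^+ j * (x * P j + y * Q j)).
  under eq_bigr do rewrite WS mulrDr.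
  rewrite big_split /= big_ord_recr /= [X in _ + X]big_ord_recl /=.
  have -> : P k.+1 = 0 by rewrite /P /U kosU_gt // !sh0 !wsum0 mulr0 addr0.
  rewrite !mulr0 addr0 add0r -big_split; apply: eq_bigr => j _ /=.
  have lejk : (j <= k)%N by rewrite -ltnS.
  by rewrite subSn // /bump add1n subSS !exprS; ring.
rewrite addnS -addSn -IHk; apply: eq_bigr => j _; congr (_ * _).
rewrite [RHS]/= -/U -[RHS]addr0 -(zero j) /P /Q; by ring.
Qed.
End WordSums.

Lemma coM (K : fieldType) (A : algType K) (B : xs_basis A) p u v :
  co B p (u * v) =
  match p with
  | PE1 => co B PE1 u * co B PE1 v
  | PE2 => co B PE2 u * co B PE2 v
  | PA => co B PE1 u * co B PA v + co B PA u * co B PE1 v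
  | PB => co B PE1 u * co B PB v + co B PB u * co B PE1 v
  | PAB => co B PE1 u * co B PAB v + co B PA u * co B PB v +
           co B PB u * co B PA v + co B PAB u * co B PE1 v
  | PC => co B PE1 u * co B PC v + co B PC u * co B PE2 v
  | PBC => co B PE1 u * co B PBC v + co B PB u * co B PC v +
           co B PBC u * co B PE2 v
  end.
Proof.
have coS I (s : seq I) F : co B p (\sum_(i <- s) F i) = \sum_(i <- s) co B p (F i).
  exact: (big_morph _ (coD B p) (co0 B p)).
have -> : co B p (u * v) = \sum_(q <- xs_paths) \sum_(r <- xs_paths)
    (if xs_comp q r is Some t then
       if xs_path_eq p t then co B q u * co B r v else 0 else 0).
  rewrite {1}(bs_co B u) mulr_suml coS; apply: eq_bigr => q _.
  rewrite {1}(bs_co B v) mulr_sumr coS; apply: eq_bigr => r _.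
  rewrite -scalerAl -scalerAr !coZ bsM.
  case: (xs_comp q r) => [t|]; rewrite ?co_bs ?co0 ?mulr0 //.
  by case: (xs_path_eq p t); rewrite ?mulr1 ?mulr0.
rewrite !big_cons !big_nil.
by case: p {coS}; rewrite /= !(addr0, add0r) ?addrA.
Qed.

(** The algebra L, with a as the outer nilpotent variable and b as the inner one. *)
Definition lam (K : fieldType) := dual (dual K).

(* The basis element a^e b^e'. *)
Definition lamE (K : fieldType) (e e' : bool) : lam K :=
  let v : dual K := if e' then (0, 1) else (1, 0) in
  if e then (0, v) else (v, 0).

Definition lamC (K : fieldType) (k : K) : lam K := ((k, 0), (0, 0)).

Definition lam_co (K : fieldType) (e e' : bool) (l : lam K) : K :=
  let v := if e then l.2 else l.1 in if e' then v.2 else v.1.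

Section Symbol.
Variables (K : fieldType) (A : algType K) (B : xs_basis A).
Local Notation Lam := (lam K).

(** The compression to e1 A e1, which is multiplicative because e2 A e1 = 0. *)
Definition loop_part (u : A) : Lam :=
  ((co B PE1 u, co B PB u), (co B PA u, co B PAB u)).

Fact loop_part_zmod : zmod_morphism loop_part.
Proof.
move=> u v; have coB p : co B p (u - v) = co B p u - co B p v.
  by rewrite coD -scaleN1r coZ mulN1r.
by rewrite /loop_part !coB.
Qed.
HB.instance Definition _ := GRing.isZmodMorphism.Build A Lam loop_part loop_part_zmod.

Fact loop_part_monoid : monoid_morphism loop_part.
Proof.
split.
  rewrite /loop_part (bs1 B) !coD !co_bs /=; congr pair; congr pair; ring.
by move=> u v; rewrite /loop_part !coM; congr pair; congr pair;
  rewrite /= ?dualM1 ?dualM2 /= ?(addr0, add0r) //; ring.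
Qed.
HB.instance Definition _ := GRing.isMonoidMorphism.Build A Lam loop_part loop_part_monoid.

Definition loop_poly (u : A) : {poly Lam} := (loop_part u)%:P.
HB.instance Definition _ := GRing.RMorphism.copy loop_poly (polyC \o loop_part).
End Symbol.

(** * The symbol on cohomology: injectivity, bounds on the image, grading *)

Section SymbolMap.
Variables (K : fieldType) (A : algType K) (B : xs_basis A).
Hypothesis char2 : 2%N \in [pchar K].
Local Notation Lam := (lam K).
Local Notation S := {poly {poly (lam K)}}.
Local Notation ml := hc_multilinear.
Local Notation wsum := (wsum B (loop_poly B) 1 'X).
Local Notation a := (B PA).
Local Notation c := (B PC).

Lemma hcocycle_bound (z : hcocycle A) :
  exists N, forall s, (N <= size s)%N -> hcocycle_val z s = 0.
Proof. by have /hcocycleP[_ h _] := valP z. Qed.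

Definition hbound z := sval (cid (hcocycle_bound z)).

(** The letter a can be given weight 1 because the outer variable already records the length of the
    word. *)
Definition symb0 z : S := \poly_(n < hbound z) wsum n (hcocycle_val z).

Lemma wsum_big (f : hcochain A) n : (forall s, (n <= size s)%N -> f s = 0) -> wsum n f = 0.
Proof.
elim: n f => [|n IHn] f h; first by rewrite /= h // rmorph0.
by rewrite /= !IHn ?mulr0 ?addr0 // => s le; apply: h.
Qed.

Lemma coef_symb0 z n : (symb0 z)`_n = wsum n (hcocycle_val z).
Proof.
rewrite coef_poly; case: ltnP => // le; rewrite wsum_big // => s les.
by apply: (svalP (cid (hcocycle_bound z))); apply: leq_trans les.
Qed.

Fact symb0_zmod : zmod_morphism symb0.
Proof.
move=> z w; apply/polyP => n; rewrite coefB !coef_symb0.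
have -> : hcocycle_val (z - w) = hcocycle_val z + (-1) *: hcocycle_val w.
  by rewrite scaleN1r.
by rewrite wsumD wsumZ scaleN1r rmorphN rmorph1 mulN1r.
Qed.
HB.instance Definition _ :=
  GRing.isZmodMorphism.Build (hcocycle A) S symb0 symb0_zmod.

Lemma cup_char2 (f g : hcochain A) : cup f g = ucup f g.
Proof.
apply/funext => s; rewrite /cup /ucup; apply: eq_bigr => i _.
have -> : (-1 : K) = 1 by exact: (char2_opp char2 (1 : K^o)).
by rewrite expr1n scale1r.
Qed.

Fact symb0_monoid : monoid_morphism symb0.
Proof.
split.
  apply/polyP => n; rewrite coef_symb0 coef1.
  case: n => [|n] /=; first by rewrite rmorph1.
  have sh1 x : sh x (@hc_one K A) = 0 by [].
  by rewrite !sh1 !wsum0 !mulr0 addr0.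
move=> z w; apply/polyP => n; rewrite coefM coef_symb0.
rewrite -[hcocycle_val _]/(cup (hcocycle_val z) (hcocycle_val w)) cup_char2.
by rewrite wsum_ucup; apply: eq_bigr => i _; rewrite !coef_symb0.
Qed.
HB.instance Definition _ :=
  GRing.isMonoidMorphism.Build (hcocycle A) S symb0 symb0_monoid.

Lemma symb0_coboundary z : hcoboundary z -> symb0 z = 0.
Proof.
move=> [g [mg _ eg]]; apply/polyP => n; rewrite coef_symb0 coef0.
by rewrite -[hcocycle_val z]/(val z) eg wsum_hdiff.
Qed.

Local Notation HHA := (HH A).
Local Notation cls := (quot2_pi (hcoboundaries A)).

Definition symb (u : HHA) : S := symb0 (quot2_repr u).

Lemma symbE z : symb (cls z) = symb0 z.
Proof.
apply/eqP; rewrite -subr_eq0 -rmorphB; apply/eqP/symb0_coboundary.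
exact: (@quot2_pi_repr K (hcocycle A) (hcoboundaries A) z).
Qed.

Fact symb_zmod : zmod_morphism symb.
Proof.
move=> u v; have [z ->] := quot2_pi_surj u; have [w ->] := quot2_pi_surj v.
by rewrite -rmorphB !symbE rmorphB.
Qed.
HB.instance Definition _ := GRing.isZmodMorphism.Build HHA S symb symb_zmod.

Fact symb_monoid : monoid_morphism symb.
Proof.
split; first by rewrite -(rmorph1 cls) symbE rmorph1.
move=> u v; have [z ->] := quot2_pi_surj u; have [w ->] := quot2_pi_surj v.
by rewrite -rmorphM !symbE rmorphM.
Qed.
HB.instance Definition _ := GRing.isMonoidMorphism.Build HHA S symb symb_monoid.

Lemma symbZ k u : symb (k *: u) = (lamC k)%:P%:P * symb u.
Proof.
have [z ->] := quot2_pi_surj u; rewrite -linearZ !symbE; apply/polyP => n.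
rewrite coefCM !coef_symb0 -[hcocycle_val _]/(k *: hcocycle_val z) wsumZ.
congr (_%:P * _); rewrite /loop_part !coZ (bs1 B) !coD !co_bs /=.
by rewrite !(addr0, mulr0, mulr1).
Qed.

Lemma loop_part_eq0 u : B PE1 * u = u -> u * B PE1 = u -> loop_part B u = 0 -> u = 0.
Proof.
move=> eu ue [h1 h2 h3 h4]; rewrite -eu -ue (bs_co B u) !big_cons big_nil h1 h2 h3 h4.
rewrite !scale0r !(mulrDl, mulrDr) -!scalerAl -!scalerAr !bsM /=.
by rewrite !(mulr0, mul0r, scaler0, addr0).
Qed.

(** Commuting with e1 kills the coordinates of c and bc, and commuting with c equates those of e1
    and e2. *)
Lemma loop_part_central u : (forall x, x * u = u * x) -> loop_part B u = 0 -> u = 0.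
Proof.
move=> h [h1 h2 h3 h4]; rewrite (bs_co B u) !big_cons big_nil h1 h2 h3 h4.
have := congr1 (co B PC) (h (B PE1)); have := congr1 (co B PBC) (h (B PE1)).
have := congr1 (co B PC) (h c); rewrite !coM /= !co_bs /=.
rewrite !(mulr0, mul0r, mulr1, mul1r, addr0, add0r) h1 => -> -> ->.
by rewrite !scale0r !addr0.
Qed.

Lemma symb0_eq0 z : symb0 z = 0 -> hcoboundary z.
Proof.
move=> h; have /hcocycleP[mz bz dz] := valP z.
have w0 n : wsum n (hcocycle_val z) = 0 by rewrite -coef_symb0 h coef0.
have lp1 : loop_poly B (B PE1) = 1.
  have e : loop_part B (B PE1) = 1 by rewrite /loop_part !co_bs.
  by rewrite /loop_poly e polyC1.
case: (@kos_injective K A B char2 _ mz dz bz) => [||g hg]; last by exists g.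
  have e x : x * val z [::] = val z [::] * x.
    by have := congr1 (@^~ [:: x]) dz; rewrite hdiff1 => /eqP; rewrite subr_eq0 => /eqP.
  apply: loop_part_central e _.
  by have := w0 0%N => /= /eqP; rewrite polyC_eq0 => /eqP.
move=> k j; apply: loop_part_eq0.
- by rewrite -[RHS](congr1 (@^~ [::]) (e1_kosU B (val z) k j)).
- by rewrite -[RHS](congr1 (@^~ [::]) (kosU_e1 B char2 dz k j)).
(* With m = 0 every word sum on the left is constant in 'X, so the coefficient of 'X^j isolates
   [kosU k j [::]]. *)
have := wsum_kosU char2 1 'X lp1 k 0 mz dz; rewrite add0n w0 => hs.
have [lekj|ltkj] := leqP j k; last by rewrite kosU_gt ?rmorph0.
have := congr1 (fun p : {poly Lam} => p`_j) hs; rewrite coef0 coef_sum.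
rewrite (bigD1 (Ordinal (lekj : (j < k.+1)%N))) //= big1 ?addr0 => [|i ne].
  by rewrite expr1n mul1r coefXnM ltnn subnn coefC.
rewrite expr1n mul1r coefXnM coefC; case: ltnP => // le.
case: eqP => // /eqP; rewrite subn_eq0 => le2; case/eqP: ne; apply: val_inj => /=.
by apply/eqP; rewrite eqn_leq le le2.
Qed.

Lemma symb_inj : injective symb.
Proof.
have main u : symb u = 0 -> u = 0.
  have [z ->] := quot2_pi_surj u; rewrite symbE => /symb0_eq0 h.
  by rewrite -(rmorph0 cls); apply/eqP/quot2_piP; rewrite subr0.
by move=> u v /eqP; rewrite -subr_eq0 -rmorphB => /eqP/main/eqP; rewrite subr_eq0 => /eqP.
Qed.

Lemma wsum_coef_gt n q f : (n < q)%N -> (wsum n f)`_q = 0.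
Proof.
elim: n q f => [|n IHn] [|q] f // lt; first by rewrite coefC.
by rewrite /= mul1r coefD coefXM /= !IHn ?addr0 // ltnW.
Qed.

Lemma wsum_coef0 n f : (wsum n f)`_0 = loop_part B (f (nseq n a)).
Proof.
elim: n f => [|n IHn] f; first by rewrite coefC.
by rewrite /= mul1r coefD coefXM /= addr0 IHn.
Qed.

Lemma rm_chain n f : ml f -> rm a f (rcons (nseq n a) c) = f (nseq n.+1 a) * c.
Proof.
elim: n f => [|n IHn] f mf /=; rewrite rm_cons bsM /= -[f (0 :: _)]/(sh 0 f _) sh_0 //.
  by rewrite hc0 add0r char2_opp // rm_nil.
by rewrite hc0 add0r char2_opp // IHn //; apply: ml_sh.
Qed.

Lemma cocycle_central (z : hcocycle A) x : x * val z [::] = val z [::] * x.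
Proof.
have /hcocycleP[_ _ /(congr1 (@^~ [:: x]))] := valP z.
by rewrite hdiff1 => /eqP; rewrite subr_eq0 => /eqP.
Qed.

(** This is the cocycle condition on the word a...ac, whose inner products aa and ac all vanish. *)
Lemma cocycle_loop (z : hcocycle A) n :
  a * val z (rcons (nseq n a) c) = val z (nseq n.+1 a) * c.
Proof.
have /hcocycleP[mz _ dz] := valP z.
by rewrite -rm_chain // cocycle_rm.
Qed.

(** The left side of [cocycle_loop] has no coordinate at c or bc, since ac = abc = 0. So f(a, ...,
    a) has no coordinate at e1 or b. In degree 0 only centrality is available, and it leaves the
    coordinate at e1 free. *)
Lemma symb_coef u n q :
  [/\ (n < q)%N -> (symb u)`_n`_q = 0,
     (0 < n)%N -> ((symb u)`_n`_0).1.1 = 0 & ((symb u)`_n`_0).1.2 = 0].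
Proof.
have [z ->] := quot2_pi_surj u; rewrite symbE coef_symb0 wsum_coef0.
split; first exact: wsum_coef_gt.
  case: n => // n _; have := cocycle_loop z n.
  by move/(congr1 (co B PC)); rewrite !coM /= !co_bs /=
    !(mulr0, mul0r, mulr1, addr0, add0r).
case: n => [|n].
  have := cocycle_central z c.
  by move/(congr1 (co B PBC)); rewrite !coM /= !co_bs /=
    !(mulr0, mul0r, mulr1, addr0, add0r).
have := cocycle_loop z n.
by move/(congr1 (co B PBC)); rewrite !coM /= !co_bs /=
    !(mulr0, mul0r, mulr1, addr0, add0r).
Qed.

(** The degree n part of a cocycle is again a cocycle; if the rest of the symbol vanishes, it has
    the same symbol, hence by injectivity the same class. *)
Lemma HH_degP n u : HH_deg n u <-> forall m, m != n -> (symb u)`_m = 0.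
Proof.
split=> [[z -> hz] m ne|h].
  rewrite symbE coef_symb0; have {hz ne}: forall s, size s = m -> hcocycle_val z s = 0.
    by move=> s es; apply: hz; rewrite es.
  elim: m (hcocycle_val z) => [|m IHm] f hf /=; first by rewrite hf // rmorph0.
  by rewrite !IHm ?mulr0 ?addr0 // => s es; apply: hf; rewrite /= es.
have [z ez] := quot2_pi_surj u; have /hcocycleP[mz [N bz] dz] := valP z.
pose t m : K := (m == n)%:R.
pose zn : hcochain A := fun s => t (size s) *: val z s.
have zn_cocycle : zn \in @hcocycle_pred K A.
  apply/hcocycleP; split.
  - exact: hc_multilinear_size.
  - by exists N => s les; rewrite /zn bz ?scaler0.
  by apply/funext => s; rewrite hdiff_size dz scaler0.
exists (HCocycle zn_cocycle); last first.
  by move=> s /negPf ne; rewrite /= /zn /t ne scale0r.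
apply: symb_inj; apply/polyP => m; rewrite symbE coef_symb0 /=.
have [->|ne] := eqVneq m n; last first.
  rewrite h //; have {h}: forall s, size s = m -> zn s = 0.
    by move=> s es; rewrite /zn /t es (negPf ne) scale0r.
  move: zn {zn_cocycle} => f; elim: m f {ne} => [|m IHm] f hf /=; first by rewrite hf // rmorph0.
  by rewrite -!IHm ?mulr0 ?addr0 // => s es; apply: hf; rewrite /= es.
rewrite ez symbE coef_symb0.
have {zn_cocycle}: forall s, size s = n -> hcocycle_val z s = zn s.
  by move=> s es; rewrite /zn /t es eqxx scale1r.
move: (hcocycle_val z) zn => f g {t h}; elim: n f g => [|n IHn] f g e /=; first by rewrite e.
by congr (_ * _ + _ * _); apply: IHn => s es; apply: e; rewrite /= es.
Qed.
End SymbolMap.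

(** * Cocycles with prescribed symbol *)

Section Generators.
Variables (K : fieldType) (A : algType K) (B : xs_basis A).
Hypothesis char2 : 2%N \in [pchar K].
Local Notation S := {poly {poly (lam K)}}.
Local Notation ml := hc_multilinear.
Local Notation wsum := (wsum B (loop_poly B) 1 'X).
Local Notation H := (hcochain A).
Local Notation e1 := (B PE1).
Local Notation e2 := (B PE2).
Local Notation a := (B PA).
Local Notation b := (B PB).
Local Notation c := (B PC).

Let addKK : forall k : K, k + k = 0 := char2_addvv (V := K^o) char2.

Lemma co_inj (u v : A) : (forall p, co B p u = co B p v) -> u = v.
Proof.
by move=> h; rewrite (bs_co B u) (bs_co B v); apply: eq_bigr => p _; rewrite h.
Qed.

Definition deg1 (F : A -> A) : H := fun s => if s is [:: x] then F x else 0.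

Lemma ml_deg1 F : (forall k x y, F (k *: x + y) = k *: F x + F y) -> ml (deg1 F).
Proof.
by move=> lF [|w [|w' s1]] [|z s2] k x y /=; rewrite ?scaler0 ?addr0 ?lF.
Qed.

Lemma hdiff_deg1 F s : hdiff (deg1 F) s =
  if s is [:: x; y] then x * F y + F (x * y) + F x * y else 0.
Proof.
case: s => [//|x [|y s]]; rewrite hdiff_rm char2_opp //.
  by rewrite rm_nil /= mulr0 mul0r addr0.
have e : sh x (deg1 F) = pt (F x) by apply/funext => -[].
rewrite rm_cons e char2_opp // addrA.
case: s => [|z s] //=; rewrite rm_cons sh_pt rm0 hc0 /= mulr0 !add0r.
by rewrite oppr0.
Qed.

Definition DA := deg1 (fun x => co B PA x *: e1 + co B PAB x *: b).

Definition DB := deg1 (fun x => co B PB x *: e1 + co B PAB x *: a + co B PBC x *: c).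

Definition bDB := deg1 (fun x => co B PB x *: b + co B PAB x *: B PAB + co B PBC x *: B PBC).

Lemma ml_DA : ml DA.
Proof.
by apply: ml_deg1 => k x y; rewrite !co_linear !scalerDl !scalerDr !scalerA addrACA.
Qed.

Lemma ml_DB : ml DB.
Proof.
apply: ml_deg1 => k x y; rewrite !co_linear !scalerDl !scalerDr !scalerA.
by rewrite (addrACA (_ *: e1)) [LHS]addrACA.
Qed.

Lemma ml_bDB : ml bDB.
Proof.
apply: ml_deg1 => k x y; rewrite !co_linear !scalerDl !scalerDr !scalerA.
by rewrite (addrACA (_ *: b)) [LHS]addrACA.
Qed.

Lemma hdiff_DB : hdiff DB = 0.
Proof.
apply/funext => s; rewrite hdiff_deg1; case: s => [|x [|y []]] //.
apply: co_inj => p; rewrite !coD !(coM, coD, coZ) co0.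
by case: p; rewrite /= !(coD, coZ, co_bs) /=
  !(mulr0, mul0r, mulr1, addr0, add0r) //; cancel2 addKK.
Qed.

Lemma hdiff_bDB : hdiff bDB = 0.
Proof.
apply/funext => s; rewrite hdiff_deg1; case: s => [|x [|y []]] //.
apply: co_inj => p; rewrite !coD !(coM, coD, coZ) co0.
by case: p; rewrite /= !(coD, coZ, co_bs) /=
  !(mulr0, mul0r, mulr1, addr0, add0r) //; cancel2 addKK.
Qed.

Lemma loop_part0_e2 u : loop_part B u = 0 -> u * e2 = u.
Proof.
move=> [h1 h2 h3 h4]; apply: co_inj => p.
by case: p; rewrite coM /= !co_bs /=
  !(mulr0, mul0r, mulr1, addr0, add0r) ?h1 ?h2 ?h3 ?h4.
Qed.

(* Extending d/da by 0 to c and bc makes it a derivation up to a defect with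
   values in e1 A e2, which is killed by right multiplication by e1 A. *)
Lemma hdiff_DA_e2 s : hdiff DA s * e2 = hdiff DA s.
Proof.
rewrite hdiff_deg1; case: s => [|x [|y []]]; rewrite ?mul0r //.
apply: loop_part0_e2; congr pair; congr pair; rewrite !coD !(coM, coD, coZ);
rewrite /= !(coD, coZ, co_bs) /=
  !(mulr0, mul0r, mulr1, addr0, add0r) //; cancel2 addKK.
Qed.

Lemma lm_ucup u (f g : H) : lm u (ucup f g) = ucup (lm u f) g.
Proof. by rewrite ucup_lm. Qed.

Definition DAn n (w : H) : H := iter n (ucup DA) w.

Lemma ucup_pt u (g : H) : ucup (pt u) g = lm u g.
Proof.
apply/funext => s; rewrite /ucup big_ord_recl take0 drop0 big1 ?addr0 // => i _.
by case: s i => [|y s] i; [case: i | rewrite mul0r].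
Qed.

Section Chain.
Variable w : H.
Hypotheses (mw : ml w) (bw : hc_bounded w) (dw : hdiff w = 0) (e1w : lm e1 w = w).

Lemma ml_DAn n : ml (DAn n w).
Proof. by elim: n => //= n; apply: hc_multilinear_ucup ml_DA. Qed.

Lemma bounded_DAn n : hc_bounded (DAn n w).
Proof.
elim: n => //= n IHn; rewrite -(cup_char2 char2); apply: hc_bounded_cup => //.
by exists 2 => -[|x [|y s]].
Qed.

Lemma e1_DAn n : lm e1 (DAn n w) = DAn n w.
Proof.
case: n => //= n; rewrite lm_ucup; congr ucup; apply/funext => -[|x [|y s]];
  rewrite /lm /DA /= ?mulr0 //.
by rewrite mulrDr -!scalerAr !bsM.
Qed.

Lemma hdiff_DAn n : hdiff (DAn n w) = 0.
Proof.
elim: n => //= n IHn; rewrite hdiff_ucup IHn.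
have -> : ucup (alt DA) 0 = 0.
  by apply/funext => s; rewrite /ucup big1 // => i _; rewrite mulr0.
rewrite addr0 -e1_DAn; apply/funext => s; rewrite /ucup big1 // => i _.
by rewrite -hdiff_DA_e2 /lm mulrA -(mulrA _ e2) bsM /= mulr0 mul0r.
Qed.

Lemma DAn_cocycle n : DAn n w \in @hcocycle_pred K A.
Proof.
apply/hcocycleP; split; [exact: ml_DAn | exact: bounded_DAn | exact: hdiff_DAn].
Qed.

(** Each factor [DA] takes the value e1 at a and 0 at b, so it acts on word sums as multiplication
    by x. *)
Lemma wsum_DAn n m : wsum m (DAn n w) = if (m < n)%N then 0 else wsum (m - n) w.
Proof.
elim: n m => [|n IHn] m; first by rewrite subn0.
have sD q u : sh (B q) DA = pt u -> sh (B q) (DAn n.+1 w) = lm u (DAn n w).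
  by move=> e; rewrite /= sh_ucup e ucup_pt; apply/funext => s; rewrite hcD /lm mul0r add0r.
have sa : sh a DA = pt e1.
  by apply/funext => -[|y s] //; rewrite /sh /= !co_bs /= scale1r scale0r addr0.
have sb : sh b DA = pt 0.
  by apply/funext => -[|y s] //; rewrite /sh /= !co_bs /= !scale0r addr0.
case: m => [|m]; first by rewrite /= ucup_nil mul0r rmorph0.
rewrite -[LHS]/(1 * wsum m (sh a (DAn n.+1 w)) + 'X * wsum m (sh b (DAn n.+1 w))).
by rewrite (sD _ _ sa) (sD _ _ sb) e1_DAn lm_0 wsum0 mulr0 addr0 mul1r IHn ltnS subSS.
Qed.

Lemma symb_DAn n (F : S) : (forall m, wsum m w = F`_m) ->
  exists u, symb B u = 'X^n * F.
Proof.
move=> wF; exists (quot2_pi (hcoboundaries A) (HCocycle (DAn_cocycle n))).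
apply/polyP => m; rewrite (symbE B char2) coef_symb0 // coefXnM /= wsum_DAn.
by case: ifP => // _; apply: wF.
Qed.
End Chain.

Lemma bounded_deg1 (F : A -> A) : @hc_bounded K A (deg1 F).
Proof. by exists 2%N => -[|x [|y s]]. Qed.

Lemma hdiff_pt (u : A) : (forall x, x * u = u * x) -> hdiff (pt u : H) = 0.
Proof.
move=> h; apply/funext => -[//|x s]; rewrite hdiff_rm.
by case: s => [|y s]; rewrite ?rm_nil /= ?h ?subrr // rm_cons sh_pt rm0 mulr0 hc0 !subr0.
Qed.

Lemma wsum_pt (u : A) m : wsum m (pt u) = ((loop_part B u)%:P%:P : S)`_m.
Proof. by rewrite coefC; case: m => [|m] //=; rewrite !wsum0 !mulr0 addr0. Qed.

Lemma symb_pt n (u : A) : (forall x, x * u = u * x) -> e1 * u = u ->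
  exists v, symb B v = 'X^n * (loop_part B u)%:P%:P.
Proof.
move=> cu e1u; apply: (@symb_DAn (pt u)).
- exact: ml_pt.
- by exists 1%N => -[].
- exact: hdiff_pt.
- by apply/funext => -[|x s]; rewrite /lm /= ?mulr0.
- by move=> m; apply: wsum_pt.
Qed.

Lemma symb_deg1 n F l : ml (deg1 F) -> hdiff (deg1 F) = 0 ->
  (forall x, e1 * F x = F x) -> F a = 0 -> loop_part B (F b) = l ->
  exists v, symb B v = 'X^n * ('X * l%:P)%:P * 'X.
Proof.
move=> mF dF eF Fa Fb.
have [|||v ev] := @symb_DAn (deg1 F) mF _ dF _ n (('X * l%:P)%:P * 'X).
- exact: bounded_deg1.
- by apply/funext => -[|x [|y s]]; rewrite /lm /= ?mulr0.
- move=> m; rewrite coefMX coefC; case: m => [|[|m]] /=.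
  + by rewrite rmorph0.
  + by rewrite /sh /= Fa rmorph0 mulr0 add0r /loop_poly Fb.
  have sh2 x y : sh x (sh y (deg1 F)) = 0 :> H by [].
  by rewrite !sh2 !wsum0 !mulr0 !addr0 !mulr0 addr0.
by exists v; rewrite ev mulrA.
Qed.

Lemma loop_part_bs p : loop_part B (B p) =
  match p with PE1 => lamE K false false | PB => lamE K false true
  | PA => lamE K true false | PAB => lamE K true true | _ => 0 end.
Proof. by case: p; rewrite /loop_part !co_bs. Qed.

Lemma symb_gen_a n e' : exists v, symb B v = 'X^n * (lamE K true e')%:P%:P.
Proof.
case: e'; [have := @symb_pt n (B PAB) | have := @symb_pt n a];
  rewrite loop_part_bs bsM; apply=> //;
  by move=> x; apply: co_inj => p; rewrite !coM;
    case: p; rewrite /= !co_bs /= !(mulr0, mul0r, mulr1, mul1r, addr0, add0r).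
Qed.

Lemma symb_gen_b n e' : exists v,
  symb B v = 'X^n * ('X * (lamE K false e')%:P)%:P * 'X.
Proof.
case: e'; [apply: (symb_deg1 _ ml_bDB hdiff_bDB) | apply: (symb_deg1 _ ml_DB hdiff_DB)].
- by move=> x; rewrite !mulrDr -!scalerAr !bsM.
- by rewrite !co_bs /= !scale0r !addr0.
- by rewrite !co_bs /= !scale0r !addr0 scale1r loop_part_bs.
- by move=> x; rewrite !mulrDr -!scalerAr !bsM.
- by rewrite !co_bs /= !scale0r !addr0.
- by rewrite !co_bs /= !scale0r !addr0 scale1r loop_part_bs.
Qed.
End Generators.

(** * Normal forms in the presented algebra *)

(* (e, e', p, q) encodes the monomial a^e b^e' x^p y^q. *)
Definition code : Type := (bool * bool * nat * nat)%type.

(** These monomials form a basis of K + (a, y) L[x,y]. *)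
Definition valid (c : code) : bool := let: (e, e', p, q) := c in
  [|| (0 < q)%N, e | (p == 0%N) && ~~ e'].

(* The normal monomials of KX / J. *)
Definition nfg (R : nzRingType) (y : nat -> nat -> R) (c : code) : R :=
  let: (e, e', p, q) := c in
  if q is q'.+1 then y 0%N 1%N ^+ e * y 1%N 3%N ^+ q' * y p.+1 (if e' then 4 else 3)%N
  else if e then y p (if e' then 2 else 1)%N else 1.

Definition cdeg (c : code) : nat := let: (e, e', p, q) := c in (p + q)%N.

Section Monomials.
Variable K : fieldType.
Local Notation Lam := (lam K).
Local Notation S := {poly {poly (lam K)}}.
Local Notation KX := {malg K[{cmonom xvar}]}.
Local Notation lamE := (lamE K).

Definition cS (k : K) : S := (lamC k)%:P%:P.

Fact lamC_zmod : zmod_morphism (@lamC K).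
Proof. by move=> k l; congr pair; congr pair; rewrite /= subrr. Qed.
HB.instance Definition _ := GRing.isZmodMorphism.Build K Lam (@lamC K) lamC_zmod.
Fact lamC_monoid : monoid_morphism (@lamC K).
Proof.
split=> // k l; congr pair; congr pair;
  by rewrite /= ?dualM1 ?dualM2 /= !(mul0r, mulr0) ?addr0.
Qed.
HB.instance Definition _ := GRing.isMonoidMorphism.Build K Lam (@lamC K) lamC_monoid.
HB.instance Definition _ := GRing.RMorphism.copy cS (polyC \o polyC \o @lamC K).

Lemma lamEM e1 e1' e2 e2' : lamE e1 e1' * lamE e2 e2' =
  if (e1 && e2) || (e1' && e2') then 0 else lamE (e1 || e2) (e1' || e2').
Proof.
by case: e1 e1' e2 e2' => [] [] [] []; congr pair; congr pair;
  rewrite /= ?dualM1 ?dualM2 /= !(mul0r, mulr0, mul1r, mulr1, addr0, add0r).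
Qed.

Lemma lam_co_lamE e e' f f' : lam_co e e' (lamE f f') = ((e == f) && (e' == f'))%:R.
Proof. by case: e e' f f' => [] [] [] []. Qed.

(* The outer variable counts the cohomological degree and the inner one the y,
   so that x is the outer variable and y the product of both. *)
Definition mon : code -> S := locked (fun c => let: (e, e', p, q) := c in
  'X^(p + q) * ('X^q * (lamE e e')%:P)%:P).

Lemma monE e e' p q :
  mon (e, e', p, q) = 'X^(p + q) * ('X^q * (lamE e e')%:P)%:P.
Proof. by rewrite /mon -lock. Qed.

Definition cf (c : code) (F : S) : K := let: (e, e', p, q) := c in
  lam_co e e' (F`_(p + q))`_q.

Lemma cf_mon c d : cf c (mon d) = (c == d)%:R.
Proof.
case: c d => [[[e e'] p] q] [[[f f'] r] s]; rewrite /cf monE coefXnM coefC.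
have lam_co0 : lam_co e e' (0 : Lam) = 0 by case: e e' => [] [].
have [/eqP pq|] := boolP ((p + q)%N == (r + s)%N); last first.
  move=> ne; have -> : ((e, e', p, q) == (f, f', r, s)) = false.
    by apply/eqP => -[_ _ ep eq]; move: ne; rewrite ep eq eqxx.
  case: ltnP => le; rewrite ?coef0 ?lam_co0 //.
  by rewrite subn_eq0 leqNgt ltn_neqAle eq_sym ne le coef0 lam_co0.
rewrite pq ltnn subnn eqxx coefXnM coefC subn_eq0.
have [eqs|nes] := eqVneq q s.
  move: pq; rewrite eqs => /addIn ->.
  by rewrite ltnn leqnn lam_co_lamE !xpair_eqE !eqxx !andbT.
have -> : ((e, e', p, q) == (f, f', r, s)) = false.
  by apply/eqP => -[_ _ _ eq]; rewrite eq eqxx in nes.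
case: ltnP => le; rewrite ?lam_co0 //.
by rewrite leqNgt ltn_neqAle eq_sym nes le lam_co0.
Qed.

Lemma cfD c F G : cf c (F + G) = cf c F + cf c G.
Proof. by case: c => [[[[] []] p] q]; rewrite /cf !coefD. Qed.

Lemma cf0 c : cf c 0 = 0.
Proof. by case: c => [[[[] []] p] q]; rewrite /cf !coef0. Qed.

Lemma cfZ c k F : cf c (cS k * F) = k * cf c F.
Proof.
by case: c => [[[[] []] p] q]; rewrite /cf /cS !coefCM; case: (_`_q) => [[? ?] [? ?]];
  rewrite /lam_co /= ?dualM1 ?dualM2 /= ?(mul0r, addr0) ?dualM1 ?dualM2 /= ?(mul0r, addr0).
Qed.

Definition nf : code -> KX := nfg (xg K).

Definition tvar (v : nat * nat) : S :=
  match v.2 with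
  | 1 => mon (true, false, v.1, 0%N)
  | 2 => mon (true, true, v.1, 0%N)
  | 3 => mon (false, false, v.1.-1, 1%N)
  | 4 => mon (false, true, v.1.-1, 1%N)
  | _ => 0
  end.

Definition tmon (m : {cmonom xvar}) : S :=
  \prod_(v <- finsupp m) tvar (val v) ^+ m v.

Lemma tmonEw (m : {cmonom xvar}) (d : {fset xvar}) : (finsupp m `<=` d)%fset ->
  tmon m = \prod_(v <- d) tvar (val v) ^+ m v.
Proof.
move=> le; rewrite /tmon (big_fset_incl _ le) // => v _.
by rewrite -cmE_neq0 negbK => /eqP ->.
Qed.

Fact tmon_mmorphism : mmorphism tmon.
Proof.
split; last by rewrite /tmon mdom1 big_seq_fset0.
move=> m1 m2; have le1 := fsubsetUl (finsupp m1) (finsupp m2).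
have le2 := fsubsetUr (finsupp m1) (finsupp m2).
rewrite (tmonEw le1) (tmonEw le2) /tmon mdomD -[RHS]big_split /=.
by apply: eq_bigr => v _; rewrite cmM exprD.
Qed.
HB.instance Definition _ := isMultiplicative.Build {cmonom xvar} S tmon tmon_mmorphism.

Definition tsym : KX -> S := mmap cS tmon.
HB.instance Definition _ := GRing.RMorphism.copy tsym (mmap cS tmon).

Lemma tsymZ k p : tsym (k *: p) = cS k * tsym p.
Proof. exact: mmapZ. Qed.

Lemma tsym_xg n i : is_xvar (n, i) -> tsym (xg K n i) = tvar (n, i).
Proof.
move=> h; rewrite xgE insubT /= /tsym mmapU /= (_ : cS 1 = 1) ?mul1r; last exact: rmorph1.
rewrite /tmon mdomU.
by rewrite big_seq_fset1 cmUU expr1.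
Qed.

Lemma monM c d : mon c * mon d =
  let: (e, e', p, q) := c in let: (f, f', r, s) := d in
  if (e && f) || (e' && f') then 0 else mon (e || f, e' || f', p + r, q + s)%N.
Proof.
case: c d => [[[e e'] p] q] [[[f f'] r] s]; rewrite !monE.
have -> : 'X^(p + q) * ('X^q * (lamE e e')%:P)%:P *
  ('X^(r + s) * ('X^s * (lamE f f')%:P)%:P) =
  'X^(p + r + (q + s)) * ('X^(q + s) * (lamE e e' * lamE f f')%:P)%:P :> S.
  by rewrite addnACA mulrACA -exprD -polyCM mulrACA -exprD -polyCM.
by rewrite lamEM; case: ifP => _; [rewrite !polyC0 mulr0 polyC0 mulr0 | by []].
Qed.

Lemma mon_sqr0 c : (c.1.1.1 || c.1.1.2)%B -> mon c * mon c = 0.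
Proof. by case: c => [[[e e'] p] q] /= h; rewrite monM !andbb h. Qed.

Lemma mon1 : mon (false, false, 0%N, 0%N) = 1.
Proof. by rewrite monE !expr0 !mul1r [lamE _ _](_ : _ = 1) // !polyC1. Qed.

Lemma monX e' p q n :
  mon (false, e', p, q) ^+ n = if e' && (1 < n)%N then 0 else mon (false, e' && (n == 1%N), p * n, q * n)%N.
Proof.
elim: n => [|n IHn]; first by rewrite expr0 !muln0 !andbF mon1.
rewrite exprS IHn {IHn}; case: e' => /=; last by rewrite monM !mulnS.
case: n => [|[|n]] /=; rewrite ?mulr0 // monM /= ?muln0 ?addn0 ?muln1 //.
Qed.

Lemma tsym_nf c : valid c -> tsym (nf c) = mon c.
Proof.
case: c => [[[e e'] p] [|q]] /=.
  case: e => /= [_|/andP[/eqP-> /negPf->]]; last by rewrite rmorph1 mon1.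
  by rewrite tsym_xg; case: e'.
move=> _; rewrite !rmorphM !rmorphXn /= !tsym_xg /tvar //=; last by case: e'.
case: e'; rewrite /= monX /= mul0n mul1n.
  by case: e; rewrite ?expr1 ?expr0 ?mul1r !monM /= ?add0n addn1.
by case: e; rewrite ?expr1 ?expr0 ?mul1r !monM /= ?add0n addn1.
Qed.
End Monomials.

(** * Reduction to normal monomials by the relations *)

Section Spanning.
Variables (K : fieldType) (Q : algType K) (y : nat -> nat -> Q).
Hypothesis mulC : commutative (@GRing.mul Q).
Hypotheses (y11 : forall m n, y m 1%N * y n 1%N = 0)
  (y12 : forall m n, y m 1%N * y n 2%N = 0)
  (y22 : forall m n, y m 2%N * y n 2%N = 0)
  (y24 : forall m n, y m 2%N * y n.+1 4%N = 0)
  (y23 : forall m n, y m 2%N * y n.+1 3%N = y m 1%N * y n.+1 4%N)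
  (y44 : forall m n, y m.+1 4%N * y n.+1 4%N = 0)
  (y13 : forall m n, y m 1%N * y n.+1 3%N = y 0%N 1%N * y (m + n).+1 3%N)
  (y14 : forall m n, y m 1%N * y n.+1 4%N = y 0%N 1%N * y (m + n).+1 4%N)
  (y33 : forall m n, y m.+1 3%N * y n.+1 3%N = y 1%N 3%N * y (m + n).+1 3%N)
  (y34 : forall m n, y m.+1 3%N * y n.+1 4%N = y 1%N 3%N * y (m + n).+1 4%N).

Local Notation nf := (nfg y).

Let mulCA (u v w : Q) : u * (v * w) = v * (u * w).
Proof. by rewrite !mulrA (mulC u). Qed.

(** The relations imitate the multiplication of the monomials a^e b^e' x^p y^q: the whole power of x
    and the factor b can be collected in a single variable, leaving only copies of x_{0,1} and
    x_{1,3} beside it. *)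
Lemma gen_nf n i c : is_xvar (n, i) -> valid c ->
  y n i * nf c = 0 \/ exists2 c', valid c' & y n i * nf c = nf c'.
Proof.
have nfS e e' p q : nf (e, e', p, q.+1) = y 0%N 1%N ^+ e * y 1%N 3%N ^+ q * y p.+1 (if e' then 4 else 3)%N by [].
have nf0 e' p : nf (true, e', p, 0%N) = y p (if e' then 2 else 1)%N by [].
have nf1 e' p : nf (false, e', p, 0%N) = 1 by [].
have ac (u v w z : Q) : u * (v * w * z) = v * w * (u * z) by rewrite mulCA.
have ac2 (u v w z : Q) : u * (v * w * z) = v * (w * (u * z)).
  by rewrite mulCA -mulrA.
have ac3 (u v w z : Q) : u * (v * w * z) = u * v * (w * z) by rewrite !mulrA.
case: c => [[[e e'] p] q] hv vc.
have {hv} : [\/ i = 1%N, i = 2%N, i = 3%N /\ n = n.-1.+1 | i = 4%N /\ n = n.-1.+1].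
  move: hv; rewrite /is_xvar !inE /=.
  case/orP => [/orP[]/eqP->|/andP[/orP[]/eqP-> /prednK <-]];
    by [constructor 1 | constructor 2 | constructor 3 | constructor 4].
move: (n.-1) => n'; case=> [->|->|[-> ->]|[-> ->]] {i}.
- case: q vc => [|q] vc.
    case: e vc => vc; rewrite ?nf0 ?nf1.
      by left; case: e' {vc} => /=; [apply: y12 | apply: y11].
    by right; exists (true, false, n, 0%N); rewrite // mulr1.
  rewrite nfS; case: e {vc} => /=.
    by left; rewrite ac3 expr1 y11 mul0r.
  right; exists (true, e', n + p, q.+1)%N; rewrite // nfS ac expr0 mul1r expr1.
  by case: e' => /=; [rewrite y14 | rewrite y13]; rewrite mulCA mulrA.
- case: q vc => [|q] vc.
    case: e vc => vc; rewrite ?nf0 ?nf1.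
      by left; case: e' {vc} => /=; [rewrite y22 | rewrite mulC y12].
    by right; exists (true, true, n, 0%N); rewrite // mulr1.
  rewrite nfS; case: e {vc} => /=.
    by left; rewrite ac3 expr1 (mulC (y n 2%N)) y12 mul0r.
  rewrite ac; case: e'; first by left; rewrite y24 mulr0.
  right; exists (true, true, n + p, q.+1)%N; rewrite // nfS expr0 mul1r expr1.
  by rewrite y23 y14 mulCA mulrA.
- case: q vc => [|q] vc; right.
    case: e vc => vc; rewrite ?nf0 ?nf1.
      exists (true, e', p + n', 1)%N; rewrite // nfS expr1 expr0 mulr1 [LHS]mulC.
      by case: e' {vc} => /=; [rewrite y23 y14 | rewrite [LHS]y13].
    by exists (false, false, n', 1%N); rewrite // nfS !mul1r mulr1.
  exists (e, e', n' + p, q.+2)%N; rewrite // !nfS ac2 -mulrA exprSr -mulrA.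
  by congr (_ * (_ * _)); case: e' {vc}; [rewrite y34 | rewrite y33].
- case: q vc => [|q] vc.
    case: e vc => vc; rewrite ?nf0 ?nf1.
      case: e' {vc}; first by left; rewrite mulC y24.
      right; exists (true, true, p + n', 1)%N; rewrite // nfS expr1 expr0 mulr1 [LHS]mulC.
      by rewrite [LHS]y14.
    by right; exists (false, true, n', 1%N); rewrite // nfS !mul1r mulr1.
  rewrite nfS ac2; case: e' {vc} => /=; first by left; rewrite y44 !mulr0.
  right; exists (e, true, p + n', q.+2)%N; rewrite // !nfS.
  by rewrite (mulC (y n'.+1 _)) y34 exprSr !mulrA.
Qed.

Definition nf_span (u : Q) := exists2 s : seq (K * code),
  all (fun d => valid d.2) s & u = \sum_(d <- s) d.1 *: nf d.2.

Lemma nf_span0 : nf_span 0.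
Proof. by exists [::]; rewrite ?big_nil. Qed.

Lemma nf_spanD u v : nf_span u -> nf_span v -> nf_span (u + v).
Proof.
move=> [s hs ->] [t ht ->]; exists (s ++ t); first by rewrite all_cat hs.
by rewrite big_cat.
Qed.

Lemma nf_spanZ k u : nf_span u -> nf_span (k *: u).
Proof.
move=> [s hs ->]; exists [seq (k * d.1, d.2) | d <- s]; first by rewrite all_map.
by rewrite big_map scaler_sumr; apply: eq_bigr => d _; rewrite scalerA.
Qed.

Lemma nf_span_nf c : valid c -> nf_span (nf c).
Proof. by move=> vc; exists [:: (1, c)]; rewrite /= ?vc // big_seq1 scale1r. Qed.

Lemma nf_span1 : nf_span 1.
Proof. exact: (@nf_span_nf (false, false, 0%N, 0%N)). Qed.

Lemma nf_spanM n i u : is_xvar (n, i) -> nf_span u -> nf_span (y n i * u).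
Proof.
move=> hv [s hs ->]; rewrite mulr_sumr.
elim: s hs => [|d s IHs] /=; first by rewrite big_nil => _; apply: nf_span0.
case/andP=> vd hs; rewrite big_cons; apply: nf_spanD (IHs hs).
rewrite -scalerAr; apply: nf_spanZ.
by have [->|[c' vc' ->]] := gen_nf hv vd; [apply: nf_span0 | apply: nf_span_nf].
Qed.
End Spanning.

Section Expansion.
Variables (K : fieldType) (V : lmodType K) (C : eqType) (ok : pred C).
Variables (fam : C -> V) (co : C -> V -> K).
Hypotheses (coD : forall c u v, co c (u + v) = co c u + co c v)
  (coZ : forall c k u, co c (k *: u) = k * co c u)
  (co_fam : forall c d, ok d -> co c (fam d) = (c == d)%:R).

(** The dual forms return the total coefficient of each index, so repeated terms can be merged into
    an expansion whose coefficients depend on the vector alone. *)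
Lemma dual_expansion s : all (fun d => ok d.2) s ->
  let u := \sum_(d <- s) d.1 *: fam d.2 in
  exists s' : seq C, [/\ uniq s', all ok s' & u = \sum_(c <- s') co c u *: fam c].
Proof.
move=> oks u; exists (undup [seq d.2 | d <- s]); split; first exact: undup_uniq.
  by apply/allP => c; rewrite mem_undup => /mapP[d ds ->]; apply: (allP oks).
have co0 c : co c 0 = 0 by rewrite -(scale0r (0 : V)) coZ mul0r.
have coE c : co c u = \sum_(d <- s) d.1 * (c == d.2)%:R.
  rewrite /u (big_morph (co c) (coD c) (co0 c)) !big_seq.
  by apply: eq_bigr => d ds; rewrite coZ co_fam // (allP oks).
under eq_bigr => c _ do rewrite coE scaler_suml.
rewrite exchange_big /=; apply: eq_big_seq => d ds.
rewrite (bigD1_seq d.2) ?undup_uniq ?mem_undup ?map_f //= eqxx mulr1.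
by rewrite big1 ?addr0 // => c /negPf ->; rewrite mulr0 scale0r.
Qed.
End Expansion.

(** * The presented algebra and its map to L[x,y] *)

Section PresentedAlgebra.
Variable K : fieldType.
Local Notation S := {poly {poly (lam K)}}.
Local Notation KX := {malg K[{cmonom xvar}]}.
Local Notation xg := (xg K).
Local Notation ppi := (@KXJ_pi K).
Local Notation Q := (KXJ K).

Lemma KX_mulC (p q : KX) : p * q = q * p. Proof. exact: mulrC. Qed.

Lemma ppiM (p q : KX) : ppi (p * q) = ppi p * ppi q.
Proof. exact: (rmorphM (quot2_pi (J_ideal K))). Qed.
Lemma ppiD (p q : KX) : ppi (p + q) = ppi p + ppi q.
Proof. exact: (raddfD (quot2_pi (J_ideal K))). Qed.
Lemma ppiZ k (p : KX) : ppi (k *: p) = k *: ppi p.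
Proof. exact: esym (quot2_piZ (J_ideal K) k p). Qed.
Lemma ppi1 : ppi 1 = 1. Proof. by []. Qed.
Lemma ppi0 : ppi 0 = 0. Proof. exact: (raddf0 (quot2_pi (J_ideal K))). Qed.

Fact KXJ_mulC : commutative (@GRing.mul Q).
Proof.
move=> u v; have [p ->] := quot2_pi_surj u; have [q ->] := quot2_pi_surj v.
exact: etrans (esym (ppiM p q)) (etrans (congr1 ppi (KX_mulC p q)) (ppiM q p)).
Qed.
Definition yg n i : Q := ppi (xg n i).

Lemma yg_rel m i n j : J_rel (xg m i * xg n j) -> yg m i * yg n j = 0.
Proof.
move=> h; have : ppi (xg m i * xg n j) = ppi 0.
  by apply/eqP/quot2_piP; rewrite subr0; apply: gen_ideal_in.
by rewrite ppi0 => <-; rewrite ppiM.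
Qed.

Lemma yg_relB m i n j m' i' n' j' : J_rel (xg m i * xg n j - xg m' i' * xg n' j') ->
  yg m i * yg n j = yg m' i' * yg n' j'.
Proof.
move=> h; have : ppi (xg m i * xg n j) = ppi (xg m' i' * xg n' j').
  by apply/eqP/quot2_piP; apply: gen_ideal_in.
by move=> e; exact: etrans (etrans (esym (ppiM _ _)) e) (ppiM _ _).
Qed.

Let y12 m n : yg m 1%N * yg n 2%N = 0. Proof. exact/yg_rel/J_12. Qed.
Let y23 m n : yg m 2%N * yg n.+1 3%N = yg m 1%N * yg n.+1 4%N.
Proof. exact/yg_relB/J_23. Qed.
(** For m = 0, which the presentation leaves out, both sides coincide. The same holds for the next
    three identities. *)
Let y13 m n : yg m 1%N * yg n.+1 3%N = yg 0%N 1%N * yg (m + n).+1 3%N.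
Proof. by case: m => [//|m]; rewrite -addnS; apply/yg_relB/J_13. Qed.
Let y14 m n : yg m 1%N * yg n.+1 4%N = yg 0%N 1%N * yg (m + n).+1 4%N.
Proof. by case: m => [//|m]; rewrite -addnS; apply/yg_relB/J_14. Qed.
Let y33 m n : yg m.+1 3%N * yg n.+1 3%N = yg 1%N 3%N * yg (m + n).+1 3%N.
Proof.
case: m => [//|m]; have := @yg_relB _ _ _ _ _ _ _ _ (@J_33 K m.+2 n.+1 isT isT).
have -> : (m.+2 + n.+1 - 1)%N = (m.+1 + n).+1 by rewrite addnS subn1.
exact: id.
Qed.
Let y34 m n : yg m.+1 3%N * yg n.+1 4%N = yg 1%N 3%N * yg (m + n).+1 4%N.
Proof.
case: m => [//|m]; have := @yg_relB _ _ _ _ _ _ _ _ (@J_34 K m.+2 n.+1 isT isT).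
have -> : (m.+2 + n.+1 - 1)%N = (m.+1 + n).+1 by rewrite addnS subn1.
exact: id.
Qed.

Lemma nf_span_gen n i u : is_xvar (n, i) -> nf_span yg u -> nf_span yg (yg n i * u).
Proof.
apply: nf_spanM => //; try exact: KXJ_mulC; move=> *.
- exact/yg_rel/J_11.
- exact/yg_rel/J_22.
- exact/yg_rel/J_24.
- exact/yg_rel/J_44.
Qed.

Local Notation U m := (mkmalgU m 1 : KX).

Lemma KX_mulUU (m1 m2 : {cmonom xvar}) : U m1 * U m2 = U (mmul m1 m2).
Proof. by rewrite malgM_def fgmulUU mulr1. Qed.

Lemma xg_val (v : xvar) : xg (val v).1 (val v).2 = U (ucm v).
Proof. by rewrite xgE -surjective_pairing valK. Qed.

(** Splitting one variable at a time off each monomial reduces statements on polynomials to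
    multiplication by a generator. *)
Lemma KX_ind (P : KX -> Prop) : P 1 -> (forall p q, P p -> P q -> P (p + q)) ->
  (forall k p, P p -> P (k *: p)) ->
  (forall n i p, is_xvar (n, i) -> P p -> P (xg n i * p)) -> forall p, P p.
Proof.
move=> P1 PD PZ PM p.
have P0 : P 0 by rewrite -(scale0r (1 : KX)); apply: PZ.
have Pm (m : {cmonom xvar}) : P (U m).
  move: {2}(mdeg m) (erefl (mdeg m)) => d; elim: d m => [|d IHd] m dm.
    by rewrite (mdeg_eq0I dm).
  have /fset0Pn[v vm] : finsupp m != fset0.
    by apply/eqP => m0; rewrite mdegE m0 big_seq_fset0 in dm.
  have em : m = mmul (ucm v) (divcm m (ucm v)).
    apply/eqP/cmP => j; rewrite cmM divcmE cmU; case: eqP => [<-|_] /=.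
      by rewrite subnKC // lt0n cmE_neq0.
    by rewrite subn0.
  rewrite em -KX_mulUU -xg_val; apply: PM.
    by rewrite -surjective_pairing; apply: (valP v).
  by apply: IHd; apply/eqP; rewrite -eqSS -dm [in mdeg m]em mdegM mdegU.
rewrite (monalgE p); elim: (enum_fset (msupp p)) => [|k s IHs].
  by rewrite big_nil.
rewrite big_cons; apply: PD IHs.
have e : mcoeff k p *: U k = (mkmalgU k (mcoeff k p) : KX).
  apply/malgP => q.
  apply: etrans (mcoeffZ _ _ _) _.
  apply: etrans (esym (mcoeffU _ _ _)).
  rewrite mcoeffU.
  by rewrite mulrnAr mulr1.
exact: eq_ind _ P (PZ (mcoeff k p) _ (Pm k)) _ e.
Qed.

Lemma nf_span_all u : nf_span yg u.
Proof.
have [p ->] := quot2_pi_surj u; elim/KX_ind: p.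
- exact: nf_span1.
- by move=> p q hp hq; rewrite -[quot2_pi _ _]/(ppi _) ppiD; apply: nf_spanD.
- by move=> k p hp; rewrite -[quot2_pi _ _]/(ppi _) ppiZ; apply: nf_spanZ.
move=> n i p hv hp; rewrite -[quot2_pi _ _]/(ppi _) ppiM; exact: nf_span_gen.
Qed.

Local Notation tsym := (@tsym K).

Lemma tsymM (p q : KX) : tsym (p * q) = tsym p * tsym q. Proof. exact: rmorphM. Qed.
Lemma tsymD (p q : KX) : tsym (p + q) = tsym p + tsym q. Proof. exact: mmapD. Qed.
Lemma tsymB (p q : KX) : tsym (p - q) = tsym p - tsym q. Proof. exact: mmapB. Qed.
Lemma tsym0 : tsym (0 : KX) = 0. Proof. exact: mmap0. Qed.
Lemma tsym1 : tsym (1 : KX) = 1. Proof. exact: rmorph1. Qed.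

Lemma tsym_rel p : gen_ideal (@J_rel K) p -> tsym p = 0.
Proof.
have two (m i n j m' i' n' j' : nat) :
    is_xvar (m, i) -> is_xvar (n, j) -> is_xvar (m', i') -> is_xvar (n', j') ->
    tvar K (m, i) * tvar K (n, j) = tvar K (m', i') * tvar K (n', j') ->
    tsym (xg m i * xg n j - xg m' i' * xg n' j') = 0.
  move=> h1 h2 h3 h4 e.
  apply: etrans (tsymB _ _) _; apply/eqP; rewrite subr_eq0; apply/eqP.
  apply: etrans (tsymM _ _) _; apply: etrans _ (esym (tsymM _ _)).
  by rewrite (tsym_xg K h1) (tsym_xg K h2) (tsym_xg K h3) (tsym_xg K h4).
have one (m i n j : nat) :
    is_xvar (m, i) -> is_xvar (n, j) ->
    tvar K (m, i) * tvar K (n, j) = 0 -> tsym (xg m i * xg n j) = 0.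
  move=> h1 h2 e; apply: etrans (tsymM _ _) _.
  by rewrite (tsym_xg K h1) (tsym_xg K h2).
elim=> {p} [p|||r p _ hp|r p _ hp].
- case=> m n.
  + by apply: one; rewrite // /tvar monM.
  + by apply: one; rewrite // /tvar monM.
  + by apply: one; rewrite // /tvar monM.
  + by case: n => [//|n] _; apply: one; rewrite // /tvar monM.
  + by case: n => [//|n] _; apply: two; rewrite // /tvar !monM.
  + by case: m n => [//|m] [//|n] _ _; apply: one; rewrite // /tvar monM.
  + by case: m n => [//|m] [//|n] _ _; apply: two; rewrite ?addnS // /tvar !monM /= addnS.
  + by case: m n => [//|m] [//|n] _ _; apply: two; rewrite ?addnS // /tvar !monM /= addnS.
  + by case: m n => [//|[//|m]] [//|n] _ _; apply: two; rewrite ?addnS ?subn1 // /tvar !monM /= addnS.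
  + by case: m n => [//|[//|m]] [//|n] _ _; apply: two; rewrite ?addnS ?subn1 // /tvar !monM /= addnS.
- exact: tsym0.
- by move=> p q _ hp _ hq; apply: etrans (tsymD _ _) _; rewrite hp hq addr0.
- by apply: etrans (tsymM _ _) _; rewrite hp mulr0.
- by apply: etrans (tsymM _ _) _; rewrite hp mul0r.
Qed.

Definition psi (u : Q) : S := tsym (quot2_repr u).

Lemma psiE (p : KX) : psi (ppi p) = tsym p.
Proof.
apply/eqP; rewrite -subr_eq0; apply/eqP.
apply: etrans (esym (tsymB _ _)) (tsym_rel _).
exact: (quot2_pi_repr (J_ideal K) p).
Qed.

Lemma ppi_surj (u : Q) : exists p, u = ppi p.
Proof. exact: quot2_pi_surj. Qed.

Lemma psiD u v : psi (u + v) = psi u + psi v.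
Proof.
have [p ->] := ppi_surj u; have [q ->] := ppi_surj v.
by rewrite !psiE; apply: etrans (congr1 psi (esym (ppiD p q))) _; rewrite psiE; apply: tsymD.
Qed.

Lemma psiM u v : psi (u * v) = psi u * psi v.
Proof.
have [p ->] := ppi_surj u; have [q ->] := ppi_surj v.
by rewrite !psiE; apply: etrans (congr1 psi (esym (ppiM p q))) _; rewrite psiE; apply: tsymM.
Qed.

Lemma psiZ k u : psi (k *: u) = cS k * psi u.
Proof.
have [p ->] := ppi_surj u.
by rewrite !psiE; apply: etrans (congr1 psi (esym (ppiZ k p))) _; rewrite psiE; apply: tsymZ.
Qed.

Lemma psi1 : psi 1 = 1. Proof. by rewrite -ppi1 psiE; apply: tsym1. Qed.

Lemma nfg_ppi c : nfg yg c = ppi (nf K c).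
Proof.
have ppiX (p : KX) n : ppi (p ^+ n) = ppi p ^+ n.
  by elim: n => [|n IHn]; rewrite ?expr0 ?ppi1 // !exprS ppiM IHn.
case: c => [[[e e'] p] [|q]]; first by case: e.
rewrite /nf /nfg; apply: esym; apply: etrans (ppiM _ _) _; congr (_ * _).
by apply: etrans (ppiM _ _) _; congr (_ * _); apply: ppiX.
Qed.

Lemma psi_nf c : valid c -> psi (nfg yg c) = mon K c.
Proof. by move=> vc; rewrite nfg_ppi psiE; apply: tsym_nf. Qed.
End PresentedAlgebra.

Lemma polyCC_mul (R : comNzRingType) n q (c l : R) :
  c%:P%:P * ('X^n * ('X^q * l%:P)%:P) = 'X^n * ('X^q * (c * l)%:P)%:P.
Proof. by rewrite mulrCA -polyCM mulrCA -polyCM. Qed.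

Lemma polyCC_add (R : comNzRingType) n q (l m : R) :
  'X^n * ('X^q * (l + m)%:P)%:P = 'X^n * ('X^q * l%:P)%:P + 'X^n * ('X^q * m%:P)%:P.
Proof. by rewrite polyCD mulrDr polyCD mulrDr. Qed.

Definition nil_code (i : N_index) : code :=
  match i with
  | N_1 n => (true, false, n, 0)
  | N_2 n => (true, true, n, 0)
  | N_4 n => (false, true, n, 1)
  | N_133 l n => (true, false, n, l.+1)
  | N_134 l n => (true, true, n, l.+1)
  | N_34 l n => (false, true, n, l.+2)
  end%N.

Definition nil_decode (c : code) : N_index :=
  match c with
  | (true, false, n, 0) => N_1 n
  | (true, false, n, l.+1) => N_133 l n
  | (true, true, n, 0) => N_2 n
  | (true, true, n, l.+1) => N_134 l n
  | (_, _, n, l.+2) => N_34 l n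
  | (_, _, n, _) => N_4 n
  end%N.

Lemma nil_codeK : cancel nil_code nil_decode.
Proof. by case. Qed.

Lemma nil_decodeK c : valid c -> (c.1.1.1 || c.1.1.2)%B ->
  nil_code (nil_decode c) = c.
Proof. by case: c => [[[[] []] p] [|[|q]]] //=; rewrite andbF. Qed.

Lemma valid_nil_code i : valid (nil_code i). Proof. by case: i. Qed.

Lemma nfg_nil_code (R : nzRingType) (y : nat -> nat -> R) i :
  nfg y (nil_code i) =
  match i with
  | N_1 n => y n 1%N
  | N_2 n => y n 2%N
  | N_4 n => y n.+1 4%N
  | N_133 l n => y 0%N 1%N * y 1%N 3%N ^+ l * y n.+1 3%N
  | N_134 l n => y 0%N 1%N * y 1%N 3%N ^+ l * y n.+1 4%N
  | N_34 l n => y 1%N 3%N ^+ l.+1 * y n.+1 4%N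
  end.
Proof. by case: i => [n|n|n|l n|l n|l n] //=; rewrite ?expr0 ?expr1 ?mul1r. Qed.

(** * The isomorphism *)

Section Isomorphism.
Variables (K : fieldType) (A : algType K) (B : xs_basis A).
Hypothesis char2 : 2%N \in [pchar K].
Local Notation S := {poly {poly (lam K)}}.
Local Notation KX := {malg K[{cmonom xvar}]}.
Local Notation Q := (KXJ K).
Local Notation psi := (@psi K).
Local Notation ppi := (@KXJ_pi K).
Local Notation nfq := (nfg (@yg K)).
Local Notation mon := (mon K).

(** Normal monomials span, and the coordinates of their images are dual to them. So u can be read
    off from [psi u], which yields injectivity, the grading and the nilpotent basis. *)
Lemma psi_expansion (u : Q) : exists s : seq code,
  [/\ uniq s, all valid s & u = \sum_(c <- s) cf c (psi u) *: nfq c].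
Proof.
have [s vs eu] := nf_span_all u.
have [|||s' [us' vs' e]] :=
    @dual_expansion _ _ _ valid nfq (fun c w => cf c (psi w)) _ _ _ s vs.
- by move=> c v w; rewrite psiD cfD.
- by move=> c k v; rewrite psiZ cfZ.
- by move=> c d vd; rewrite psi_nf // cf_mon.
exists s'; split; [exact: us' | exact: vs' |].
by rewrite -eu in e; exact: e.
Qed.

Lemma psi_eq0 (u : Q) : psi u = 0 -> u = 0.
Proof.
move=> e; have [s [_ _ ->]] := psi_expansion u.
by rewrite big1 // => c _; rewrite e cf0 scale0r.
Qed.

Lemma psiB (u v : Q) : psi (u - v) = psi u - psi v.
Proof.
have e : cS (-1 : K) = -1 by exact: rmorphN1.
by rewrite psiD -scaleN1r psiZ e mulN1r.
Qed.

Lemma psi_inj (u v : Q) : psi u = psi v -> u = v.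
Proof.
move=> e; apply/eqP; rewrite -subr_eq0; apply/eqP/psi_eq0.
by rewrite psiB e subrr.
Qed.

Lemma symb_tvar n i : is_xvar (n, i) -> exists v, symb B v = tvar K (n, i).
Proof.
have ga m e' : exists v, symb B v = mon (true, e', m, 0%N).
  by have [v ev] := symb_gen_a B char2 m e'; exists v; rewrite ev monE addn0 expr0 mul1r.
have gb m e' : exists v, symb B v = mon (false, e', m, 1%N).
  have [v ev] := symb_gen_b B char2 m e'; exists v.
  by rewrite ev monE addn1 exprSr expr1 mulrAC.
rewrite /is_xvar !inE /=.
by case/orP => [/orP[]/eqP->|/andP[/orP[]/eqP-> _]]; rewrite /tvar /=.
Qed.

Lemma psi_yg n i : is_xvar (n, i) -> psi (yg K n i) = tvar K (n, i).
Proof. by move=> h; rewrite psiE; apply: tsym_xg. Qed.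

Lemma symb_psi (u : Q) : exists h, symb B h = psi u.
Proof.
have [p ->] := ppi_surj u; elim/KX_ind: p.
- by exists 1; rewrite ppi1 psi1; apply: rmorph1.
- by move=> p q [g eg] [h eh]; exists (g + h); rewrite ppiD psiD -eg -eh; apply: rmorphD.
- by move=> k p [h eh]; exists (k *: h); rewrite ppiZ psiZ -eh; exact: (symbZ B char2 k h).
move=> n i p hv [h eh]; have [g eg] := symb_tvar hv.
by exists (g * h); rewrite ppiM psiM -eh psi_yg // -eg; apply: rmorphM.
Qed.

Definition psi_im (F : S) := exists u : Q, psi u = F.

Lemma psi_im0 : psi_im 0.
Proof. by exists 0; rewrite -(scale0r (0 : Q)) psiZ rmorph0 mul0r. Qed.

Lemma psi_im_sum (I : Type) (r : seq I) (P : pred I) F : (forall i, P i -> psi_im (F i)) ->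
  psi_im (\sum_(i <- r | P i) F i).
Proof.
move=> h; apply: (big_ind psi_im) => //.
  exact: psi_im0.
by move=> ? ? [u <-] [v <-]; exists (u + v); rewrite psiD.
Qed.

Lemma lam_expand (l : lam K) : l =
  lamC (lam_co false false l) * lamE K false false +
  lamC (lam_co false true l) * lamE K false true +
  (lamC (lam_co true false l) * lamE K true false +
  lamC (lam_co true true l) * lamE K true true).
Proof.
case: l => [[l1 l2] [l3 l4]]; congr pair; congr pair;
  by rewrite /= ?dualM1 ?dualM2 /= !(mulr0, mul0r, mulr1, addr0, add0r).
Qed.

Lemma psi_im_mon k e e' n q : (q <= n)%N -> (valid (e, e', n - q, q)%N || (k == 0)) ->
  psi_im ('X^n * ('X^q * (lamC k * lamE K e e')%:P)%:P).
Proof.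
move=> leqn /orP[v|/eqP->]; last first.
  by rewrite rmorph0 mul0r polyC0 mulr0 polyC0 mulr0; apply: psi_im0.
exists (k *: nfq (e, e', n - q, q)%N); rewrite psiZ psi_nf // monE subnK // /cS.
exact: polyCC_mul.
Qed.

(** The constraints of [symb_coef] say exactly that the coordinates at codes that are not [valid]
    vanish; every other monomial is the image of a normal one. *)
Lemma psi_symb h : exists u : Q, psi u = symb B h.
Proof.
suff [u eu] : psi_im (symb B h) by exists u.
rewrite -[symb B h]coefK poly_def; apply: psi_im_sum => n _.
rewrite -mul_polyC [_%:P * 'X^n]mulrC; set G := (symb B h)`_n.
rewrite -[G]coefK poly_def rmorph_sum mulr_sumr; apply: psi_im_sum => q _ /=.
rewrite -mul_polyC [_%:P * 'X^q]mulrC.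
have [hgt h0 h1] := symb_coef B char2 h n q.
have [leqn|ltnq] := leqP q n; last first.
  by rewrite -/G in hgt; rewrite (hgt ltnq) polyC0 mulr0 polyC0 mulr0; apply: psi_im0.
have im2 l1 l2 : psi_im ('X^n * ('X^q * l1%:P)%:P) -> psi_im ('X^n * ('X^q * l2%:P)%:P) ->
    psi_im ('X^n * ('X^q * (l1 + l2)%:P)%:P).
  move=> [u eu] [v ev]; exists (u + v).
  by rewrite psiD eu ev; exact: esym (polyCC_add _ _ _ _).
rewrite (lam_expand G`_q); apply: (im2); apply: (im2); apply: psi_im_mon => //.
- rewrite /valid; have [q0|//] := posnP (q : nat); rewrite q0 subn0 andbT.
  have [n0|n_gt0] := posnP (n : nat); first by apply/orP; left; apply/eqP.
  by rewrite /lam_co /G (h0 n_gt0) eqxx orbT.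
- rewrite /valid; have [q0|//] := posnP (q : nat); rewrite q0 andbF.
  by rewrite /lam_co /G h1 eqxx.
- by rewrite /valid orbT.
- by rewrite /valid orbT.
Qed.

(** * Compatibility with the gradings *)

Lemma wdegEw (m : {cmonom xvar}) (d : {fset xvar}) : (finsupp m `<=` d)%fset ->
  wdeg m = (\sum_(v <- d) m v * xdeg v)%N.
Proof.
move=> le; rewrite /wdeg (big_fset_incl _ le) // => v _.
by rewrite -cmE_neq0 negbK => /eqP ->.
Qed.

Lemma wdegM (m1 m2 : {cmonom xvar}) : wdeg (mmul m1 m2) = (wdeg m1 + wdeg m2)%N.
Proof.
have le1 := fsubsetUl (finsupp m1) (finsupp m2).
have le2 := fsubsetUr (finsupp m1) (finsupp m2).
rewrite (wdegEw le1) (wdegEw le2) /wdeg mdomD -[RHS]big_split /=.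
by apply: eq_bigr => v _; rewrite cmM mulnDl.
Qed.

Definition homog n (F : S) := exists G, F = 'X^n * G%:P.

Lemma homogM m n F G : homog m F -> homog n G -> homog (m + n) (F * G).
Proof.
by move=> [F' ->] [G' ->]; exists (F' * G'); rewrite polyCM exprD mulrACA.
Qed.

Lemma homog1 : homog 0 1.
Proof. by exists 1; rewrite expr0 mul1r polyC1. Qed.

Lemma homogX m k F : homog m F -> homog (k * m) (F ^+ k).
Proof.
move=> hF; elim: k => [|k IHk]; first exact: homog1.
by rewrite exprS mulSn; apply: homogM.
Qed.

Lemma homog_mon c : homog (cdeg c) (mon c).
Proof.
by case: c => [[[e e'] p] q]; rewrite monE; exists ('X^q * (lamE K e e')%:P).
Qed.

Lemma homog_tmon m : homog (wdeg m) (tmon K m).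
Proof.
rewrite /wdeg /tmon; elim: (enum_fset _) => [|v s IHs].
  by rewrite !big_nil; apply: homog1.
rewrite !big_cons; apply: homogM IHs; apply: homogX.
have := valP v; rewrite /xdeg; case: (val v) => n i /=; rewrite /is_xvar !inE /=.
case/orP => [/orP[]/eqP->|/andP[/orP[]/eqP-> n_gt0]]; rewrite /tvar /=.
- by have := homog_mon (true, false, n, 0%N); rewrite /cdeg addn0.
- by have := homog_mon (true, true, n, 0%N); rewrite /cdeg addn0.
- by have := homog_mon (false, false, n.-1, 1%N); rewrite /cdeg addn1 prednK.
- by have := homog_mon (false, true, n.-1, 1%N); rewrite /cdeg addn1 prednK.
Qed.

Lemma homog_coef n m F : homog n F -> m != n -> F`_m = 0.
Proof.
move=> [G ->] ne; rewrite coefXnM coefC; case: ltnP => // le.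
by rewrite subn_eq0 leqNgt ltn_neqAle eq_sym ne le.
Qed.

Lemma KX_deg0 n : KX_deg n (0 : KX).
Proof. by move=> m; rewrite msupp0 inE. Qed.

Lemma KX_degD n (p q : KX) : KX_deg n p -> KX_deg n q -> KX_deg n (p + q).
Proof.
move=> hp hq m /(fsubsetP (msuppD_le _ _)); rewrite inE.
by case/orP; [apply: hp | apply: hq].
Qed.

Lemma KX_degZ n k (p : KX) : KX_deg n p -> KX_deg n (k *: p).
Proof. by move=> hp m /(fsubsetP (msuppZ_le _ _)); apply: hp. Qed.

Lemma KX_degM m n (p q : KX) : KX_deg m p -> KX_deg n q -> KX_deg (m + n) (p * q).
Proof.
move=> hp hq k /msuppM_le[k1 [k2 [h1 h2 ->]]].
by rewrite wdegM (hp _ h1) (hq _ h2).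
Qed.

Lemma KX_deg1 : KX_deg 0 (1 : KX).
Proof.
move=> m /(fsubsetP msuppU_le); rewrite inE => /eqP ->.
by rewrite /wdeg mdom1 big_seq_fset0.
Qed.

Lemma KX_degX m k (p : KX) : KX_deg m p -> KX_deg (k * m) (p ^+ k).
Proof.
move=> hp; elim: k => [|k IHk]; first exact: KX_deg1.
by rewrite exprS mulSn; apply: KX_degM.
Qed.

Lemma KX_deg_xg n i : KX_deg n (xg K n i).
Proof.
rewrite xgE; case: insubP => [v _ ev|_]; last exact: KX_deg0.
move=> m /(fsubsetP msuppU_le); rewrite inE => /eqP ->.
by rewrite /wdeg mdomU big_seq_fset1 cmUU mul1n /xdeg ev.
Qed.

Lemma KX_deg_nf c : valid c -> KX_deg (cdeg c) (nf K c).
Proof.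
case: c => [[[e e'] p] [|q]] /=; rewrite ?addn0.
  case: e => [_|/andP[/eqP-> _]]; [exact: KX_deg_xg | exact: KX_deg1].
move=> _; have := KX_degM (KX_degM (@KX_degX 0 e _ (@KX_deg_xg 0 1))
  (@KX_degX 1 q _ (@KX_deg_xg 1 3))) (@KX_deg_xg p.+1 (if e' then 4 else 3)).
have -> : (e * 0 + q * 1 + p.+1 = p + q.+1)%N.
  by rewrite muln0 muln1 add0n !addnS addnC.
exact: id.
Qed.

Lemma psi_coef_deg n (u : Q) : KXJ_deg n u <-> forall m, m != n -> (psi u)`_m = 0.
Proof.
split=> [[p -> hp] m ne|h].
  rewrite psiE /tsym /mmap coef_sum big_seq big1 // => k kp.
  by rewrite /cS coefCM (homog_coef (homog_tmon k)) ?mulr0 // (hp _ kp).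
have [s [_ /allP vs eu]] := psi_expansion u.
(* This representative is homogeneous: coefficients at normal monomials of other degrees are
   coordinates of vanishing parts of [psi u]. *)
exists (\sum_(c <- s) cf c (psi u) *: nf K c).
  rewrite {1}eu; elim: (s) => [|c r IHr]; first by rewrite !big_nil -ppi0.
  by rewrite !big_cons IHr nfg_ppi -ppiZ; apply: esym; apply: ppiD.
rewrite big_seq; apply: (big_ind (@KX_deg K n)) => [|p q|c cs].
- exact: KX_deg0.
- exact: KX_degD.
have [<-|ne] := eqVneq (cdeg c) n; first by apply/KX_degZ/KX_deg_nf/vs.
have -> : cf c (psi u) = 0.
  by case: c ne {cs} => [[[e e'] p] q] ne; rewrite /cf h // coef0; case: e e' {ne} => [] [].
by rewrite scale0r; apply: KX_deg0.
Qed.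

(** Both [psi] and the symbol are injective with the same image, so this is the inverse of the
    symbol after [psi]. Every property below is checked after applying the symbol. *)
Definition iso (u : Q) : HH A := sval (cid (symb_psi u)).

Lemma symb_iso u : symb B (iso u) = psi u.
Proof. exact: svalP (cid (symb_psi u)). Qed.

Let sinj : injective (symb B) := symb_inj (B := B) char2.

Let symbD g h : symb B (g + h) = symb B g + symb B h. Proof. exact: rmorphD. Qed.
Let symbM g h : symb B (g * h) = symb B g * symb B h. Proof. exact: rmorphM. Qed.
Let symb1 : symb B 1 = 1. Proof. exact: rmorph1. Qed.
Let symb0 : symb B 0 = 0. Proof. exact: rmorph0. Qed.
Let cf_symbZ c k h : cf c (symb B (k *: h)) = k * cf c (symb B h).
Proof. have e := symbZ B char2 k h; rewrite e; exact: cfZ. Qed.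

Fact iso_linear : linear iso.
Proof.
move=> k u v; apply: sinj; apply: etrans (symb_iso _) _.
apply: etrans _ (esym (symbD _ _)); apply: etrans (psiD _ _) _.
congr (_ + _); last exact: esym (symb_iso v).
apply: etrans (psiZ _ _) (etrans _ (esym (symbZ B char2 k (iso u)))).
by congr (_ * _); exact: esym (symb_iso u).
Qed.

Fact iso_monoid : monoid_morphism iso.
Proof.
split=> [|u v]; apply: sinj; apply: etrans (symb_iso _) _.
  by apply: etrans (@psi1 K) (esym symb1).
apply: etrans (psiM _ _) (etrans _ (esym (symbM _ _))).
by congr (_ * _); exact: esym (symb_iso _).
Qed.

HB.instance Definition _ := GRing.isLinear.Build K Q (HH A) _ iso iso_linear.
HB.instance Definition _ := GRing.isMonoidMorphism.Build Q (HH A) iso iso_monoid.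

Lemma iso_inj : injective iso.
Proof. by move=> u v e; apply: psi_inj; rewrite -!symb_iso e. Qed.

Lemma iso_surj h : exists u, iso u = h.
Proof.
by have [u eu] := psi_symb h; exists u; apply: sinj; apply: etrans (symb_iso u) eu.
Qed.

Lemma iso_bij : bijective iso.
Proof.
exists (fun h => sval (cid (iso_surj h))) => [u|h].
  by apply: iso_inj; apply: (svalP (cid (iso_surj (iso u)))).
exact: (svalP (cid (iso_surj h))).
Qed.

Lemma iso_deg n u : KXJ_deg n u <-> HH_deg n (iso u).
Proof.
rewrite psi_coef_deg (HH_degP B char2).
by split=> h m ne; have := h m ne; rewrite symb_iso.
Qed.

(** * The ideal generated by homogeneous nilpotents *)

Lemma nf_nil_code i : nf K (nil_code i) = N_family K i.
Proof.
by apply: etrans (nfg_nil_code (xg K) i) _; case: i.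
Qed.

Definition nil_fam i := iso (KXJ_pi (N_family K i)).

Lemma nil_fam_decode c : valid c -> (c.1.1.1 || c.1.1.2)%B ->
  nil_fam (nil_decode c) = iso (nfq c).
Proof.
move=> vc hc; have e : ppi (N_family K (nil_decode c)) = nfq c.
  by rewrite nfg_ppi -nf_nil_code nil_decodeK.
by rewrite /nil_fam e.
Qed.

Lemma symb_nil_fam i : symb B (nil_fam i) = mon (nil_code i).
Proof.
by rewrite symb_iso -nf_nil_code -nfg_ppi psi_nf //; apply: valid_nil_code.
Qed.

Lemma nil_fam_deg i : HH_deg (cdeg (nil_code i)) (nil_fam i).
Proof.
apply/(HH_degP B char2) => m ne; rewrite symb_nil_fam.
exact: homog_coef (homog_mon _) ne.
Qed.

Lemma nil_fam_sqr i : nil_fam i ^+ 2 = 0.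
Proof.
have e : mon (nil_code i) * mon (nil_code i) = 0.
  by apply: mon_sqr0; case: i.
rewrite expr2; apply: sinj; apply: etrans (symbM _ _) _.
by rewrite symb_nil_fam e; exact: esym (rmorph0 (symb B)).
Qed.

Lemma nil_fam_ideal i : nil_ideal (nil_fam i).
Proof.
apply: gen_ideal_in; split; first by exists (cdeg (nil_code i)); apply: nil_fam_deg.
by exists 2%N; apply: nil_fam_sqr.
Qed.

(* Reduction modulo (a, b), to the domain K[x, y]. *)
Definition red : S -> {poly {poly K}} :=
  map_poly (map_poly (@dual_fst K \o @dual_fst (dual K))).
HB.instance Definition _ := GRing.RMorphism.copy red
  (map_poly (map_poly (@dual_fst K \o @dual_fst (dual K)))).

Let redD F G : red (F + G) = red F + red G. Proof. exact: rmorphD. Qed.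
Let redM F G : red (F * G) = red F * red G. Proof. exact: rmorphM. Qed.

Lemma cf_red p q F : red F = 0 -> cf (false, false, p, q) F = 0.
Proof.
move=> h; have := congr1 (fun G : {poly {poly K}} => G`_(p + q)`_q) h.
by rewrite /red !coef_map !coef0.
Qed.

Lemma nil_ideal_red h : nil_ideal h -> red (symb B h) = 0.
Proof.
elim=> {h} [h [_ [k hk]]||g h _ eg _ eh|g h _ eh|g h _ eh].
- have : red (symb B h) ^+ k = 0.
    by rewrite -!rmorphXn hk !rmorph0.
  by move/eqP; rewrite expf_eq0 => /andP[_ /eqP].
- by rewrite !rmorph0.
- by rewrite symbD redD eg eh addr0.
- by rewrite symbM redM eh mulr0.
- by rewrite symbM redM eh mul0r.
Qed.

Lemma nil_ideal_sum (s : seq (K * N_index)) :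
  nil_ideal (\sum_(d <- s) d.1 *: nil_fam d.2).
Proof.
elim: s => [|d s IHs]; first by rewrite big_nil; apply: gen_ideal0.
rewrite big_cons; apply: gen_idealD IHs.
by rewrite -mulr_algl; apply: gen_idealMl; apply: nil_fam_ideal.
Qed.

Lemma nil_basis : is_basis nil_fam (@nil_ideal K A).
Proof.
split=> [v|n i k inj_i e j].
  split=> [/nil_ideal_red hv|[s ->]]; last exact: nil_ideal_sum.
  have [u eu] := iso_surj v; have [s [_ /allP vs es]] := psi_expansion u.
  (* The discarded codes contain neither a nor b; their coefficients survive reduction modulo (a,
     b), hence are zero for an element of the ideal. *)
  exists [seq (cf c (psi u), nil_decode c) | c <- s & (c.1.1.1 || c.1.1.2)%B].
  rewrite big_map big_filter -eu [in LHS]es (raddf_sum iso) /= [RHS]big_mkcond /=.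
  rewrite !big_seq; apply: eq_bigr => c cs; rewrite linearZ.
  have vc := vs _ cs; case: ifP => hc.
    by rewrite /= (nil_fam_decode vc hc).
  suff -> : cf c (psi u) = 0 by rewrite /= scale0r.
  case: c hc {cs vc} => [[[[] []] p] q] //= _.
  by apply: cf_red; rewrite -symb_iso eu.
have cfS (r : seq 'I_n) :
    cf (nil_code (i j)) (symb B (\sum_(l <- r) k l *: nil_fam (i l)))
    = \sum_(l <- r) k l * (j == l)%:R.
  elim: r => [|l r IHr].
    by rewrite !big_nil symb0 cf0.
  rewrite !big_cons -IHr symbD cfD; congr (_ + _).
  rewrite cf_symbZ symb_nil_fam cf_mon; congr (_ * _%:R); congr nat_of_bool.
  by apply/eqP/eqP => [/(can_inj nil_codeK)/inj_i|->].
have := cfS (index_enum 'I_n); rewrite e (bigD1 j) //= eqxx mulr1 big1 ?addr0.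
  by rewrite symb0 cf0 => <-.
by move=> l /negPf ne; rewrite eq_sym ne mulr0.
Qed.

Theorem iso_main : exists phi : {lrmorphism KXJ K -> HH A},
    [/\ bijective phi,
        forall (n : nat) (u : KXJ K), KXJ_deg n u <-> HH_deg n (phi u)
      & is_basis (fun i : N_index => phi (KXJ_pi (N_family K i)))
          (@nil_ideal K A)].
Proof.
by exists iso; split; [exact: iso_bij | exact: iso_deg | exact: nil_basis].
Qed.
End Isomorphism.

(** * The path basis *)

Lemma xs_paths_delta (K : nzRingType) (V : lmodType K) (F : xs_path -> V) q :
  \sum_(p <- xs_paths) (xs_path_eq p q)%:R *: F p = F q.
Proof.
by rewrite !big_cons !big_nil; case: q; rewrite /= !(scale0r, scale1r, add0r, addr0).
Qed.

Section PathClasses.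
Variable K : fieldType.
Local Notation Q := xs_quiver.
Local Notation KQ := (path_alg xs_quiver K).
Local Notation A := (xs_alg K).

Definition xs_compo (o o' : option xs_path) : option xs_path :=
  if o is Some p then if o' is Some q then xs_comp p q else None else None.

Arguments xs_compo : simpl never.

(** With [None] as zero this is a finite check on the multiplication table. It makes the class of a
    path multiplicative. *)
Lemma xs_compoA : associative xs_compo.
Proof. by case=> [[]|] [[]|] [[]|]. Qed.

Definition xs_stat (v : xs_vertex) := if v is V1 then PE1 else PE2.
Definition xs_arr (x : xs_arrow) :=
  match x with Xa => PA | Xb => PB | Xc => PC end.

Fixpoint arrows_class (v : xs_vertex) (s : seq xs_arrow) : option xs_path :=
  if s is x :: s' then
    xs_compo (Some (xs_arr x)) (arrows_class (xs_target x) s')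
  else Some (xs_stat v).

(** The image of a path in A: a basis path, or [None] if the path lies in I. *)
Definition path_class (t : qpath Q) := arrows_class (psource t) (parrows t).

Lemma arrows_class_idl v s : is_qpath (Q := Q) v s ->
  xs_compo (Some (xs_stat v)) (arrows_class v s) = arrows_class v s.
Proof.
case: s => [|x s] /=; first by case: v.
by case/andP => /eqP <- _; rewrite xs_compoA; case: x.
Qed.

Lemma arrows_class_cat v s s' : is_qpath (Q := Q) v (s ++ s') ->
  arrows_class v (s ++ s') =
  xs_compo (arrows_class v s) (arrows_class (last v (map xs_target s)) s').
Proof.
elim: s v => [|x s IHs] v; first by move=> h; rewrite /= arrows_class_idl.
move=> /andP[_ h]; by rewrite [LHS]/= (IHs _ h) xs_compoA.
Qed.

Lemma path_class_idr t :
  xs_compo (path_class t) (Some (xs_stat (ptarget t))) = path_class t.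
Proof.
have := @arrows_class_cat (psource t) (parrows t) [::].
by rewrite cats0 => h; rewrite [RHS]h //; apply: (valP t).
Qed.

Lemma path_class_comp t u :
  (if Defs.pcomp t u is Some r then path_class r else None) =
  xs_compo (path_class t) (path_class u).
Proof.
case: (pcompP t u) => [r e s a ta|ne].
  rewrite /path_class s a arrows_class_cat -?e //.
  by have := valP r; rewrite -/(psource r) -/(parrows r) s a.
rewrite -path_class_idr -[path_class u]arrows_class_idl; last exact: (valP u).
rewrite xs_compoA -(xs_compoA (path_class t)).
by case: (ptarget t) (psource u) ne => [] [] // _; case: (path_class t).
Qed.

Definition ev (w : qpath Q -> K) (f : KQ) : K := \sum_(t <- msupp f) mcoeff t f * w t.

Lemma evw w (d : {fset qpath Q}) (f : KQ) : (msupp f `<=` d)%fset ->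
  ev w f = \sum_(t <- d) mcoeff t f * w t.
Proof.
move=> le; rewrite /ev (big_fset_incl _ le) // => t _ /mcoeff_outdom ->.
by rewrite mul0r.
Qed.

Lemma ev_linear w k (f g : KQ) : ev w (k *: f + g) = k * ev w f + ev w g.
Proof.
pose d := (msupp f `|` msupp g)%fset.
have lf : (msupp f `<=` d)%fset by apply: fsubsetUl.
have lg : (msupp g `<=` d)%fset by apply: fsubsetUr.
have lfg : (msupp (k *: f + g) `<=` d)%fset.
  by apply: fsubset_trans (msuppD_le _ _) _; apply: fsetSU; apply: msuppZ_le.
rewrite (evw w lfg) (evw w lf) (evw w lg) mulr_sumr -big_split.
by apply: eq_bigr => t _ /=; rewrite mcoeffD mcoeffZ mulrDl mulrA.
Qed.

Lemma ev_basis w t : ev w (path_basis K (Some t)) = w t.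
Proof. by rewrite (evw w msuppU_le) big_seq_fset1 mcoeffUU mul1r. Qed.

(** The coordinate form of p, defined on the path algebra itself. Its vanishing on I is what makes
    the seven basis paths independent in A. *)
Definition rho p : KQ -> K :=
  ev (fun t => if path_class t is Some q then (xs_path_eq p q)%:R else 0).

Lemma rho_linear p k (f g : KQ) : rho p (k *: f + g) = k * rho p f + rho p g.
Proof. exact: ev_linear. Qed.
Lemma rho0 p : rho p 0 = 0.
Proof. by rewrite /rho /ev msupp0 big_seq_fset0. Qed.
Lemma rhoD p (f g : KQ) : rho p (f + g) = rho p f + rho p g.
Proof. by rewrite -[f]scale1r rho_linear mul1r scale1r. Qed.
Lemma rhoZ p k (f : KQ) : rho p (k *: f) = k * rho p f.
Proof. by rewrite -[_ *: f]addr0 rho_linear rho0 addr0. Qed.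
Lemma rhoB p (f g : KQ) : rho p (f - g) = rho p f - rho p g.
Proof. by rewrite rhoD -scaleN1r rhoZ mulN1r. Qed.
Lemma rho_sum p (I : Type) (r : seq I) (F : I -> KQ) :
  rho p (\sum_(i <- r) F i) = \sum_(i <- r) rho p (F i).
Proof. exact: (big_morph (rho p) (rhoD p) (rho0 p)). Qed.

Definition xs_coef p (o : option xs_path) : K :=
  if o is Some q then (xs_path_eq p q)%:R else 0.

Lemma rho_basis p o :
  rho p (path_basis K o) = xs_coef p (if o is Some t then path_class t else None).
Proof. by case: o => [t|]; [apply: ev_basis | apply: rho0]. Qed.

Lemma rho_class (h : option xs_path -> K) f : h None = 0 ->
  ev (fun t => h (path_class t)) f = \sum_(q <- xs_paths) h (Some q) * rho q f.
Proof.
move=> h0; under eq_bigr do rewrite /rho /ev mulr_sumr.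
rewrite exchange_big; apply: eq_bigr => t _.
under eq_bigr do rewrite mulrCA; rewrite -mulr_sumr; congr (_ * _).
case: (path_class t) => [q|]; last by rewrite big1 // => p _; rewrite mulr0.
by rewrite !big_cons !big_nil; case: q; rewrite /= !(mulr0, mulr1, add0r, addr0).
Qed.

Lemma rhoM p (f g : KQ) : rho p (f * g) =
  \sum_(q <- xs_paths) \sum_(r <- xs_paths)
    rho q f * (rho r g * xs_coef p (xs_comp q r)).
Proof.
have -> : f * g = \sum_(t <- msupp f) \sum_(u <- msupp g)
    (mcoeff t f * mcoeff u g) *: path_basis K (Defs.pcomp t u) by exact: path_mulE.
rewrite rho_sum.
transitivity (ev (fun t => ev (fun u => xs_coef p (xs_compo (path_class t) (path_class u))) g) f).
  apply: eq_bigr => t _; rewrite rho_sum /ev mulr_sumr; apply: eq_bigr => u _.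
  by rewrite rhoZ rho_basis path_class_comp mulrA.
pose h o := ev (fun u => xs_coef p (xs_compo o (path_class u))) g.
rewrite -[LHS]/(ev (fun t => h (path_class t)) f) rho_class.
  apply: eq_bigr => q _; rewrite /h.
  rewrite (@rho_class (fun o => xs_coef p (xs_compo (Some q) o))) //.
  by rewrite mulrC mulr_sumr; apply: eq_bigr => r _; rewrite [rho r g * _]mulrC.
by rewrite /h /ev big1 // => u _; rewrite mulr0.
Qed.

Definition path_elt (p : xs_path) : KQ :=
  match p with
  | PE1 => path_basis K (Some (@pid Q V1)) | PE2 => path_basis K (Some (@pid Q V2))
  | PA => xs_elt K Xa | PB => xs_elt K Xb | PC => xs_elt K Xc
  | PAB => xs_elt K Xa * xs_elt K Xb | PBC => xs_elt K Xb * xs_elt K Xc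
  end.

Lemma rho_elt x p : rho p (xs_elt K x) = (xs_path_eq p (xs_arr x))%:R.
Proof. by rewrite /xs_elt arrow_eltE rho_basis; case: x. Qed.

Lemma eltME x y :
  xs_elt K x * xs_elt K y = path_basis K (Defs.pcomp (@parrow Q x) (@parrow Q y)).
Proof. by rewrite /xs_elt !arrow_eltE; apply: path_mul_basis. Qed.

Lemma rho_eltM x y p :
  rho p (xs_elt K x * xs_elt K y) = xs_coef p (xs_comp (xs_arr x) (xs_arr y)).
Proof. by rewrite eltME rho_basis path_class_comp; case: x y => [] []. Qed.

Lemma rho_path_elt p q : rho p (path_elt q) = (xs_path_eq p q)%:R.
Proof. by case: q; rewrite /path_elt ?rho_eltM ?rho_elt ?rho_basis. Qed.

(** By [rhoM] the common kernel of the forms is a two-sided ideal, so only the four relations need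
    checking. *)
Lemma rho_ideal f : gen_ideal (@xs_rel K) f -> forall p, rho p f = 0.
Proof.
elim=> {f} [f hf p||f g _ hf _ hg p|r f _ hf p|r f _ hf p].
- by case: hf; rewrite ?expr2 ?rhoB !rho_eltM ?subrr.
- exact: rho0.
- by rewrite rhoD hf hg addr0.
- rewrite rhoM big1 // => q _; rewrite big1 // => t _.
  by rewrite hf mul0r mulr0.
- by rewrite rhoM big1 // => q _; rewrite big1 // => t _; rewrite hf mul0r.
Qed.

Local Notation J := (gen_proper_ideal2 (@xs_rel_proper K)).
Local Notation api := (quot2_pi J : KQ -> A).

Definition xs_co (p : xs_path) (u : A) : K := rho p (quot2_repr u).
Definition xs_bs (p : xs_path) : A := api (path_elt p).

Lemma xs_coE p f : xs_co p (api f) = rho p f.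
Proof.
apply/eqP; rewrite -subr_eq0 -rhoB; apply/eqP; apply: rho_ideal.
exact: (quot2_pi_repr J f).
Qed.

Lemma apiM (f g : KQ) : api (f * g) = api f * api g.
Proof. exact: (rmorphM (quot2_pi J)). Qed.
Lemma apiD (f g : KQ) : api (f + g) = api f + api g.
Proof. exact: (raddfD (quot2_pi J)). Qed.
Lemma apiZ k (f : KQ) : api (k *: f) = k *: api f.
Proof. exact: esym (quot2_piZ J k f). Qed.
Lemma api0 : api 0 = 0. Proof. exact: (raddf0 (quot2_pi J)). Qed.

Lemma api_rel f : @xs_rel K f -> api f = 0.
Proof.
move=> h; rewrite -api0; apply/eqP/quot2_piP; rewrite subr0.
exact: gen_ideal_in.
Qed.

Local Notation X x := (api (xs_elt K x)).
Local Notation E v := (api (path_basis K (Some (@pid Q v)))).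

Lemma path_basisM (t u : qpath Q) :
  path_basis K (Some t) * path_basis K (Some u) = path_basis K (Defs.pcomp t u) :> KQ.
Proof. exact: path_mul_basis. Qed.

Let EX v x : E v * X x = if v == V1 then X x else 0.
Proof.
rewrite -apiM /xs_elt arrow_eltE path_basisM.
by rewrite pcomp_idl; case: v; case: x => //=; rewrite api0.
Qed.

Let XE v x : X x * E v = if v == xs_target x then X x else 0.
Proof.
rewrite -apiM /xs_elt arrow_eltE path_basisM.
by rewrite pcomp_idr; case: v; case: x => //=; rewrite api0.
Qed.

Let XcX x : X Xc * X x = 0.
Proof. by have := XE V2 Xc => /= <-; rewrite -mulrA EX mulr0. Qed.

Let Xaa : X Xa * X Xa = 0. Proof. by rewrite -apiM; apply/api_rel/xs_rel_aa. Qed.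
Let Xbb : X Xb * X Xb = 0. Proof. by rewrite -apiM; apply/api_rel/xs_rel_bb. Qed.
Let Xac : X Xa * X Xc = 0. Proof. by rewrite -apiM; apply/api_rel/xs_rel_ac. Qed.
Let Xba : X Xb * X Xa = X Xa * X Xb.
Proof.
apply: esym; rewrite -!apiM; apply/eqP/quot2_piP.
exact/gen_ideal_in/xs_rel_ab.
Qed.

Definition xs_bso (o : option xs_path) : A := if o is Some p then xs_bs p else 0.

Lemma arrow_mul_bs x o :
  X x * xs_bso o = xs_bso (xs_compo (Some (xs_arr x)) o).
Proof.
case: o => [r|]; last by rewrite mulr0.
case: r; rewrite /xs_bso /xs_bs /path_elt ?XE ?EX ?apiM ?mulrA.
all: case: x => //=; rewrite ?(XcX, Xaa, Xbb, Xac, Xba, mul0r, apiM) //.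
all: try by rewrite -mulrA ?(Xbb, Xac, mulr0).
(* The remaining case is a(bc) = b(ac) = 0. *)
by rewrite -Xba -mulrA Xac mulr0.
Qed.

(** Peeling off the first arrow reduces this to the products of an arrow with a basis path; it shows
    that the seven basis paths span A. *)
Lemma api_path t : api (path_basis K (Some t)) = xs_bso (path_class t).
Proof.
case: t => [[v s] h]; elim: s v h => [|x s IHs] v h.
  rewrite (_ : exist _ _ _ = @pid Q v); last exact: val_inj.
  by case: v {h}.
have /= /andP[/eqP ev' hs] := h.
rewrite [RHS](_ : _ = xs_bso (xs_compo (Some (xs_arr x)) (path_class (exist _ (xs_target x, s) hs)))) //.
rewrite -arrow_mul_bs -IHs -apiM /xs_elt arrow_eltE; congr (quot2_pi _ _).
rewrite path_basisM.
case: (pcompP (@parrow Q x) (exist _ (xs_target x, s) hs)) => [r _ sr ar _|[]//].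
congr (path_basis K (Some _)); apply: qpath_inj; first by rewrite sr -[LHS]/v -ev'.
by rewrite ar.
Qed.

Lemma xs_bs_co (u : A) : u = \sum_(p <- xs_paths) xs_co p u *: xs_bs p.
Proof.
have [f ->] := quot2_pi_surj u; rewrite -[quot2_pi _ _]/(api f).
rewrite [in LHS](path_algE f).
have apiS (I : Type) (r : seq I) (F : I -> KQ) :
    api (\sum_(i <- r) F i) = \sum_(i <- r) api (F i).
  exact: (big_morph (quot2_pi J) apiD api0).
rewrite apiS; under eq_bigr do rewrite apiZ api_path.
under [RHS]eq_bigr do rewrite xs_coE /rho /ev scaler_suml.
rewrite exchange_big; apply: eq_bigr => t _ /=.
under eq_bigr do rewrite -scalerA.
rewrite -scaler_sumr; congr (_ *: _).
case: (path_class t) => [q|] /=; last by rewrite big1 // => p _; rewrite scale0r.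
exact: (esym (xs_paths_delta (V := A) xs_bs q)).
Qed.

Lemma xs_co_linear p k (u v : A) : xs_co p (k *: u + v) = k * xs_co p u + xs_co p v.
Proof.
have [f ->] := quot2_pi_surj u; have [g ->] := quot2_pi_surj v.
by rewrite -!/(api _) -apiZ -apiD !xs_coE rho_linear.
Qed.

Lemma xs_co_bs p q : xs_co p (xs_bs q) = (xs_path_eq p q)%:R.
Proof. by rewrite xs_coE rho_path_elt. Qed.

Lemma xs_co_inj (u v : A) : (forall p, xs_co p u = xs_co p v) -> u = v.
Proof.
move=> h; rewrite (xs_bs_co u) (xs_bs_co v).
by apply: eq_bigr => p _; rewrite h.
Qed.

Lemma xs_sum_vertex (V : nmodType) (F : xs_vertex -> V) : \sum_v F v = F V1 + F V2.
Proof.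
rewrite (bigD1 V1) //= (bigD1 V2) //= big1 ?addr0 // => v.
by case: v.
Qed.

Lemma xs_bs1 : 1 = xs_bs PE1 + xs_bs PE2.
Proof.
have e : path_elt PE1 + path_elt PE2 = 1 :> KQ.
  exact: esym (xs_sum_vertex (fun v => path_basis K (Some (@pid Q v)))).
by have := apiD (path_elt PE1) (path_elt PE2); rewrite e.
Qed.

Lemma xs_bsM p q :
  xs_bs p * xs_bs q = if xs_comp p q is Some r then xs_bs r else 0.
Proof.
apply: xs_co_inj => r; rewrite -apiM xs_coE rhoM.
have delta q' (F : xs_path -> K) :
    \sum_(s <- xs_paths) (xs_path_eq s q')%:R * F s = F q'.
  exact: (xs_paths_delta (V := K^o) F q').
under eq_bigr do rewrite -mulr_sumr rho_path_elt.
rewrite delta; under eq_bigr do rewrite rho_path_elt.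
rewrite delta; case: (xs_comp p q) => [s|]; first by rewrite xs_co_bs.
by rewrite -api0 xs_coE rho0.
Qed.

Definition xs_alg_basis : xs_basis A :=
  XsBasis xs_co_linear xs_co_bs xs_bs_co xs_bs1 xs_bsM.
End PathClasses.

Theorem theorem7p1 (K : fieldType) (char2 : (2%N \in [pchar K])) :
  exists phi : {lrmorphism KXJ K -> HH (xs_alg K)},
    [/\ bijective phi,
        forall (n : nat) (u : KXJ K), KXJ_deg n u <-> HH_deg n (phi u)
      & is_basis (fun i : N_index => phi (KXJ_pi (N_family K i)))
          (@nil_ideal K (xs_alg K))].
Proof. exact: iso_main (xs_alg_basis K) char2. Qed.
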